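(* Let $d\ge2$, $\nu=d/2-1$, $\ell\ge0$ an integer, $0<R_1<R_2$, and $\alpha_1,\alpha_2>0$. For each angular mode $\ell$, the roots $$0<k_{\ell,1}(\alpha_1,\alpha_2)<k_{\ell,2}(\alpha_1,\alpha_2)<\cdots$$ of the characteristic equation $\Delta_\ell(k;\alpha_1,\alpha_2)=0$ are positive, simple, and satisfy $k_{\ell,p}\to+\infty$ as $p\to\infty$. For each $p$ the map $(\alpha_1,\alpha_2)\mapsto k_{\ell,p}(\alpha_1,\alpha_2)$ is real-analytic on $(0,\infty)^2$ and strictly increasing in each impedance: $$\frac{\partial k_{\ell,p}}{\partial\alpha_1}>0,\qquad \frac{\partial k_{\ell,p}}{\partial\alpha_2}>0.$$ Consequently, every branch is canonically labelled by continuity from the Neumann–Neumann corner $(\alpha_1,\alpha_2)=(0,0)$.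
   Context: With $\mu=\ell+\nu$ and $Z_\mu\in\{J_\mu,Y_\mu\}$ (Bessel functions of the first and second kind), put $$\mathcal B_1[Z_\mu]=R_1^{-\nu}\Bigl[kZ_{\mu+1}(kR_1)+\bigl(\alpha_1-\tfrac{\ell}{R_1}\bigr)Z_\mu(kR_1)\Bigr],\qquad \mathcal B_2[Z_\mu]=R_2^{-\nu}\Bigl[\bigl(\alpha_2+\tfrac{\ell}{R_2}\bigr)Z_\mu(kR_2)-kZ_{\mu+1}(kR_2)\Bigr],$$ $$\Delta_\ell(k;\alpha_1,\alpha_2)=\mathcal B_1[J_\mu]\,\mathcal B_2[Y_\mu]-\mathcal B_2[J_\mu]\,\mathcal B_1[Y_\mu],\qquad k>0.$$ The equation $\Delta_\ell=0$ is the spectral condition, with $\lambda=k^2$, for the Sturm–Liouville problem $u''+\frac{d-1}{r}u'+\bigl(\lambda-\frac{\ell(\ell+d-2)}{r^2}\bigr)u=0$ on $(R_1,R_2)$, $-u'(R_1)+\alpha_1u(R_1)=0$, $u'(R_2)+\alpha_2u(R_2)=0$. ''Simple'' means $\partial_k\Delta_\ell\ne0$ at the root. The Neumann–Neumann corner corresponds to $\alpha_1=\alpha_2=0$ in these boundary conditions. *)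

(* Defs.v *)
From Stdlib Require Import Reals Factorial.
From Coquelicot Require Import Coquelicot.
Open Scope R_scope.

(* 1/Gamma on the whole real line, by Gauss's product: the limit of
   z (z+1) ... (z+n) / (n! n^z).  It vanishes at the poles 0, -1, -2, ... of
   Gamma, as the series of J of negative order requires. *)
Definition rgamma (z : R) : R :=
  real (Lim_seq (fun n : nat =>
    prod_f_R0 (fun j => z + INR j) n / (INR (fact n) * Rpower (INR n) z))).

(* Bessel functions of real order; meaningful for x > 0 only, since [Rpower] is
   the real power of a positive base. *)
Definition bessel_J (mu x : R) : R :=
  Rpower (x / 2) mu *
  Series (fun m : nat =>
    (-1) ^ m * rgamma (INR m + mu + 1) / INR (fact m) * (x / 2) ^ (2 * m)).

Definition bessel_Y_quotient (mu x : R) : R :=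
  (bessel_J mu x * cos (mu * PI) - bessel_J (- mu) x) / sin (mu * PI).

(* At integer orders, where the quotient is 0/0, Y is its limit in the order;
   [Lim] does not use the value at the limit point. *)
Definition bessel_Y (mu x : R) : R :=
  if Req_EM_T (sin (mu * PI)) 0
  then real (Lim (fun s => bessel_Y_quotient s x) mu)
  else bessel_Y_quotient mu x.

Definition nu (d : nat) : R := INR d / 2 - 1.

Definition mu (d l : nat) : R := INR l + nu d.

Definition bc1 (d l : nat) (R1 : R) (Z : R -> R -> R) (a1 k : R) : R :=
  Rpower R1 (- nu d) *
  (k * Z (mu d l + 1) (k * R1) + (a1 - INR l / R1) * Z (mu d l) (k * R1)).

Definition bc2 (d l : nat) (R2 : R) (Z : R -> R -> R) (a2 k : R) : R :=
  Rpower R2 (- nu d) *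
  ((a2 + INR l / R2) * Z (mu d l) (k * R2) - k * Z (mu d l + 1) (k * R2)).

Definition Delta_l (d l : nat) (R1 R2 k a1 a2 : R) : R :=
  bc1 d l R1 bessel_J a1 k * bc2 d l R2 bessel_Y a2 k
  - bc2 d l R2 bessel_J a2 k * bc1 d l R1 bessel_Y a1 k.

(* [v] is u'.  The equation holds on the open interval and u, u' are continuous
   up to the (one-sided) endpoints, where the boundary conditions are imposed. *)
Definition SL_eigenvalue (d l : nat) (R1 R2 a1 a2 lam : R) : Prop :=
  exists u v : R -> R,
    continuous_on (fun r => R1 <= r <= R2) u /\
    continuous_on (fun r => R1 <= r <= R2) v /\
    (forall r, R1 < r < R2 ->
       is_derive u r (v r) /\
       exists w, is_derive v r w /\
         w + (INR d - 1) / r * v r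
           + (lam - INR l * (INR l + INR d - 2) / r ^ 2) * u r = 0) /\
    - v R1 + a1 * u R1 = 0 /\
    v R2 + a2 * u R2 = 0 /\
    (exists r, R1 <= r <= R2 /\ u r <> 0).

(* f is, near (a,b), the sum of an absolutely convergent double power series
   centred at (a,b). *)
Definition analytic2_at (f : R -> R -> R) (a b : R) : Prop :=
  exists (c : nat -> nat -> R) (rho : R), 0 < rho /\
    forall x y, Rabs (x - a) < rho -> Rabs (y - b) < rho ->
      let t i j := c i j * (x - a) ^ i * (y - b) ^ j in
      (forall i, ex_series (fun j => Rabs (t i j))) /\
      ex_series (fun i => Series (fun j => Rabs (t i j))) /\
      is_series (fun i => Series (fun j => t i j)) (f x y).

Definition quadrant (a : R * R) : Prop := 0 < fst a /\ 0 < snd a.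

Definition tends_at_corner (g : R -> R -> R) (x : R) : Prop :=
  filterlim (fun a : R * R => g (fst a) (snd a))
    (within quadrant (locally ((0, 0) : R * R))) (locally x).

Definition is_branch (d l : nat) (R1 R2 : R) (g : R -> R -> R) : Prop :=
  continuous_on quadrant (fun a : R * R => g (fst a) (snd a)) /\
  forall a1 a2, 0 < a1 -> 0 < a2 ->
    0 < g a1 a2 /\ Delta_l d l R1 R2 (g a1 a2) a1 a2 = 0.

(* Main.v *)
Require Import Defs.
From Stdlib Require Import Reals Lra Lia ZArith.
From Stdlib Require Import Classical_Prop IndefiniteDescription.
From Coquelicot Require Import Coquelicot.
Open Scope R_scope.

(* Up to a nonzero constant, Delta(k; a, b) is u'(R2) + b u(R2), where u is the
   solution of the radial equation with u(R1) = 1, u'(R1) = a.  Lagrange's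
   identity makes the polar angle Theta of (u, u' + b u)(R2) strictly decreasing
   in k, so that the roots are the solutions of Theta = -p PI, p = 0, 1, ...;
   they are simple, and there are infinitely many because u oscillates (Liouville
   transform).  Theta is continuous in (a, b) up to (0, 0), which gives the
   continuity of the roots and their limits at the Neumann corner.  The
   derivatives of the roots come from the same Lagrange identity and the
   constancy of the Wronskian.  Real analyticity follows from a contraction in
   the Banach algebra of absolutely convergent double power series.

   That J and Y are independent solutions is read off the power series; for Y of
   integer order the limit in the order is taken termwise, which needs the
   derivative of 1/Gamma at the integers. *)

(** * Series *)

(** Both impedances enter [Delta_l] with degree one: the data at R2 are affine in a, the condition
    there is affine in b. Derivatives and analyticity of the roots therefore come from equations
    that are affine in each parameter, with coefficients depending on k alone. Two obstacles shape
    the rest. First, k = 0 lies outside the domain of [Delta_l], yet for l = 0 the number 0 is a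
    Neumann eigenvalue and the lowest branch tends to it. Hence the corner values are tied to the
    boundary value problem [SL_eigenvalue], small k is studied separately for l = 0 and l > 0, and
    continuity of the roots is proved by trapping, which also works at 0. Second, a polar angle is
    defined only modulo 2 PI and must be chosen coherently in three variables: it is lifted in k for
    a = b = 0 alone, and a and b are then brought in by explicit angles that are never ambiguous.
    Since d is an integer, the order of the Bessel functions is an integer or a half-integer; in
    both cases the Wronskian of J and Y is shown to be nonzero by looking at x -> 0. *)

Lemma ex_series_of_bounded (a : nat -> R) (M : R) :
  (forall n, 0 <= a n) -> (forall n, sum_n a n <= M) ->
  ex_series a /\ Series a <= M.
Proof.
  intros Ha HM.
  assert (Hex : ex_finite_lim_seq (sum_n a)).
  { apply ex_finite_lim_seq_incr with M; auto.
    intros n; rewrite sum_Sn; unfold plus; simpl; specialize (Ha (S n)); lra. }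
  destruct Hex as [l Hl].
  assert (Hs : is_series a l) by exact Hl.
  split; [exists l; exact Hs|].
  rewrite (is_series_unique _ _ Hs).
  apply (is_lim_seq_le (sum_n a) (fun _ => M) l M); auto using is_lim_seq_const.
Qed.

Lemma sum_n_le_Series (a : nat -> R) (n : nat) :
  (forall n, 0 <= a n) -> ex_series a -> sum_n a n <= Series a.
Proof.
  intros Ha [l Hl]; rewrite (is_series_unique _ _ Hl).
  apply (is_lim_seq_incr_compare (sum_n a) l Hl).
  intros m; rewrite sum_Sn; unfold plus; simpl; specialize (Ha (S m)); lra.
Qed.

Lemma Series_nonneg (a : nat -> R) : (forall n, 0 <= a n) -> ex_series a -> 0 <= Series a.
Proof.
  intros Ha Hex; apply Rle_trans with (sum_n a 0).
  - rewrite sum_O; apply Ha.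
  - apply sum_n_le_Series; auto.
Qed.

Lemma term_le_Series (a : nat -> R) (n : nat) :
  (forall n, 0 <= a n) -> ex_series a -> a n <= Series a.
Proof.
  intros Ha Hex; apply Rle_trans with (sum_n a n); [|apply sum_n_le_Series; auto].
  assert (H0 : forall m, 0 <= sum_n a m).
  { induction m as [|m IH]; [rewrite sum_O; apply Ha|].
    rewrite sum_Sn; unfold plus; simpl; specialize (Ha (S m)); lra. }
  destruct n as [|n]; [rewrite sum_O; lra|].
  rewrite sum_Sn; unfold plus; simpl; specialize (H0 n); lra.
Qed.

Lemma ex_series_Rabs_le (a b : nat -> R) :
  (forall n, Rabs (a n) <= b n) -> ex_series b ->
  ex_series (fun n => Rabs (a n)) /\ ex_series a /\ Rabs (Series a) <= Series b.
Proof.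
  intros Hab Hb.
  assert (H1 : ex_series (fun n => Rabs (a n))).
  { apply (ex_series_le (V := R_CompleteNormedModule)) with b; auto.
    intros n; unfold norm; simpl; unfold abs; simpl; rewrite Rabs_Rabsolu; auto. }
  split; [exact H1|split; [apply ex_series_Rabs; exact H1|]].
  eapply Rle_trans; [apply Series_Rabs; exact H1|].
  apply Series_le; auto. intros n; split; [apply Rabs_pos|auto].
Qed.

Lemma ex_series_shift (a : nat -> R) (n : nat) :
  ex_series a -> ex_series (fun k => a (n + k)%nat).
Proof. intros H; apply (ex_series_incr_n a n); exact H. Qed.

Lemma Series_split (a : nat -> R) (n : nat) :
  ex_series a -> Series a = sum_n a n + Series (fun k => a (S n + k)%nat).
Proof.
  intros H; rewrite (Series_incr_n a (S n)) by (auto; lia).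
  rewrite sum_n_Reals; reflexivity.
Qed.

Lemma is_lim_seq_sum_n (a : nat -> nat -> R) (l : nat -> R) (N : nat) :
  (forall m, is_lim_seq (fun k => a k m) (l m)) ->
  is_lim_seq (fun k => sum_n (a k) N) (sum_n l N).
Proof.
  intros H; induction N as [|N IH].
  - apply is_lim_seq_ext with (fun k => a k 0%nat); [intros; now rewrite sum_O|].
    rewrite sum_O; apply H.
  - apply is_lim_seq_ext with (fun k => sum_n (a k) N + a k (S N));
      [intros; now rewrite sum_Sn|].
    rewrite sum_Sn; apply is_lim_seq_plus'; auto.
Qed.

(** Tannery's theorem. The tails beyond N are bounded by that of [b] uniformly in k, and the first
    terms form a finite sum, where the limit passes termwise. *)
Lemma Series_dominated (a : nat -> nat -> R) (l b : nat -> R) :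
  ex_series b -> (forall k m, Rabs (a k m) <= b m) ->
  (forall m, is_lim_seq (fun k => a k m) (l m)) ->
  (forall m, Rabs (l m) <= b m) /\ is_lim_seq (fun k => Series (a k)) (Series l).
Proof.
  intros Hb Hab Hl.
  assert (Hlb : forall m, Rabs (l m) <= b m).
  { intros m.
    apply (is_lim_seq_le (fun k => Rabs (a k m)) (fun _ => b m) (Rabs (l m)) (b m)); auto.
    - apply (is_lim_seq_abs _ (l m)); apply Hl.
    - apply is_lim_seq_const. }
  split; [exact Hlb|].
  apply is_lim_seq_spec; intros eps; simpl.
  assert (Htail : exists N, Series (fun k => b (S N + k)%nat) < eps / 3).
  { assert (H3 : 0 < eps / 3) by (apply Rdiv_lt_0_compat; [apply eps|lra]).
    assert (H' : is_lim_seq (sum_n b) (Series b)) by exact (Series_correct _ Hb).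
    apply is_lim_seq_spec in H'.
    destruct (H' (mkposreal _ H3)) as [N' HN']; simpl in HN'.
    exists N'; specialize (HN' N' (le_n _)).
    rewrite (Series_split b N' Hb) in HN'.
    apply Rabs_def2 in HN'; lra. }
  destruct Htail as [N HN].
  assert (Hfin := is_lim_seq_sum_n a l N Hl); apply is_lim_seq_spec in Hfin.
  assert (H3 : 0 < eps / 3) by (apply Rdiv_lt_0_compat; [apply eps|lra]).
  destruct (Hfin (mkposreal _ H3)) as [K HK]; simpl in HK.
  exists K; intros k Hk; specialize (HK k Hk).
  destruct (ex_series_Rabs_le (a k) b (Hab k) Hb) as (_ & Hak & _).
  destruct (ex_series_Rabs_le l b Hlb Hb) as (_ & Hlex & _).
  rewrite (Series_split (a k) N Hak), (Series_split l N Hlex).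
  assert (Hbs := ex_series_shift b (S N) Hb).
  destruct (ex_series_Rabs_le (fun j => a k (S N + j)%nat) (fun j => b (S N + j)%nat)) as (_ & _ & T1); auto.
  destruct (ex_series_Rabs_le (fun j => l (S N + j)%nat) (fun j => b (S N + j)%nat)) as (_ & _ & T2); auto.
  apply Rabs_def2 in HK.
  apply Rabs_le_between in T1; apply Rabs_le_between in T2.
  apply Rabs_def1; lra.
Qed.

Lemma sum_n_Series (a : nat -> nat -> R) (N : nat) :
  (forall i, ex_series (a i)) ->
  ex_series (fun j => sum_n (fun i => a i j) N) /\
  sum_n (fun i => Series (a i)) N = Series (fun j => sum_n (fun i => a i j) N).
Proof.
  intros H; induction N as [|N [IH1 IH2]].
  - split.
    + apply ex_series_ext with (a 0%nat); auto. intros; now rewrite sum_O.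
    + rewrite sum_O; apply Series_ext; intros; now rewrite sum_O.
  - split.
    + apply ex_series_ext with (fun j => sum_n (fun i => a i j) N + a (S N) j).
      * intros; now rewrite sum_Sn.
      * apply (ex_series_plus (V := R_NormedModule)); auto.
    + rewrite sum_Sn, IH2; unfold plus; simpl.
      rewrite <- Series_plus by auto.
      apply Series_ext; intros; now rewrite sum_Sn.
Qed.

(** Fubini for absolutely summable double series. The sum of the first N rows passes under the
    series over j; as N grows, the column sums of absolute values dominate, so the limit is the sum
    by columns. *)
Lemma Series_swap (a : nat -> nat -> R) :
  (forall i, ex_series (fun j => Rabs (a i j))) ->
  ex_series (fun i => Series (fun j => Rabs (a i j))) ->
  (forall j, ex_series (fun i => Rabs (a i j))) /\
  ex_series (fun j => Series (fun i => Rabs (a i j))) /\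
  Series (fun j => Series (fun i => Rabs (a i j)))
    <= Series (fun i => Series (fun j => Rabs (a i j))) /\
  Series (fun i => Series (a i)) = Series (fun j => Series (fun i => a i j)).
Proof.
  intros Hi Hs.
  assert (Hcol : forall j, ex_series (fun i => Rabs (a i j))).
  { intros j; apply (ex_series_Rabs_le (fun i => a i j) (fun i => Series (fun j => Rabs (a i j)))); auto.
    intros i; apply (term_le_Series (fun j => Rabs (a i j))); auto using Rabs_pos. }
  assert (Hcols : ex_series (fun j => Series (fun i => Rabs (a i j))) /\
     Series (fun j => Series (fun i => Rabs (a i j)))
       <= Series (fun i => Series (fun j => Rabs (a i j)))).
  { apply ex_series_of_bounded.
    - intros j; apply Series_nonneg; auto using Rabs_pos.
    - intros N.
      destruct (sum_n_Series (fun j i => Rabs (a i j)) N Hcol) as [E1 ->].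
      apply Series_le; auto. intros i; split.
      + rewrite sum_n_Reals; apply cond_pos_sum; intros; apply Rabs_pos.
      + apply (sum_n_le_Series (fun j => Rabs (a i j))); auto using Rabs_pos. }
  destruct Hcols as [Hcols Hle].
  repeat split; auto.
  assert (Hlim : is_lim_seq (fun N => Series (fun j => sum_n (fun i => a i j) N))
                   (Series (fun j => Series (fun i => a i j)))).
  { apply (Series_dominated _ _ (fun j => Series (fun i => Rabs (a i j)))); auto.
    - intros N j.
      apply Rle_trans with (sum_n (fun i => Rabs (a i j)) N).
      + rewrite !sum_n_Reals; apply Rsum_abs.
      + apply (sum_n_le_Series (fun i => Rabs (a i j))); auto using Rabs_pos.
    - intros j; apply (Series_correct (fun i => a i j)).
      apply ex_series_Rabs; auto. }
  assert (Hlim2 : is_lim_seq (sum_n (fun i => Series (a i))) (Series (fun i => Series (a i)))).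
  { apply (Series_correct (fun i => Series (a i))).
    apply (ex_series_Rabs_le _ (fun i => Series (fun j => Rabs (a i j)))); auto.
    intros i; apply Series_Rabs; auto. }
  assert (Heq : Finite (Series (fun i => Series (a i)))
                = Finite (Series (fun j => Series (fun i => a i j)))).
  { rewrite <- (is_lim_seq_unique _ _ Hlim), <- (is_lim_seq_unique _ _ Hlim2).
    apply Lim_seq_ext; intros N.
    apply (sum_n_Series a N). intros i; apply ex_series_Rabs; auto. }
  now injection Heq.
Qed.

Lemma is_series_scal_R (c : R) (a : nat -> R) (l : R) :
  is_series a l -> is_series (fun n => c * a n) (c * l).
Proof. exact (is_series_scal_l (V := R_NormedModule) c a l). Qed.

Lemma is_series_geom_R (c q : R) : 0 <= q < 1 -> is_series (fun n => c * q ^ n) (c * / (1 - q)).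
Proof.
  intros Hq; apply is_series_scal_R, is_series_geom; rewrite Rabs_pos_eq; lra.
Qed.

(** * Banach algebras of power series *)

(* [P f M] reads: f belongs to a Banach algebra of functions on D, with norm at
   most M. *)
Record fun_alg {X : Type} (D : X -> Prop) (P : (X -> R) -> R -> Prop) : Prop := {
  fa_bound : forall f M x, P f M -> D x -> Rabs (f x) <= M;
  fa_ge0 : forall f M, P f M -> 0 <= M;
  fa_ext : forall f g M, (forall x, D x -> f x = g x) -> P f M -> P g M;
  fa_le : forall f M M', M <= M' -> P f M -> P f M';
  fa_const : forall c, P (fun _ => c) (Rabs c);
  fa_mult : forall f g M N, P f M -> P g N -> P (fun x => f x * g x) (M * N);
  fa_series : forall f M, (forall n, P (f n) (M n)) -> ex_series M ->
    P (fun x => Series (fun n => f n x)) (Series M) }.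

Arguments fa_bound {X D P}.
Arguments fa_ge0 {X D P}.
Arguments fa_ext {X D P}.
Arguments fa_le {X D P}.
Arguments fa_const {X D P}.
Arguments fa_mult {X D P}.
Arguments fa_series {X D P}.

Lemma is_series_two (a : nat -> R) :
  (forall n, a (S (S n)) = 0) -> is_series a (a 0%nat + a 1%nat).
Proof.
  intros H; apply (filterlim_ext_loc (fun _ => a 0%nat + a 1%nat)).
  - exists 1%nat; intros n Hn; symmetry; induction n as [|n IH]; [lia|].
    rewrite sum_Sn; unfold plus; simpl; destruct n as [|n].
    + now rewrite sum_O.
    + rewrite IH by lia; rewrite H; ring.
  - apply filterlim_const.
Qed.

Section FunAlg.
Context {X : Type} {D : X -> Prop} {P : (X -> R) -> R -> Prop} (HP : fun_alg D P).

Lemma fa_zero : P (fun _ => 0) 0.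
Proof using HP. apply (fa_le HP _ (Rabs 0)); [rewrite Rabs_R0; lra|apply (fa_const HP)]. Qed.

Lemma fa_one : P (fun _ => 1) 1.
Proof using HP. apply (fa_le HP _ (Rabs 1)); [rewrite Rabs_R1; lra|apply (fa_const HP)]. Qed.

(** Sums come from [fa_series] applied to a family whose members beyond the second are zero;
    completeness is the only additive axiom of [fun_alg]. *)
Lemma fa_plus (f g : X -> R) (M N : R) :
  P f M -> P g N -> P (fun x => f x + g x) (M + N).
Proof using HP.
  intros Hf Hg.
  set (F := fun n => match n with O => f | 1%nat => g | _ => fun _ => 0 end).
  set (K := fun n => match n with O => M | 1%nat => N | _ => 0 end).
  assert (HK := is_series_two K (fun n => eq_refl)).
  assert (H := fa_series HP F K).
  rewrite (is_series_unique _ _ HK) in H.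
  eapply (fa_ext HP); [|apply H].
  - intros x _; apply (is_series_unique _ (f x + g x)).
    apply (is_series_two (fun n => F n x) (fun n => eq_refl)).
  - intros [|[|n]]; simpl; auto.
    apply fa_zero.
  - eexists; exact HK.
Qed.

Lemma fa_scal (c : R) (f : X -> R) (M : R) :
  P f M -> P (fun x => c * f x) (Rabs c * M).
Proof using HP. intros Hf; apply (fa_mult HP (fun _ => c) f); auto using (fa_const HP). Qed.

Lemma fa_minus (f g : X -> R) (M N : R) :
  P f M -> P g N -> P (fun x => f x - g x) (M + N).
Proof using HP.
  intros Hf Hg; apply (fa_ext HP (fun x => f x + (-1) * g x)); [intros; ring|].
  apply fa_plus; auto.
  apply (fa_le HP _ (Rabs (-1) * N)); [|apply fa_scal; auto].
  replace (Rabs (-1)) with 1; [lra|].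
  rewrite Rabs_left; lra.
Qed.

Lemma fa_pow (f : X -> R) (M : R) (n : nat) : P f M -> P (fun x => f x ^ n) (M ^ n).
Proof using HP.
  intros Hf; induction n as [|n IH]; simpl.
  - apply fa_one.
  - apply (fa_mult HP); auto.
Qed.

Lemma fa_sum (f : nat -> X -> R) (M : nat -> R) (n : nat) :
  (forall i, P (f i) (M i)) -> P (fun x => sum_f_R0 (fun i => f i x) n) (sum_f_R0 M n).
Proof using HP.
  intros H; induction n as [|n IH]; simpl; [apply H|].
  apply fa_plus; auto.
Qed.

End FunAlg.

(** The real field with its absolute value, seen as functions on a one-point space: the ground
    algebra to which variables are adjoined. *)
Definition base_alg (f : unit -> R) (M : R) : Prop := Rabs (f tt) <= M.

Lemma base_alg_fun_alg : fun_alg (fun _ => True) base_alg.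
Proof.
  unfold base_alg; constructor.
  - intros f M [] H _; exact H.
  - intros f M H; eapply Rle_trans; [apply Rabs_pos|exact H].
  - intros f g M H; rewrite (H tt I); auto.
  - intros; lra.
  - intros; lra.
  - intros f g M N H1 H2; rewrite Rabs_mult; apply Rmult_le_compat; auto using Rabs_pos.
  - intros f M H1 H2; apply (ex_series_Rabs_le (fun n => f n tt) M); auto.
Qed.

(** * Adjoining a variable to a Banach algebra *)

Definition adj_dom {X : Type} (D : X -> Prop) (rho : R) (z : X * R) : Prop :=
  D (fst z) /\ Rabs (snd z) <= rho.

(** Power series in one new variable with coefficients in the algebra, under the weighted l^1 norm
    at radius [rho]. A majorant [N] of the norms of the coefficients is part of the witness: [P]
    only knows upper bounds, so no infimum has to be taken. *)
Definition adj {X : Type} (D : X -> Prop) (P : (X -> R) -> R -> Prop) (rho : R)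
    (f : X * R -> R) (M : R) : Prop :=
  exists (g : nat -> X -> R) (N : nat -> R),
    (forall i, P (g i) (N i)) /\
    ex_series (fun i => N i * rho ^ i) /\
    Series (fun i => N i * rho ^ i) <= M /\
    forall x s, D x -> Rabs s <= rho -> f (x, s) = Series (fun i => g i x * s ^ i).

Section Adjunction.
Context {X : Type} {D : X -> Prop} {P : (X -> R) -> R -> Prop} (HP : fun_alg D P).
Context {rho : R} (Hrho : 0 < rho).

Lemma adj_term_le (g : nat -> X -> R) (N : nat -> R) (x : X) (s : R) :
  (forall i, P (g i) (N i)) -> D x -> Rabs s <= rho ->
  forall i, Rabs (g i x * s ^ i) <= N i * rho ^ i.
Proof using HP.
  intros Hg Hx Hs i; rewrite Rabs_mult, <- RPow_abs.
  apply Rmult_le_compat; auto using Rabs_pos, pow_le.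
  - apply (fa_bound HP _ _ _ (Hg i) Hx).
  - apply pow_incr; split; auto using Rabs_pos.
Qed.

Lemma adj_nonneg (g : nat -> X -> R) (N : nat -> R) :
  (forall i, P (g i) (N i)) -> forall i, 0 <= N i * rho ^ i.
Proof using HP Hrho.
  intros Hg i; apply Rmult_le_pos; [apply (fa_ge0 HP _ _ (Hg i))|apply pow_le; lra].
Qed.

Lemma adj_lift (f : X -> R) (M : R) : P f M -> adj D P rho (fun z => f (fst z)) M.
Proof using HP.
  intros Hf.
  exists (fun i => match i with O => f | _ => fun _ => 0 end),
         (fun i => match i with O => M | _ => 0 end).
  assert (H1 := is_series_two
    (fun i => (match i with O => M | _ => 0 end) * rho ^ i) (fun n => Rmult_0_l _)).
  repeat split.
  - intros [|i]; auto. apply (fa_zero HP).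
  - eexists; exact H1.
  - rewrite (is_series_unique _ _ H1); simpl; lra.
  - intros x s _ _; symmetry; simpl.
    rewrite (is_series_unique _ (f x * s ^ 0 + 0 * s ^ 1)).
    + simpl; ring.
    + apply (is_series_two (fun i =>
        (match i with O => f | _ => fun _ => 0 end) x * s ^ i) (fun n => Rmult_0_l _)).
Qed.

Lemma adj_var : adj D P rho (fun z => snd z) rho.
Proof using HP.
  exists (fun i => match i with 1%nat => fun _ => 1 | _ => fun _ => 0 end),
         (fun i => match i with 1%nat => 1 | _ => 0 end).
  assert (H1 := is_series_two
    (fun i => (match i with 1%nat => 1 | _ => 0 end) * rho ^ i) (fun n => Rmult_0_l _)).
  repeat split.
  - intros [|[|i]]; auto using (fa_zero HP), (fa_one HP).
  - eexists; exact H1.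
  - rewrite (is_series_unique _ _ H1); simpl; lra.
  - intros x s _ _; symmetry; simpl.
    rewrite (is_series_unique _ (0 * s ^ 0 + 1 * s ^ 1)).
    + simpl; ring.
    + apply (is_series_two (fun i =>
        (match i with 1%nat => fun _ => 1 | _ => fun _ => 0 end) x * s ^ i)
        (fun n => Rmult_0_l _)).
Qed.

(** Cauchy product of the coefficients and, in parallel, of the majorants, whose sum is the product
    of the two norms. *)
Lemma adj_mult (f h : X * R -> R) (M N : R) :
  adj D P rho f M -> adj D P rho h N -> adj D P rho (fun z => f z * h z) (M * N).
Proof using HP Hrho.
  intros (g & K & Hg & HK & HM & Hf) (g' & K' & Hg' & HK' & HN & Hh).
  assert (P1 := adj_nonneg g K Hg). assert (P2 := adj_nonneg g' K' Hg').
  exists (fun n x => sum_f_R0 (fun i => g i x * g' (n - i)%nat x) n),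
         (fun n => sum_f_R0 (fun i => K i * K' (n - i)%nat) n).
  assert (Hpow : forall (u v : nat -> R) s n,
    sum_f_R0 (fun i => u i * s ^ i * (v (n - i)%nat * s ^ (n - i))) n
    = sum_f_R0 (fun i => u i * v (n - i)%nat) n * s ^ n).
  { intros u v s n; rewrite (Rmult_comm _ (s ^ n)), scal_sum.
    apply sum_eq; intros i Hi.
    replace (s ^ n) with (s ^ i * s ^ (n - i)); [ring|].
    rewrite <- pow_add; f_equal; lia. }
  assert (Habs : forall u : nat -> R, (forall i, 0 <= u i) -> ex_series u ->
     ex_series (fun i => Rabs (u i))).
  { intros u Hu Hex; apply ex_series_ext with u; auto.
    intros i; now rewrite Rabs_pos_eq. }
  assert (HS := is_series_mult _ _ _ _ (Series_correct _ HK) (Series_correct _ HK')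
                 (Habs _ P1 HK) (Habs _ P2 HK')).
  apply (is_series_ext _ _ _ (Hpow K K' rho)) in HS.
  repeat split.
  - intros n; apply (fa_sum HP (fun i x => g i x * g' (n - i)%nat x)).
    intros i; apply (fa_mult HP); auto.
  - eexists; exact HS.
  - rewrite (is_series_unique _ _ HS).
    apply Rmult_le_compat; auto using Series_nonneg.
  - intros x s Hx Hs; rewrite Hf, Hh by auto.
    destruct (ex_series_Rabs_le _ _ (adj_term_le g K x s Hg Hx Hs) HK) as (A1 & B1 & _).
    destruct (ex_series_Rabs_le _ _ (adj_term_le g' K' x s Hg' Hx Hs) HK') as (A2 & B2 & _).
    symmetry; apply is_series_unique.
    assert (HS' := is_series_mult _ _ _ _ (Series_correct _ B1) (Series_correct _ B2) A1 A2).
    apply (is_series_ext _ _ _ (Hpow (fun i => g i x) (fun i => g' i x) s)) in HS'.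
    exact HS'.
Qed.

(** Completeness of the adjoined algebra. The majorants form a nonnegative double series summable by
    rows; its columns give majorants for the coefficients of the sum, and the same exchange of
    summations identifies the sum itself. *)
Lemma adj_series (f : nat -> X * R -> R) (M : nat -> R) :
  (forall n, adj D P rho (f n) (M n)) -> ex_series M ->
  adj D P rho (fun z => Series (fun n => f n z)) (Series M).
Proof using HP Hrho.
  intros Hf HM.
  assert (Hch : forall n, exists gN : (nat -> X -> R) * (nat -> R),
    (forall i, P (fst gN i) (snd gN i)) /\
    ex_series (fun i => snd gN i * rho ^ i) /\
    Series (fun i => snd gN i * rho ^ i) <= M n /\
    forall x s, D x -> Rabs s <= rho -> f n (x, s) = Series (fun i => fst gN i x * s ^ i)).
  { intros n; destruct (Hf n) as (g & N & H); exists (g, N); exact H. }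
  apply functional_choice in Hch; destruct Hch as [gN H].
  set (g := fun n => fst (gN n)). set (N := fun n => snd (gN n)).
  assert (Hg : forall n i, P (g n i) (N n i)) by (intros n; apply (H n)).
  assert (HN : forall n, ex_series (fun i => N n i * rho ^ i)) by (intros n; apply (H n)).
  assert (HNM : forall n, Series (fun i => N n i * rho ^ i) <= M n) by (intros n; apply (H n)).
  assert (Hfg : forall n x s, D x -> Rabs s <= rho ->
     f n (x, s) = Series (fun i => g n i x * s ^ i)) by (intros n; apply (H n)).
  clearbody g N; clear H gN.
  assert (Hpos : forall n i, 0 <= N n i * rho ^ i) by (intros n; apply (adj_nonneg (g n)); auto).
  assert (Habs : forall n i, Rabs (N n i * rho ^ i) = N n i * rho ^ i)
    by (intros; apply Rabs_pos_eq; auto).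
  assert (HSM : ex_series (fun n => Series (fun i => N n i * rho ^ i)) /\
     Series (fun n => Series (fun i => N n i * rho ^ i)) <= Series M).
  { assert (Hb : forall n, 0 <= Series (fun i => N n i * rho ^ i) <= M n).
    { intros n; split; auto. apply Series_nonneg; auto. }
    split; [|apply Series_le; auto].
    apply (ex_series_Rabs_le _ M); auto. intros n; rewrite Rabs_pos_eq; apply Hb. }
  destruct HSM as [HS1 HS2].
  destruct (Series_swap (fun n i => N n i * rho ^ i)) as (C1 & C2 & C3 & C4).
  { intros n; apply ex_series_ext with (fun i => N n i * rho ^ i); auto. }
  { eapply ex_series_ext; [|exact HS1]. intros n; apply Series_ext; intros; now rewrite Habs. }
  assert (Hcol : forall i, ex_series (fun n => N n i)).
  { intros i.
    assert (E : forall n, Rabs (N n i * rho ^ i) * / rho ^ i = N n i).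
    { intros n; rewrite Habs; field; apply pow_nonzero; lra. }
    apply (ex_series_ext _ _ E), ex_series_scal_r; auto. }
  assert (Hcolr : forall i, Series (fun n => N n i) * rho ^ i = Series (fun n => N n i * rho ^ i)).
  { intros i; now rewrite Series_scal_r. }
  exists (fun i x => Series (fun n => g n i x)), (fun i => Series (fun n => N n i)).
  repeat split.
  - intros i; apply (fa_series HP); auto.
  - eapply ex_series_ext; [|exact C2]; intros i; simpl; rewrite Hcolr.
    apply Series_ext; intros; apply Habs.
  - rewrite (Series_ext _ (fun i => Series (fun n => N n i * rho ^ i))) by (intros; apply Hcolr).
    simpl in C4; eapply Rle_trans; [|exact HS2]; right; symmetry; exact C4.
  - intros x s Hx Hs.
    rewrite (Series_ext _ (fun n => Series (fun i => g n i x * s ^ i)))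
      by (intros; apply Hfg; auto).
    assert (T : forall n, ex_series (fun i => Rabs (g n i x * s ^ i)) /\
                          Series (fun i => Rabs (g n i x * s ^ i)) <= Series (fun i => N n i * rho ^ i)).
    { intros n; split.
      - apply (ex_series_Rabs_le (fun i => g n i x * s ^ i) (fun i => N n i * rho ^ i)); auto.
        apply adj_term_le; auto.
      - apply Series_le; auto; intros i; split; [apply Rabs_pos|apply adj_term_le; auto]. }
    destruct (Series_swap (fun n i => g n i x * s ^ i)) as (_ & _ & _ & E).
    + apply T.
    + apply (ex_series_Rabs_le _ (fun n => Series (fun i => N n i * rho ^ i))); auto.
      intros n; rewrite Rabs_pos_eq; [apply T|apply Series_nonneg; [intros; apply Rabs_pos|apply T]].
    + etransitivity; [exact E|].
      apply Series_ext; intros i; now rewrite Series_scal_r.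
Qed.

Lemma adj_fun_alg : fun_alg (adj_dom D rho) (adj D P rho).
Proof using HP Hrho.
  constructor.
  - intros f M [x s] (g & N & Hg & HN & HM & Hf) [Hx Hs]; simpl in *.
    rewrite Hf by auto.
    eapply Rle_trans; [|exact HM].
    apply (ex_series_Rabs_le _ (fun i => N i * rho ^ i)); auto.
    apply adj_term_le; auto.
  - intros f M (g & N & Hg & HN & HM & Hf).
    apply Rle_trans with (2 := HM), Series_nonneg; auto.
    apply (adj_nonneg g); auto.
  - intros f h M Hfh (g & N & Hg & HN & HM & Hf).
    exists g, N; repeat split; auto.
    intros x s Hx Hs; rewrite <- Hfh; auto. split; auto.
  - intros f M M' HMM (g & N & Hg & HN & HM & Hf).
    exists g, N; repeat split; auto; lra.
  - intros c; apply (adj_lift (fun _ => c)); apply (fa_const HP).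
  - apply adj_mult.
  - apply adj_series.
Qed.

End Adjunction.

(** * Contraction in a Banach algebra of functions *)

Section FixedPoint.
Context {X : Type} {D : X -> Prop} {P : (X -> R) -> R -> Prop} (HP : fun_alg D P).
Variables (C : nat -> X -> R) (gam : nat -> R) (r : R).
Hypothesis Hr : 0 < r.
Hypothesis HC : forall n, P (C n) (gam n).
Hypothesis Hg0 : ex_series (fun n => gam n * r ^ n).
Hypothesis Hg1 : ex_series (fun n => gam n * (INR n * r ^ pred n)).

Let Phi (f : X -> R) (x : X) : R := Series (fun n => C n x * f x ^ n).

(** Telescoping of f^n - h^n. The factor n r^(n-1) is the derivative of z^n at r, so summing against
    [gam] gives the derivative of the majorant series: the Lipschitz constant of [Phi] on the ball
    of radius r. *)
Lemma fa_pow_diff (f h : X -> R) (e : R) (n : nat) :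
  P f r -> P h r -> P (fun x => f x - h x) e ->
  P (fun x => f x ^ n - h x ^ n) (e * (INR n * r ^ pred n)).
Proof using HP.
  intros Hf Hh He; induction n as [|n IH].
  - apply (fa_ext HP (fun _ => 0)); [intros; simpl; ring|].
    apply (fa_le HP _ 0); [simpl; lra|apply (fa_zero HP)].
  - apply (fa_ext HP (fun x => f x * (f x ^ n - h x ^ n) + (f x - h x) * h x ^ n));
      [intros; simpl; ring|].
    apply (fa_le HP _ (r * (e * (INR n * r ^ pred n)) + e * r ^ n)).
    + destruct n as [|n]; [simpl; lra|]. rewrite (S_INR (S n)); simpl pred.
      change (r ^ S n) with (r * r ^ n); apply Req_le; ring.
    + apply (fa_plus HP); apply (fa_mult HP); auto.
      apply (fa_pow HP); auto.
Qed.

Lemma fa_Phi_term (f : X -> R) (x : X) : P f r -> D x ->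
  ex_series (fun n => C n x * f x ^ n).
Proof using HP HC Hg0 Hr.
  intros Hf Hx.
  apply (ex_series_Rabs_le _ (fun n => gam n * r ^ n)); auto.
  intros n; apply (fa_bound HP (fun x => C n x * f x ^ n)); auto.
  apply (fa_mult HP); auto. apply (fa_pow HP); auto.
Qed.

Lemma fa_Phi_diff (f h : X -> R) (e : R) :
  P f r -> P h r -> P (fun x => f x - h x) e ->
  P (fun x => Phi f x - Phi h x) (e * Series (fun n => gam n * (INR n * r ^ pred n))).
Proof using HP HC Hg0 Hg1 Hr.
  intros Hf Hh He.
  apply (fa_ext HP (fun x => Series (fun n => C n x * (f x ^ n - h x ^ n)))).
  - intros x Hx; unfold Phi; rewrite <- Series_minus by (apply fa_Phi_term; auto).
    apply Series_ext; intros; ring.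
  - rewrite <- Series_scal_l.
    apply (fa_series HP (fun n x => C n x * (f x ^ n - h x ^ n))).
    + intros n; apply (fa_le HP _ (gam n * (e * (INR n * r ^ pred n)))); [lra|].
      apply (fa_mult HP (C n)); auto. apply fa_pow_diff; auto.
    + apply (ex_series_scal_l (V := R_NormedModule)); auto.
Qed.

Fixpoint picard (N : nat) : X -> R :=
  match N with O => fun _ => 0 | S N => Phi (picard N) end.

Hypothesis Hhalf : Series (fun n => gam n * (INR n * r ^ pred n)) <= 1 / 2.
Hypothesis Hsmall : gam 0%nat <= r / 2.

(** The two bounds support each other: contraction applies to iterates that stay in the ball of
    radius r, and they stay there because the increments r/2 2^(-N) add up to r. *)
Lemma fa_picard (N : nat) :
  P (picard N) (r * (1 - (1 / 2) ^ N)) /\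
  P (fun x => picard (S N) x - picard N x) (r / 2 * (1 / 2) ^ N).
Proof using HP HC Hg0 Hg1 Hr Hhalf Hsmall.
  induction N as [|N [IH1 IH2]].
  - split; simpl.
    + apply (fa_le HP _ 0); [lra|apply (fa_zero HP)].
    + apply (fa_ext HP (C 0%nat)).
      * intros x Hx; unfold Phi.
        rewrite (is_series_unique _ (C 0%nat x * 0 ^ 0 + C 1%nat x * 0 ^ 1)).
        -- simpl; ring.
        -- apply (is_series_two (fun n => C n x * 0 ^ n)); intros; simpl; ring.
      * apply (fa_le HP _ (gam 0%nat)); auto; lra.
  - assert (Hp : 0 < (1 / 2) ^ N) by (apply pow_lt; lra).
    assert (H1 : P (picard (S N)) (r * (1 - (1 / 2) ^ S N))).
    { apply (fa_ext HP (fun x => picard N x + (picard (S N) x - picard N x)));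
        [intros; ring|].
      apply (fa_le HP _ (r * (1 - (1 / 2) ^ N) + r / 2 * (1 / 2) ^ N)).
      - change ((1 / 2) ^ S N) with (1 / 2 * (1 / 2) ^ N); lra.
      - apply (fa_plus HP); auto. }
    split; auto.
    assert (Hle : forall M, P (picard M) (r * (1 - (1 / 2) ^ M)) -> P (picard M) r).
    { intros M; apply (fa_le HP). assert (0 < (1 / 2) ^ M) by (apply pow_lt; lra); nra. }
    apply (fa_le HP _ (r / 2 * (1 / 2) ^ N * Series (fun n => gam n * (INR n * r ^ pred n)))).
    + change ((1 / 2) ^ S N) with (1 / 2 * (1 / 2) ^ N).
      replace (r / 2 * (1 / 2 * (1 / 2) ^ N)) with (r / 2 * (1 / 2) ^ N * (1 / 2)) by field.
      apply Rmult_le_compat_l; auto; apply Rmult_le_pos; lra.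
    + apply (fa_Phi_diff (picard (S N)) (picard N)); [apply Hle; exact H1|apply Hle; exact IH1|exact IH2].
Qed.

End FixedPoint.

Lemma Phi_lipschitz (c gam : nat -> R) (r z w : R) :
  0 < r -> (forall n, Rabs (c n) <= gam n) ->
  ex_series (fun n => gam n * r ^ n) ->
  ex_series (fun n => gam n * (INR n * r ^ pred n)) ->
  Series (fun n => gam n * (INR n * r ^ pred n)) <= 1 / 2 ->
  Rabs z <= r -> Rabs w <= r ->
  Rabs (Series (fun n => c n * z ^ n) - Series (fun n => c n * w ^ n))
    <= Rabs (z - w) * (1 / 2).
Proof.
  intros Hr Hc H0 H1 H2 Hz Hw.
  eapply Rle_trans.
  - apply (fa_Phi_diff base_alg_fun_alg (fun n _ => c n) gam r Hr Hc H0 H1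
             (fun _ => z) (fun _ => w) (Rabs (z - w)) Hz Hw).
    apply Rle_refl.
  - apply Rmult_le_compat_l; auto using Rabs_pos.
Qed.

(** The fixed point is the sum of the Picard increments, so [fa_series] places it in the algebra.
    The equation and uniqueness are then checked at each point with the scalar contraction;
    uniqueness holds among all real z in the ball, which later identifies a root given only as a
    number. *)
Lemma fa_fixed_point {X : Type} {D : X -> Prop} {P : (X -> R) -> R -> Prop}
    (HP : fun_alg D P) (C : nat -> X -> R) (gam : nat -> R) (r : R) :
  0 < r -> (forall n, P (C n) (gam n)) ->
  ex_series (fun n => gam n * r ^ n) ->
  ex_series (fun n => gam n * (INR n * r ^ pred n)) ->
  Series (fun n => gam n * (INR n * r ^ pred n)) <= 1 / 2 ->
  gam 0%nat <= r / 2 ->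
  exists g, P g r /\ forall x, D x ->
    g x = Series (fun n => C n x * g x ^ n) /\
    forall z, Rabs z <= r -> z = Series (fun n => C n x * z ^ n) -> z = g x.
Proof.
  intros Hr HC H0 H1 H2 H3.
  assert (Hpic := fa_picard HP C gam r Hr HC H0 H1 H2 H3).
  set (x_ := picard C) in *.
  assert (Hgeo : is_series (fun N => r / 2 * (1 / 2) ^ N) r).
  { assert (E : is_series (fun N => r / 2 * (1 / 2) ^ N) (r / 2 * / (1 - 1 / 2)))
      by (apply is_series_geom_R; lra).
    replace (r / 2 * / (1 - 1 / 2)) with r in E by field; exact E. }
  set (g := fun x => Series (fun N => x_ (S N) x - x_ N x)).
  assert (Hg : P g r).
  { rewrite <- (is_series_unique _ _ Hgeo).
    apply (fa_series HP (fun N x => x_ (S N) x - x_ N x)); [apply Hpic|].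
    eexists; exact Hgeo. }
  exists g; split; auto.
  intros x Hx.
  assert (Hlip : forall z w, Rabs z <= r -> Rabs w <= r ->
    Rabs (Series (fun n => C n x * z ^ n) - Series (fun n => C n x * w ^ n))
    <= Rabs (z - w) * (1 / 2)).
  { intros z w; apply (Phi_lipschitz (fun n => C n x) gam); auto.
    intros n; apply (fa_bound HP (C n)); auto. }
  assert (Hgx : Rabs (g x) <= r) by (apply (fa_bound HP g); auto).
  assert (Hfix : g x = Series (fun n => C n x * g x ^ n)).
  { assert (Hxr : forall N, Rabs (x_ N x) <= r).
    { intros N; apply (fa_bound HP (x_ N)); auto.
      eapply (fa_le HP); [|apply Hpic].
      assert (0 < (1 / 2) ^ N) by (apply pow_lt; lra); nra. }
    assert (Hlim : is_lim_seq (fun N => x_ (S N) x) (g x)).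
    { assert (Hex : ex_series (fun N => x_ (S N) x - x_ N x)).
      { apply (ex_series_Rabs_le _ (fun N => r / 2 * (1 / 2) ^ N)).
        - intros N; apply (fa_bound HP (fun x => x_ (S N) x - x_ N x)); auto; apply Hpic.
        - eexists; exact Hgeo. }
      assert (HS : is_lim_seq (sum_n (fun N => x_ (S N) x - x_ N x)) (g x))
        by exact (Series_correct _ Hex).
      eapply is_lim_seq_ext; [|exact HS].
      intros N; induction N as [|N IH].
      - rewrite sum_O; unfold x_; simpl; ring.
      - rewrite sum_Sn, IH; unfold plus; simpl; ring. }
    assert (Hlim' : is_lim_seq (fun N => x_ N x) (g x)) by (apply is_lim_seq_incr_1; auto).
    assert (Hlim2 : is_lim_seq (fun N => x_ (S N) x) (Series (fun n => C n x * g x ^ n))).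
    { apply is_lim_seq_spec in Hlim'; apply is_lim_seq_spec.
      intros eps; destruct (Hlim' eps) as [N HN]; exists N; intros n Hn.
      specialize (HN n Hn).
      eapply Rle_lt_trans; [apply (Hlip (x_ n x) (g x)); auto|].
      assert (Hp := Rabs_pos (x_ n x - g x)); lra. }
    assert (E := is_lim_seq_unique _ _ Hlim); rewrite (is_lim_seq_unique _ _ Hlim2) in E.
    now injection E. }
  split; auto.
  intros z Hz Hfz.
  assert (L := Hlip z (g x) Hz Hgx); rewrite <- Hfz, <- Hfix in L.
  assert (Hp := Rabs_pos (z - g x)).
  assert (E : Rabs (z - g x) = 0) by lra.
  destruct (Req_dec (z - g x) 0) as [Z|Z]; [lra|].
  apply Rabs_pos_lt in Z; lra.
Qed.

(** * Implicit equations in double power series *)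

Lemma ex_series_mul_pow (a : nat -> R) (B q x : R) :
  (forall n, Rabs (a n) <= B * q ^ n) -> 0 <= q -> q * Rabs x < 1 ->
  ex_series (fun n => Rabs (a n * x ^ n)) /\ ex_series (fun n => a n * x ^ n).
Proof.
  intros Ha Hq Hx.
  destruct (ex_series_Rabs_le (fun n => a n * x ^ n) (fun n => B * (q * Rabs x) ^ n))
    as (H1 & H2 & _); auto.
  - intros n; rewrite Rabs_mult, Rpow_mult_distr, <- RPow_abs, <- Rmult_assoc.
    apply Rmult_le_compat_r; auto using pow_le, Rabs_pos.
  - apply (ex_series_scal_l (V := R_NormedModule)), ex_series_geom.
    rewrite Rabs_pos_eq; auto. apply Rmult_le_pos; auto using Rabs_pos.
Qed.

(** Absolutely convergent double power series for |s|, |t| <= [rho]. A point is (tt, t, s): the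
    variable adjoined last, s, belongs to the first impedance and carries the outer index of the
    double series. *)
Definition alg2 (rho : R) : (unit * R * R -> R) -> R -> Prop :=
  adj (adj_dom (fun _ => True) rho) (adj (fun _ => True) base_alg rho) rho.

Lemma alg2_fun_alg (rho : R) : 0 < rho ->
  fun_alg (adj_dom (adj_dom (fun _ => True) rho) rho) (alg2 rho).
Proof. intros H; apply adj_fun_alg, H. apply adj_fun_alg, H. apply base_alg_fun_alg. Qed.

(** Dividing by the linear coefficient m = [h0 1] turns the equation into z = Phi(z), where Phi has
    no linear term in z at s = t = 0; hence Phi contracts for small z, s, t. *)
Lemma analytic_implicit (h0 h1 h2 h3 : nat -> R) (B q : R) :
  0 < B -> 0 < q ->
  (forall n, Rabs (h0 n) <= B * q ^ n) -> (forall n, Rabs (h1 n) <= B * q ^ n) ->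
  (forall n, Rabs (h2 n) <= B * q ^ n) -> (forall n, Rabs (h3 n) <= B * q ^ n) ->
  h0 0%nat = 0 -> h0 1%nat <> 0 ->
  exists (r rho : R) (g : unit * R * R -> R),
    0 < r /\ r * q < 1 /\ 0 < rho /\ alg2 rho g r /\
    forall s t z, Rabs s <= rho -> Rabs t <= rho -> Rabs z <= r ->
      Series (fun n => h0 n * z ^ n) + s * Series (fun n => h1 n * z ^ n)
      + t * Series (fun n => h2 n * z ^ n) + s * t * Series (fun n => h3 n * z ^ n) = 0 ->
      z = g (tt, t, s).
Proof.
  intros HB Hq H0 H1 H2 H3 H00 H01.
  set (m := h0 1%nat).
  assert (Hm : 0 < Rabs m) by (apply Rabs_pos_lt; exact H01).
  set (B' := B / Rabs m).
  assert (HB' : 0 < B') by (apply Rdiv_lt_0_compat; auto).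
  (* The first bound gives (2 r q)^n <= (1/4)^n, the second 16 r B' q^2 <= 1/64. Together they put
     the term of index n + 2 of the differentiated majorant below [D (n + 2)], and the sum of [D] is
     1/3. *)
  set (r := Rmin (1 / (8 * q)) (1 / (1024 * B' * q ^ 2))).
  assert (Hq2 : 0 < q ^ 2) by (apply pow_lt; auto).
  assert (Hr : 0 < r).
  { unfold r; apply Rmin_pos; apply Rdiv_lt_0_compat; nra. }
  assert (Hr1 : r * q <= 1 / 8).
  { apply Rle_trans with (1 / (8 * q) * q); [|right; field; lra].
    apply Rmult_le_compat_r; [lra|apply Rmin_l]. }
  assert (Hr2 : r * (B' * q ^ 2) <= 1 / 1024).
  { apply Rle_trans with (1 / (1024 * B' * q ^ 2) * (B' * q ^ 2)); [|right; field; lra].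
    apply Rmult_le_compat_r; [nra|apply Rmin_r]. }
  (* With rho <= 1 the product s t is also bounded by rho, whence 3 rho in [gam]. The second bound
     gives gam 0 = 3 rho B' <= r/16 and controls the term of index 1. *)
  set (rho := Rmin 1 (r / (48 * B'))).
  assert (Hrho : 0 < rho).
  { unfold rho; apply Rmin_pos; [lra|]. apply Rdiv_lt_0_compat; nra. }
  assert (Hrho1 : rho <= 1) by apply Rmin_l.
  assert (Hrho2 : rho * B' <= r / 48).
  { apply Rle_trans with (r / (48 * B') * B'); [|right; field; lra].
    apply Rmult_le_compat_r; [lra|apply Rmin_r]. }
  (* Drops from [h0] the coefficient of index 0, which is zero, and the linear one, which is moved
     to the other side of the equation. *)
  set (c0 := fun n : nat => match n with O | 1%nat => 0 | _ => 1 end).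
  set (C := fun n (z : unit * R * R) =>
    - / m * (c0 n * h0 n + snd z * h1 n + snd (fst z) * h2 n + snd z * snd (fst z) * h3 n)).
  set (gam := fun n => B' * q ^ n * (c0 n + 3 * rho)).
  assert (HP := alg2_fun_alg rho Hrho).
  assert (HC : forall n, alg2 rho (C n) (gam n)).
  { intros n.
    assert (Hs : alg2 rho (fun z => snd z) rho)
      by apply (adj_var (adj_fun_alg base_alg_fun_alg Hrho)).
    assert (Ht : alg2 rho (fun z => snd (fst z)) rho).
    { apply (adj_lift (adj_fun_alg base_alg_fun_alg Hrho) (fun z => snd z)).
      apply (adj_var base_alg_fun_alg). }
    assert (Hk : forall h f M, alg2 rho f M -> Rabs h <= B * q ^ n ->
       alg2 rho (fun z => f z * h) (M * (B * q ^ n))).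
    { intros h f M Hf Hh; apply (fa_mult HP f (fun _ => h)); auto.
      eapply (fa_le HP); [exact Hh|apply (fa_const HP)]. }
    assert (Hc0 : alg2 rho (fun _ => c0 n) (c0 n)).
    { eapply (fa_le HP); [|apply (fa_const HP)].
      destruct n as [|[|n]]; simpl; rewrite Rabs_pos_eq; lra. }
    assert (Hbq : 0 < B * q ^ n) by (apply Rmult_lt_0_compat; auto using pow_lt).
    apply (fa_le HP _ (Rabs (- / m) * (c0 n * (B * q ^ n) + rho * (B * q ^ n)
             + rho * (B * q ^ n) + rho * rho * (B * q ^ n)))).
    - rewrite Rabs_Ropp, Rabs_inv.
      apply Rle_trans with (/ Rabs m * ((B * q ^ n) * (c0 n + 3 * rho))).
      + apply Rmult_le_compat_l; [left; apply Rinv_0_lt_compat; auto|].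
        assert (rho * rho <= rho) by nra. nra.
      + right; unfold gam, B'; field; lra.
    - apply (fa_scal HP (- / m)).
      repeat apply (fa_plus HP).
      + apply (Hk (h0 n) (fun _ => c0 n)); auto.
      + apply (Hk (h1 n) (fun z => snd z)); auto.
      + apply (Hk (h2 n) (fun z => snd (fst z))); auto.
      + apply (Hk (h3 n) (fun z => snd z * snd (fst z))); auto.
        apply (fa_mult HP (fun z => snd z) (fun z => snd (fst z))); auto. }
  assert (Hc01 : forall n, 0 <= c0 n <= 1) by (intros [|[|n]]; simpl; lra).
  set (D := fun n => 1 / 4 * (1 / 4) ^ n).
  assert (HD : is_series D (1 / 4 * / (1 - 1 / 4))) by (apply is_series_geom_R; lra).
  assert (Hn2 : forall n, INR n <= 2 ^ n).
  { induction n as [|n IH]; [simpl; lra|].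
    rewrite S_INR; simpl. assert (1 <= 2 ^ n) by (apply pow_R1_Rle; lra). lra. }
  assert (Hgam : forall n, 0 <= gam n <= B' * q ^ n * 4).
  { intros n; specialize (Hc01 n); unfold gam.
    assert (0 < B' * q ^ n) by (apply Rmult_lt_0_compat; auto using pow_lt).
    split; [apply Rmult_le_pos; lra|apply Rmult_le_compat_l; lra]. }
  assert (Hterm : forall n, 0 <= gam n * (INR n * r ^ pred n) <= D n).
  { intros n; split.
    - apply Rmult_le_pos; [apply Hgam|].
      apply Rmult_le_pos; [apply pos_INR|apply pow_le; lra].
    - destruct n as [|[|n]]; unfold D.
      + simpl; lra.
      + unfold gam; simpl. nra.
      + apply Rle_trans with (B' * q ^ S (S n) * 4 * (2 ^ S (S n) * r ^ pred (S (S n)))).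
        * apply Rmult_le_compat; try apply Hgam.
          -- apply Rmult_le_pos; [apply pos_INR|apply pow_le; lra].
          -- apply Rmult_le_compat_r; auto; apply pow_le; lra.
        * replace (B' * q ^ S (S n) * 4 * (2 ^ S (S n) * r ^ pred (S (S n))))
            with (16 * (r * (B' * q ^ 2)) * (2 * (r * q)) ^ n)
            by (rewrite !Rpow_mult_distr; simpl; ring).
          assert (0 <= (2 * (r * q)) ^ n <= (1 / 4) ^ n).
          { split; [apply pow_le; nra|apply pow_incr; nra]. }
          simpl; nra. }
  assert (HS1 : ex_series (fun n => gam n * (INR n * r ^ pred n))).
  { apply (ex_series_Rabs_le _ D); [|eexists; exact HD].
    intros n; rewrite Rabs_pos_eq; apply Hterm. }
  destruct (fa_fixed_point HP C gam r) as (g & Hg & Hfix); auto.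
  { apply (ex_series_mul_pow gam (B' * 4) q); [|lra|rewrite Rabs_pos_eq; lra].
    intros n; rewrite Rabs_pos_eq; [|apply Hgam].
    specialize (Hgam n); lra. }
  { apply Rle_trans with (Series D).
    - apply Series_le; auto. eexists; exact HD.
    - rewrite (is_series_unique _ _ HD); lra. }
  { unfold gam; simpl; lra. }
  exists r, rho, g; split; [auto|split; [lra|split; [auto|split; [auto|]]]].
  intros s t z Hs Ht Hz HF.
  apply (Hfix (tt, t, s)); auto.
  { repeat split; auto. }
  assert (Hex : forall h, (forall n, Rabs (h n) <= B * q ^ n) -> ex_series (fun n => h n * z ^ n)).
  { intros h Hh; apply (ex_series_mul_pow h B q); auto; [lra|].
    assert (q * Rabs z <= q * r) by (apply Rmult_le_compat_l; lra). lra. }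
  (* The linear term m z as a series, to be subtracted termwise from that of [h0]. *)
  set (e := fun n : nat => match n with 1%nat => m * z | _ => 0 end).
  assert (He : is_series e (m * z)).
  { replace (m * z) with (e 0%nat + e 1%nat) by (simpl; ring).
    apply (is_series_two e); auto. }
  assert (E0 := Series_correct _ (Hex h0 H0)). assert (E1 := Series_correct _ (Hex h1 H1)).
  assert (E2 := Series_correct _ (Hex h2 H2)). assert (E3 := Series_correct _ (Hex h3 H3)).
  symmetry; apply is_series_unique.
  assert (E := is_series_scal_R (- / m) _ _
    (is_series_plus _ _ _ _
      (is_series_plus _ _ _ _ (is_series_minus _ _ _ _ E0 He) (is_series_scal_R s _ _ E1))
      (is_series_plus _ _ _ _ (is_series_scal_R t _ _ E2) (is_series_scal_R (s * t) _ _ E3)))).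
  unfold minus, plus, opp in E; simpl in E.
  match type of E with is_series _ ?l => replace l with z in E end.
  - eapply is_series_ext; [|exact E].
    intros n; unfold C, e; simpl. destruct n as [|[|n]]; simpl; [rewrite H00| |]; fold m; ring.
  - replace (Series (fun n => h0 n * z ^ n)) with
      (- (s * Series (fun n => h1 n * z ^ n)
      + t * Series (fun n => h2 n * z ^ n) + s * t * Series (fun n => h3 n * z ^ n))) by lra.
    field; exact H01.
Qed.

(** * The analytic implicit function theorem *)

(** Stated through [adj] over the ground algebra, so that the closure properties are those of
    [fun_alg]. *)
Definition analytic_at (f : R -> R) (x0 : R) : Prop :=
  exists r M, 0 < r /\ adj (fun _ => True) base_alg r (fun z => f (x0 + snd z)) M.

Lemma adj_restrict {X : Type} (D : X -> Prop) (P : (X -> R) -> R -> Prop)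
    (HP : fun_alg D P) (r r' : R) (f : X * R -> R) (M : R) :
  0 < r' -> r' <= r -> adj D P r f M -> adj D P r' f M.
Proof.
  intros Hr' Hrr (g & N & Hg & HN & HM & Hf).
  assert (Hle : forall i, 0 <= N i * r' ^ i <= N i * r ^ i).
  { intros i; assert (H0 := fa_ge0 HP _ _ (Hg i)). split.
    - apply Rmult_le_pos; auto; apply pow_le; lra.
    - apply Rmult_le_compat_l; auto; apply pow_incr; lra. }
  exists g, N; split; [exact Hg|split; [|split]].
  - apply (ex_series_Rabs_le _ (fun i => N i * r ^ i)); auto.
    intros i; rewrite Rabs_pos_eq; apply Hle.
  - eapply Rle_trans; [|exact HM]. apply Series_le; auto.
  - intros x s Hx Hs; apply Hf; auto; lra.
Qed.

Lemma analytic_at_ext (f g : R -> R) (x0 : R) :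
  locally x0 (fun x => f x = g x) -> analytic_at f x0 -> analytic_at g x0.
Proof.
  intros [eps He] (r & M & Hr & Hf).
  exists (Rmin r (eps / 2)), M.
  assert (He0 := cond_pos eps).
  assert (H0 : 0 < Rmin r (eps / 2)) by (apply Rmin_pos; lra).
  split; auto.
  assert (HA := adj_fun_alg base_alg_fun_alg H0).
  eapply (fa_ext HA); [|apply (adj_restrict _ _ base_alg_fun_alg r); eauto using Rmin_l].
  intros [u x] [_ Hx]; simpl in *.
  apply He; unfold ball; simpl; unfold AbsRing_ball, abs, minus, plus, opp; simpl.
  replace (x0 + x + - x0) with x by ring.
  assert (H := Rmin_r r (eps / 2)); lra.
Qed.

Lemma analytic_at_const (c x0 : R) : analytic_at (fun _ => c) x0.
Proof.
  exists 1, (Rabs c); split; [lra|].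
  apply (fa_const (adj_fun_alg base_alg_fun_alg Rlt_0_1)).
Qed.

Lemma analytic_at_id (x0 : R) : analytic_at (fun x => x) x0.
Proof.
  exists 1, (Rabs x0 + 1); split; [lra|].
  assert (HA := adj_fun_alg base_alg_fun_alg Rlt_0_1).
  apply (fa_plus HA (fun _ => x0)); [apply (fa_const HA)|].
  apply (adj_var base_alg_fun_alg).
Qed.

(** Two functions come with different radii; an operation available in every [fun_alg] is applied
    after restriction to the smaller one. *)
Lemma analytic_at_op (op : R -> R -> R) (opM : R -> R -> R) :
  (forall X (D : X -> Prop) P, fun_alg D P -> forall f g M N, P f M -> P g N ->
     P (fun x => op (f x) (g x)) (opM M N)) ->
  forall f g x0, analytic_at f x0 -> analytic_at g x0 ->
  analytic_at (fun x => op (f x) (g x)) x0.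
Proof.
  intros Hop f g x0 (r & M & Hr & Hf) (r' & N & Hr' & Hg).
  exists (Rmin r r'), (opM M N).
  assert (H0 : 0 < Rmin r r') by (apply Rmin_pos; auto).
  split; auto.
  apply (Hop _ _ _ (adj_fun_alg base_alg_fun_alg H0) (fun z => f (x0 + snd z)) (fun z => g (x0 + snd z))).
  - apply (adj_restrict _ _ base_alg_fun_alg r); auto using Rmin_l.
  - apply (adj_restrict _ _ base_alg_fun_alg r'); auto using Rmin_r.
Qed.

Lemma analytic_at_plus (f g : R -> R) (x0 : R) :
  analytic_at f x0 -> analytic_at g x0 -> analytic_at (fun x => f x + g x) x0.
Proof. apply (analytic_at_op Rplus Rplus); intros X D P HP; apply (fa_plus HP). Qed.

Lemma analytic_at_minus (f g : R -> R) (x0 : R) :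
  analytic_at f x0 -> analytic_at g x0 -> analytic_at (fun x => f x - g x) x0.
Proof. apply (analytic_at_op Rminus Rplus); intros X D P HP; apply (fa_minus HP). Qed.

Lemma analytic_at_mult (f g : R -> R) (x0 : R) :
  analytic_at f x0 -> analytic_at g x0 -> analytic_at (fun x => f x * g x) x0.
Proof. apply (analytic_at_op Rmult Rmult); intros X D P HP; apply (fa_mult HP). Qed.

Lemma analytic_at_of_coef (f : R -> R) (x0 : R) (a : nat -> R) (B q r : R) :
  0 < r -> 0 <= q -> (forall n, Rabs (a n) <= B * q ^ n) ->
  (forall x, Rabs x <= r -> f (x0 + x) = Series (fun n => a n * x ^ n)) ->
  analytic_at f x0.
Proof.
  intros Hr Hq Ha Hf.
  set (r' := Rmin r (/ (2 * (q + 1)))).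
  assert (H0 : 0 < / (2 * (q + 1))) by (apply Rinv_0_lt_compat; lra).
  assert (H1 : 0 < r') by (apply Rmin_pos; auto).
  assert (H2 : q * r' < 1).
  { apply Rle_lt_trans with (q * / (2 * (q + 1))).
    - apply Rmult_le_compat_l; auto; apply Rmin_r.
    - apply (Rmult_lt_reg_r (2 * (q + 1))); [lra|]. field_simplify; lra. }
  exists r', (Series (fun n => Rabs (a n) * r' ^ n)); split; auto.
  exists (fun n _ => a n), (fun n => Rabs (a n)).
  split; [intros i; unfold base_alg; lra|split; [|split; [lra|]]].
  - apply (ex_series_mul_pow (fun n => Rabs (a n)) B q); auto.
    + intros n; rewrite Rabs_Rabsolu; auto.
    + rewrite Rabs_pos_eq; lra.
  - intros [] x _ Hx; apply Hf; simpl. assert (H := Rmin_l r (/ (2 * (q + 1)))); fold r' in H; lra.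
Qed.

(** Cauchy's estimate: N n r^n is one term of a nonnegative series with sum at most M, so q = 1/r
    works. The 1 in M + 1 makes B positive. *)
Lemma analytic_at_coef (f : R -> R) (x0 : R) : analytic_at f x0 ->
  exists (a : nat -> R) (B q r : R), 0 < r /\ 0 < q /\ 0 < B /\
    (forall n, Rabs (a n) <= B * q ^ n) /\
    (forall x, Rabs x <= r -> f (x0 + x) = Series (fun n => a n * x ^ n)).
Proof.
  intros (r & M & Hr & g & N & Hg & HN & HM & Hf).
  assert (HM0 : 0 <= M).
  { apply Rle_trans with (2 := HM), Series_nonneg; auto.
    apply (adj_nonneg base_alg_fun_alg Hr g); auto. }
  exists (fun n => g n tt), (M + 1), (/ r), r.
  split; [auto|split; [apply Rinv_0_lt_compat; auto|split; [lra|split]]].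
  - intros n; apply Rle_trans with (N n); [apply (Hg n)|].
    assert (Hn : N n * r ^ n <= M).
    { eapply Rle_trans; [|exact HM]. apply (term_le_Series (fun i => N i * r ^ i)); auto.
      apply (adj_nonneg base_alg_fun_alg Hr g); auto. }
    assert (Hp : 0 < r ^ n) by (apply pow_lt; auto).
    apply (Rmult_le_reg_r (r ^ n)); auto.
    rewrite Rmult_assoc, <- Rpow_mult_distr, Rinv_l, pow1 by lra. lra.
  - intros x Hx; apply (Hf tt x I Hx).
Qed.

Lemma analytic_at_scale (f : R -> R) (x0 c : R) : c <> 0 ->
  analytic_at f (c * x0) -> analytic_at (fun x => f (c * x)) x0.
Proof.
  intros Hc Hf; destruct (analytic_at_coef _ _ Hf) as (a & B & q & r & Hr & Hq & HB & Ha & Hfx).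
  assert (Hc' : 0 < Rabs c) by (apply Rabs_pos_lt; auto).
  apply (analytic_at_of_coef _ _ (fun n => a n * c ^ n) B (q * Rabs c) (r / Rabs c)).
  - apply Rdiv_lt_0_compat; auto.
  - nra.
  - intros n; rewrite Rabs_mult, <- RPow_abs, Rpow_mult_distr, <- Rmult_assoc.
    apply Rmult_le_compat_r; auto; apply pow_le; lra.
  - intros x Hx; rewrite Rmult_plus_distr_l, Hfx.
    + apply Series_ext; intros n; rewrite Rpow_mult_distr; ring.
    + rewrite Rabs_mult; apply Rle_trans with (Rabs c * (r / Rabs c)).
      * apply Rmult_le_compat_l; lra.
      * right; field; lra.
Qed.

Lemma CV_radius_gt (a : nat -> R) (B q : R) (x : R) :
  0 < q -> (forall n, Rabs (a n) <= B * q ^ n) -> q * Rabs x < 1 ->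
  Rbar_lt (Rabs x) (CV_radius a).
Proof.
  intros Hq Ha Hx.
  (* A point strictly between |x| and 1/q: the terms still tend to 0 there, so it does not lie
     outside the disc of convergence. *)
  set (y := (Rabs x + / q) / 2).
  assert (Hxq : Rabs x < / q).
  { apply (Rmult_lt_reg_l q); auto. rewrite Rinv_r; lra. }
  assert (Hy0 := Rabs_pos x).
  apply Rbar_lt_le_trans with (Rabs y).
  - unfold y; simpl. rewrite (Rabs_pos_eq ((Rabs x + / q) / 2)); lra.
  - apply Rbar_not_lt_le; intros Hlt.
    apply CV_disk_outside in Hlt; apply Hlt.
    apply ex_series_lim_0.
    apply (ex_series_mul_pow a B q); auto; [lra|].
    unfold y; rewrite (Rabs_pos_eq ((Rabs x + / q) / 2)) by lra.
    apply Rlt_le_trans with (q * / q); [|right; field; lra].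
    apply Rmult_lt_compat_l; lra.
Qed.

Lemma is_derive_Series_pow (a : nat -> R) (x : R) :
  Rbar_lt (Rabs x) (CV_radius a) ->
  is_derive (fun x => Series (fun n => a n * x ^ n)) x
    (Series (fun n => INR (S n) * a (S n) * x ^ n)) /\
  ex_series (fun n => INR (S n) * a (S n) * x ^ n).
Proof.
  intros H; split; [apply (is_derive_PSeries a x); auto|].
  apply ex_pseries_R, (ex_pseries_derive a x H).
Qed.

Lemma alg2_analytic (g : unit * R * R -> R) (rho M : R) (f : R -> R -> R) (a b : R) :
  0 < rho -> alg2 rho g M ->
  (exists del, 0 < del /\ forall s t, Rabs s < del -> Rabs t < del ->
     f (a + s) (b + t) = g (tt, t, s)) ->
  analytic2_at f a b.
Proof.
  intros Hrho (h & N & Hh & HN & HM & Hg) (del & Hdel & Hf).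
  apply functional_choice in Hh; destruct Hh as [c Hc].
  apply functional_choice in Hc; destruct Hc as [K HK].
  exists (fun i j => c i j tt), (Rmin rho del).
  split; [apply Rmin_pos; auto|].
  intros x y Hx Hy.
  assert (R1 := Rmin_l rho del). assert (R2 := Rmin_r rho del).
  set (s := x - a) in *. set (t := y - b) in *. cbv zeta.
  assert (Ht : forall i j, Rabs (c i j tt * t ^ j) <= K i j * rho ^ j).
  { intros i j; destruct (HK i) as (H1 & _).
    apply (adj_term_le base_alg_fun_alg (c i) (K i) tt t); auto; lra. }
  assert (Hti : forall i, ex_series (fun j => Rabs (c i j tt * t ^ j)) /\
     Series (fun j => Rabs (c i j tt * t ^ j)) <= N i /\
     Rabs (Series (fun j => c i j tt * t ^ j)) <= N i).
  { intros i; destruct (HK i) as (H1 & H2 & H3 & _).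
    destruct (ex_series_Rabs_le _ _ (Ht i) H2) as (E1 & E2 & E3).
    repeat split; auto; [|lra].
    eapply Rle_trans; [|exact H3]; apply Series_le; auto.
    intros j; split; [apply Rabs_pos|auto]. }
  assert (Habs : forall i j, Rabs (c i j tt * s ^ i * t ^ j) = Rabs (s ^ i) * Rabs (c i j tt * t ^ j)).
  { intros i j; rewrite <- Rabs_mult; f_equal; ring. }
  assert (HN0 : forall i, 0 <= N i).
  { intros i; eapply Rle_trans; [|apply (Hti i)]. apply Rabs_pos. }
  assert (Hsi : forall i, Rabs (s ^ i) <= rho ^ i).
  { intros i; rewrite <- RPow_abs; apply pow_incr; split; [apply Rabs_pos|lra]. }
  split; [|split].
  - intros i; apply ex_series_ext with (fun j => Rabs (s ^ i) * Rabs (c i j tt * t ^ j)).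
    + intros j; now rewrite Habs.
    + apply (ex_series_scal_l (V := R_NormedModule)); apply Hti.
  - apply (ex_series_Rabs_le _ (fun i => N i * rho ^ i)); auto.
    intros i; rewrite (Series_ext _ _ (Habs i)), Series_scal_l, Rabs_mult, Rabs_Rabsolu, Rmult_comm.
    apply Rmult_le_compat; auto using Rabs_pos.
    rewrite Rabs_pos_eq; [apply Hti|]. apply Series_nonneg; [intros; apply Rabs_pos|apply Hti].
  - replace (f x y) with (g (tt, t, s)).
    2: { rewrite <- Hf by lra. unfold s, t; f_equal; ring. }
    rewrite (Hg (tt, t) s); [|split; simpl; [auto|lra]|lra].
    assert (E : forall i, Series (fun j => c i j tt * s ^ i * t ^ j) = h i (tt, t) * s ^ i).
    { intros i; destruct (HK i) as (_ & _ & _ & H4).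
      rewrite H4 by (auto; lra). rewrite <- Series_scal_r; apply Series_ext; intros; ring. }
    apply (is_series_ext _ _ _ (fun i => eq_sym (E i))).
    apply Series_correct, (ex_series_Rabs_le _ (fun i => N i * rho ^ i)); auto.
    intros i; rewrite Rabs_mult; apply Rmult_le_compat; auto using Rabs_pos.
    destruct (HK i) as (_ & _ & _ & H4). rewrite H4 by (auto; lra). apply Hti.
Qed.

(** The equation is affine in each parameter, so shifting to (a0, b0) keeps its form, with [G0] as
    the part free of s and t; the linear coefficient of [G0] at the root is the derivative m.
    Continuity of k keeps it in the ball where the fixed point is unique, and there k coincides with
    the analytic solution. *)
Lemma implicit_analytic (F0 F1 F2 F3 : R -> R) (k : R -> R -> R) (a0 b0 m : R) :
  analytic_at F0 (k a0 b0) -> analytic_at F1 (k a0 b0) ->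
  analytic_at F2 (k a0 b0) -> analytic_at F3 (k a0 b0) ->
  is_derive (fun x => F0 x + a0 * F1 x + b0 * F2 x + a0 * b0 * F3 x) (k a0 b0) m ->
  m <> 0 ->
  (forall eps, 0 < eps -> exists del, 0 < del /\ forall s t, Rabs s < del -> Rabs t < del ->
     Rabs (k (a0 + s) (b0 + t) - k a0 b0) < eps) ->
  (exists del, 0 < del /\ forall s t, Rabs s < del -> Rabs t < del ->
     let a := a0 + s in let b := b0 + t in let x := k a b in
     F0 x + a * F1 x + b * F2 x + a * b * F3 x = 0) ->
  analytic2_at k a0 b0.
Proof.
  intros A0 A1 A2 A3 HD Hm Hcont (del0 & Hdel0 & Hroot).
  set (k0 := k a0 b0) in *.
  set (G0 := fun x => F0 x + a0 * F1 x + b0 * F2 x + a0 * b0 * F3 x) in *.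
  set (G1 := fun x => F1 x + b0 * F3 x). set (G2 := fun x => F2 x + a0 * F3 x).
  assert (B0 : analytic_at G0 k0).
  { unfold G0; repeat apply analytic_at_plus; auto; apply analytic_at_mult; auto using analytic_at_const. }
  assert (B1 : analytic_at G1 k0).
  { unfold G1; apply analytic_at_plus; auto; apply analytic_at_mult; auto using analytic_at_const. }
  assert (B2 : analytic_at G2 k0).
  { unfold G2; apply analytic_at_plus; auto; apply analytic_at_mult; auto using analytic_at_const. }
  destruct (analytic_at_coef _ _ B0) as (h0 & C0 & q0 & r0 & Hr0 & Hq0 & HC0 & Hh0 & E0).
  destruct (analytic_at_coef _ _ B1) as (h1 & C1 & q1 & r1 & Hr1 & Hq1 & HC1 & Hh1 & E1).
  destruct (analytic_at_coef _ _ B2) as (h2 & C2 & q2 & r2 & Hr2 & Hq2 & HC2 & Hh2 & E2).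
  destruct (analytic_at_coef _ _ A3) as (h3 & C3 & q3 & r3 & Hr3 & Hq3 & HC3 & Hh3 & E3).
  set (q := q0 + q1 + q2 + q3). set (C := C0 + C1 + C2 + C3).
  assert (Hmono : forall h C' q', 0 < C' -> 0 < q' -> C' <= C -> q' <= q ->
     (forall n, Rabs (h n) <= C' * q' ^ n) -> forall n, Rabs (h n) <= C * q ^ n).
  { intros h C' q' HC' Hq' HCC Hqq Hh n; eapply Rle_trans; [apply Hh|].
    apply Rmult_le_compat; auto; [lra|apply pow_le; lra|apply pow_incr; lra]. }
  assert (Hz : h0 0%nat = 0).
  { assert (E := E0 0); rewrite Rabs_R0 in E; specialize (E (Rlt_le _ _ Hr0)).
    rewrite (is_series_unique _ (h0 0%nat * 0 ^ 0 + h0 1%nat * 0 ^ 1)) in E.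
    - assert (Z := Hroot 0 0); rewrite Rabs_R0, !Rplus_0_r in Z.
      specialize (Z Hdel0 Hdel0); cbv zeta in Z. rewrite Rplus_0_r in E.
      fold k0 in Z; fold (G0 k0) in Z; rewrite Z in E; simpl in E; lra.
    - apply (is_series_two (fun n => h0 n * 0 ^ n)); intros; simpl; ring. }
  assert (Hd : h0 1%nat = m).
  { assert (D1 : is_derive (fun x => Series (fun n => h0 n * x ^ n)) 0
                  (Series (fun n => INR (S n) * h0 (S n) * 0 ^ n))).
    { apply is_derive_Series_pow, (CV_radius_gt h0 C0 q0); auto. rewrite Rabs_R0; lra. }
    rewrite (is_series_unique _ (INR 1 * h0 1%nat * 0 ^ 0 + INR 2 * h0 2%nat * 0 ^ 1)) in D1.
    2: { apply (is_series_two (fun n => INR (S n) * h0 (S n) * 0 ^ n)); intros.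
         rewrite pow_ne_zero by lia; ring. }
    assert (D2 : is_derive (fun x => G0 (k0 + x)) 0 m).
    { assert (D3 : is_derive (fun x => k0 + x) 0 1) by (auto_derive; auto; ring).
      replace m with (scal 1 m) by (unfold scal; simpl; unfold mult; simpl; ring).
      apply (is_derive_comp G0 (fun x => k0 + x)); auto. now rewrite Rplus_0_r. }
    assert (D4 : is_derive (fun x => Series (fun n => h0 n * x ^ n)) 0 m).
    { eapply is_derive_ext_loc; [|exact D2].
      exists (mkposreal _ Hr0); intros y Hy; apply E0.
      unfold ball in Hy; simpl in Hy; unfold AbsRing_ball, abs, minus, plus, opp in Hy; simpl in Hy.
      replace y with (y + - 0) by ring; lra. }
    apply is_derive_unique in D1; apply is_derive_unique in D4.
    rewrite D4 in D1; simpl in D1; lra. }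
  destruct (analytic_implicit h0 h1 h2 h3 C q) as (r & rho & g & Hr & Hrq & Hrho & Hg & Huniq);
    try (unfold C, q; lra).
  { apply (Hmono h0 C0 q0); unfold C, q; auto; lra. }
  { apply (Hmono h1 C1 q1); unfold C, q; auto; lra. }
  { apply (Hmono h2 C2 q2); unfold C, q; auto; lra. }
  { apply (Hmono h3 C3 q3); unfold C, q; auto; lra. }
  apply (alg2_analytic (fun z => k0 + g z) rho (Rabs k0 + r) k a0 b0 Hrho).
  { apply (fa_plus (alg2_fun_alg rho Hrho) (fun _ => k0)); auto.
    apply (fa_const (alg2_fun_alg rho Hrho)). }
  set (r' := Rmin r (Rmin (Rmin r0 r1) (Rmin r2 r3))).
  assert (Hr' : 0 < r') by (repeat apply Rmin_pos; auto).
  destruct (Hcont r' Hr') as (del1 & Hdel1 & Hc).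
  exists (Rmin rho (Rmin del0 del1)); split; [repeat apply Rmin_pos; auto|].
  intros s t Hs Ht.
  assert (L1 := Rmin_l rho (Rmin del0 del1)). assert (L2 := Rmin_r rho (Rmin del0 del1)).
  assert (L3 := Rmin_l del0 del1). assert (L4 := Rmin_r del0 del1).
  specialize (Hc s t ltac:(lra) ltac:(lra)).
  specialize (Hroot s t ltac:(lra) ltac:(lra)); cbv zeta in Hroot.
  set (z := k (a0 + s) (b0 + t) - k0) in *.
  replace (k (a0 + s) (b0 + t)) with (k0 + z) in * by (unfold z; ring).
  f_equal.
  assert (M1 := Rmin_l r (Rmin (Rmin r0 r1) (Rmin r2 r3))).
  assert (M2 := Rmin_r r (Rmin (Rmin r0 r1) (Rmin r2 r3))). fold r' in M1, M2.
  assert (M3 := Rmin_l (Rmin r0 r1) (Rmin r2 r3)). assert (M4 := Rmin_r (Rmin r0 r1) (Rmin r2 r3)).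
  assert (M5 := Rmin_l r0 r1). assert (M6 := Rmin_r r0 r1).
  assert (M7 := Rmin_l r2 r3). assert (M8 := Rmin_r r2 r3).
  apply Huniq; try lra.
  rewrite <- E0, <- E1, <- E2, <- E3 by lra.
  unfold G0, G1, G2; rewrite <- Hroot; ring.
Qed.

(** * Analyticity of cylinder functions *)

Lemma decreasing_of_derive (f f' : R -> R) (a b : R) : a <= b ->
  (forall x, a <= x <= b -> is_derive f x (f' x)) ->
  (forall x, a <= x <= b -> f' x <= 0) -> f b <= f a.
Proof.
  intros Hab Hd Hneg; destruct (Req_dec a b) as [->|Hne]; [lra|].
  destruct (MVT_cor2 f f' a b) as (c & Hc & Hcab); [lra| |].
  - intros c Hc; apply is_derive_Reals; auto.
  - specialize (Hneg c ltac:(lra)). nra.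
Qed.

Lemma strictly_decreasing_of_derive (f f' : R -> R) (a b : R) : a < b ->
  (forall x, a <= x <= b -> is_derive f x (f' x)) ->
  (forall x, a <= x <= b -> f' x < 0) -> f b < f a.
Proof.
  intros Hab Hd Hneg.
  destruct (MVT_cor2 f f' a b) as (c & Hc & Hcab); [lra| |].
  - intros c Hc; apply is_derive_Reals; auto.
  - specialize (Hneg c ltac:(lra)). nra.
Qed.

Lemma is_derive_mul_R (f g : R -> R) (x df dg : R) :
  is_derive f x df -> is_derive g x dg ->
  is_derive (fun x => f x * g x) x (df * g x + f x * dg).
Proof. intros Hf Hg; apply (is_derive_mult f g); auto. intros; apply Rmult_comm. Qed.

Lemma gronwall (E E' : R -> R) (a b L : R) : a <= b ->
  (forall x, a <= x <= b -> is_derive E x (E' x)) ->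
  (forall x, a <= x <= b -> E' x <= L * E x) ->
  E b <= E a * exp (L * (b - a)).
Proof.
  intros Hab Hd HL.
  assert (H : E b * exp (- L * (b - a)) <= E a * exp (- L * (a - a))).
  { apply (decreasing_of_derive (fun x => E x * exp (- L * (x - a)))
             (fun x => (E' x - L * E x) * exp (- L * (x - a)))); auto.
    - intros x Hx. assert (Hdx := Hd x Hx).
      assert (De : is_derive (fun x => exp (- L * (x - a))) x (- L * exp (- L * (x - a))))
        by (auto_derive; auto; unfold Rminus; ring).
      replace ((E' x - L * E x) * exp (- L * (x - a))) with
        (E' x * exp (- L * (x - a)) + E x * (- L * exp (- L * (x - a)))) by ring.
      apply (is_derive_mul_R E (fun x => exp (- L * (x - a)))); auto.
    - intros x Hx; specialize (HL x Hx).
      assert (Hp := exp_pos (- L * (x - a))). nra. }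
  rewrite Rminus_diag, Rmult_0_r, exp_0, Rmult_1_r in H.
  replace (E b) with (E b * exp (- L * (b - a)) * exp (L * (b - a))).
  - apply Rmult_le_compat_r; auto; left; apply exp_pos.
  - rewrite Rmult_assoc, <- exp_plus.
    replace (- L * (b - a) + L * (b - a)) with 0 by ring. rewrite exp_0; ring.
Qed.

(* [(p, q) = (Z_mu, Z_{mu+1})] for every cylinder function Z. *)
Definition bessel_system (mu : R) (p q : R -> R) : Prop :=
  forall x, 0 < x ->
    is_derive p x (mu / x * p x - q x) /\
    is_derive q x (p x - (mu + 1) / x * q x).

Section BesselSystemAnalytic.
Variables (mu x0 p0 q0 : R).
Hypothesis Hx0 : 0 < x0.

(** Taylor coefficients at [x0] of the solution with value (p0, q0). The system is first multiplied
    by x = x0 + t; the factor t brings in the coefficients of index n - 1, which the second pair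
    carries along, starting from 0. *)
Fixpoint bs_state (n : nat) : (R * R) * (R * R) :=
  match n with
  | O => ((p0, q0), (0, 0))
  | S n => let '((a, b), (a', b')) := bs_state n in
      ((((mu - INR n) * a - x0 * b - b') / (x0 * INR (S n)),
        (x0 * a + a' - (mu + 1 + INR n) * b) / (x0 * INR (S n))), (a, b))
  end.

Let a n := fst (fst (bs_state n)).
Let b n := snd (fst (bs_state n)).
Let a' n := fst (snd (bs_state n)).
Let b' n := snd (snd (bs_state n)).

Lemma bs_rec (n : nat) :
  a' (S n) = a n /\ b' (S n) = b n /\
  x0 * (INR (S n) * a (S n)) + INR n * a n = mu * a n - (x0 * b n + b' n) /\
  x0 * (INR (S n) * b (S n)) + INR n * b n = x0 * a n + a' n - (mu + 1) * b n.
Proof using Hx0.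
  assert (Hn : 0 < INR (S n)) by apply lt_0_INR, Nat.lt_0_succ.
  assert (E : bs_state (S n) =
      ((((mu - INR n) * a n - x0 * b n - b' n) / (x0 * INR (S n)),
        (x0 * a n + a' n - (mu + 1 + INR n) * b n) / (x0 * INR (S n))), (a n, b n))).
  { unfold a, b, a', b'; cbn [bs_state]; destruct (bs_state n) as [[? ?] [? ?]]; reflexivity. }
  assert (Ea : a (S n) = ((mu - INR n) * a n - x0 * b n - b' n) / (x0 * INR (S n)))
    by (unfold a at 1; now rewrite E).
  assert (Eb : b (S n) = (x0 * a n + a' n - (mu + 1 + INR n) * b n) / (x0 * INR (S n)))
    by (unfold b at 1; now rewrite E).
  assert (Ea' : a' (S n) = a n) by (unfold a' at 1; now rewrite E).
  assert (Eb' : b' (S n) = b n) by (unfold b' at 1; now rewrite E).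
  rewrite Ea, Eb.
  repeat split; auto; field; lra.
Qed.

(** In the recursion, x0 (n + 1) times the new coefficient is a combination of old ones with weights
    at most (n + 1) (|mu| + 2), x0 and 1; dividing by x0 (n + 1) leaves at most this factor. *)
Let K := (Rabs mu + 3 + x0) / x0.
Let M := Rabs p0 + Rabs q0.

Lemma bs_K : 1 <= K.
Proof using Hx0.
  unfold K; apply (Rmult_le_reg_r x0); auto.
  assert (H := Rabs_pos mu). replace ((Rabs mu + 3 + x0) / x0 * x0) with (Rabs mu + 3 + x0) by (field; lra).
  lra.
Qed.

Lemma bs_bound (n : nat) :
  (Rabs (a n) <= M * K ^ n /\ Rabs (b n) <= M * K ^ n) /\
  (Rabs (a' n) <= M * K ^ n /\ Rabs (b' n) <= M * K ^ n).
Proof using Hx0.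
  assert (HK := bs_K).
  assert (HM : 0 <= M) by (unfold M; assert (H1 := Rabs_pos p0); assert (H2 := Rabs_pos q0); lra).
  induction n as [|n [[IH1 IH2] [IH3 IH4]]].
  - unfold a, b, a', b'; simpl. rewrite Rabs_R0. unfold M in *.
    assert (H1 := Rabs_pos p0); assert (H2 := Rabs_pos q0); lra.
  - destruct (bs_rec n) as (E1 & E2 & E3 & E4).
    rewrite E1, E2.
    assert (HKn : 0 <= M * K ^ n) by (apply Rmult_le_pos; auto; apply pow_le; lra).
    set (T := M * K ^ n) in *.
    replace (M * K ^ S n) with (T * K) by (unfold T; simpl; ring).
    assert (HT : T <= T * K) by nra.
    assert (Hn : 1 <= INR (S n)) by (rewrite S_INR; assert (H := pos_INR n); lra).
    assert (Hin : INR n <= INR (S n)) by (rewrite S_INR; lra).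
    assert (Hin0 := pos_INR n).
    assert (key : forall u v, x0 * (INR (S n) * u) = v ->
       Rabs v <= INR (S n) * (T * (Rabs mu + 3 + x0)) -> Rabs u <= T * K).
    { intros u v Huv Hv. apply (Rmult_le_reg_l (x0 * INR (S n))); [nra|].
      replace (x0 * INR (S n) * Rabs u) with (Rabs v).
      - eapply Rle_trans; [exact Hv|]. unfold K; right; field; lra.
      - rewrite <- Huv, !Rabs_mult, (Rabs_pos_eq x0), (Rabs_pos_eq (INR (S n))) by lra; ring. }
    assert (Hmu := Rabs_pos mu).
    assert (Hsum : forall u v w y, Rabs u <= T -> Rabs v <= T -> Rabs w <= T ->
      Rabs y <= Rabs mu + 1 ->
      Rabs ((y + INR n) * u + x0 * v + w) <= INR (S n) * (T * (Rabs mu + 3 + x0))).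
    { intros u v w y Hu Hv Hw Hy.
      eapply Rle_trans; [apply Rabs_triang|].
      eapply Rle_trans; [apply Rplus_le_compat_r, Rabs_triang|].
      rewrite !Rabs_mult, (Rabs_pos_eq x0) by lra.
      assert (Rabs (y + INR n) <= INR (S n) * (Rabs mu + 2)).
      { eapply Rle_trans; [apply Rabs_triang|]. rewrite (Rabs_pos_eq (INR n)) by lra. nra. }
      assert (Rabs (y + INR n) * Rabs u <= INR (S n) * (Rabs mu + 2) * T)
        by (apply Rmult_le_compat; auto using Rabs_pos).
      assert (x0 * Rabs v <= x0 * T) by (apply Rmult_le_compat_l; lra).
      assert (0 <= x0 * T) by nra.
      assert (x0 * T <= INR (S n) * (x0 * T)) by nra.
      assert (T <= INR (S n) * T) by nra.
      lra. }
    split; [split|split; lra].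
    + apply (key _ (- ((- mu + INR n) * a n + x0 * b n + b' n))); [lra|].
      rewrite Rabs_Ropp; apply Hsum; auto. rewrite Rabs_Ropp; lra.
    + apply (key _ (- ((mu + 1 + INR n) * b n + x0 * - a n + - a' n))); [lra|].
      rewrite Rabs_Ropp; apply Hsum; auto; try (rewrite Rabs_Ropp; auto).
      eapply Rle_trans; [apply Rabs_triang|]. rewrite Rabs_R1; lra.
Qed.

Let Pf (t : R) := Series (fun n => a n * t ^ n).
Let Qf (t : R) := Series (fun n => b n * t ^ n).

Lemma Series_shift_pow (c : nat -> R) (t : R) :
  ex_series (fun n => INR (S n) * c (S n) * t ^ n) ->
  is_series (fun n => INR n * c n * t ^ n) (t * Series (fun n => INR (S n) * c (S n) * t ^ n)).
Proof.
  intros H; apply is_series_decr_1; simpl.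
  match goal with |- is_series _ ?l =>
    replace l with (t * Series (fun n => INR (S n) * c (S n) * t ^ n)) end.
  - eapply is_series_ext; [|apply is_series_scal_R, Series_correct, H].
    intros n; simpl; ring.
  - unfold plus, opp; simpl; ring.
Qed.

Lemma bs_series_system (t : R) : K * Rabs t < 1 -> 0 < x0 + t ->
  is_derive Pf t (mu / (x0 + t) * Pf t - Qf t) /\
  is_derive Qf t (Pf t - (mu + 1) / (x0 + t) * Qf t).
Proof using Hx0.
  intros Ht Hxt.
  assert (HK := bs_K).
  assert (Ha : forall n, Rabs (a n) <= M * K ^ n) by apply bs_bound.
  assert (Hb : forall n, Rabs (b n) <= M * K ^ n) by apply bs_bound.
  destruct (ex_series_mul_pow a M K t) as [_ Sa]; auto; [lra|].
  destruct (ex_series_mul_pow b M K t) as [_ Sb]; auto; [lra|].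
  destruct (is_derive_Series_pow a t) as [Da Ea']; [apply (CV_radius_gt a M K); auto; lra|].
  destruct (is_derive_Series_pow b t) as [Db Eb']; [apply (CV_radius_gt b M K); auto; lra|].
  assert (Hsh : forall c c' C, Series (fun n => c n * t ^ n) = C ->
    c' O = 0 -> (forall n, c' (S n) = c n) -> ex_series (fun n => c n * t ^ n) ->
    is_series (fun n => c' n * t ^ n) (t * C)).
  { intros c c' C <- H0 H1 Hex; apply is_series_decr_1.
    match goal with |- is_series _ ?l => replace l with (t * Series (fun n => c n * t ^ n)) end.
    - eapply is_series_ext; [|apply is_series_scal_R, Series_correct, Hex].
      intros n; simpl; rewrite H1; ring.
    - unfold plus, opp; simpl; rewrite H0; ring. }
  assert (Sb' := Hsh b b' (Qf t) eq_refl eq_refl (fun n => proj1 (proj2 (bs_rec n))) Sb).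
  assert (Sa' := Hsh a a' (Pf t) eq_refl eq_refl (fun n => proj1 (bs_rec n)) Sa).
  apply Series_correct in Sa; apply Series_correct in Sb. fold (Pf t) in Sa; fold (Qf t) in Sb.
  set (P' := Series (fun n => INR (S n) * a (S n) * t ^ n)) in *.
  set (Q' := Series (fun n => INR (S n) * b (S n) * t ^ n)) in *.
  assert (Ea := Series_shift_pow a t Ea'). assert (Eb := Series_shift_pow b t Eb').
  assert (Da' := Series_correct _ Ea'). assert (Db' := Series_correct _ Eb').
  fold P' in Ea, Da'; fold Q' in Eb, Db'.
  split.
  - replace (mu / (x0 + t) * Pf t - Qf t) with P'; auto.
    assert (E : (x0 + t) * P' = mu * Pf t - (x0 + t) * Qf t).
    { assert (E1 := is_series_plus _ _ _ _ (is_series_scal_R x0 _ _ Da') Ea).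
      assert (E2 := is_series_minus _ _ _ _ (is_series_scal_R mu _ _ Sa)
                     (is_series_plus _ _ _ _ (is_series_scal_R x0 _ _ Sb) Sb')).
      apply is_series_unique in E1; apply is_series_unique in E2.
      unfold minus, plus, opp in E1, E2; simpl in E1, E2.
      replace ((x0 + t) * P') with (x0 * P' + t * P') by ring.
      rewrite <- E1.
      transitivity (mu * Pf t + - (x0 * Qf t + t * Qf t)); [rewrite <- E2|ring].
      apply Series_ext; intros n; destruct (bs_rec n) as (_ & _ & E3 & _).
      transitivity ((x0 * (INR (S n) * a (S n)) + INR n * a n) * t ^ n); [simpl; ring|].
      rewrite E3; ring. }
    apply (Rmult_eq_reg_l (x0 + t)); [|lra]. rewrite E; field; lra.
  - replace (Pf t - (mu + 1) / (x0 + t) * Qf t) with Q'; auto.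
    assert (E : (x0 + t) * Q' = (x0 + t) * Pf t - (mu + 1) * Qf t).
    { assert (E1 := is_series_plus _ _ _ _ (is_series_scal_R x0 _ _ Db') Eb).
      assert (E2 := is_series_minus _ _ _ _
                     (is_series_plus _ _ _ _ (is_series_scal_R x0 _ _ Sa) Sa')
                     (is_series_scal_R (mu + 1) _ _ Sb)).
      apply is_series_unique in E1; apply is_series_unique in E2.
      unfold minus, plus, opp in E1, E2; simpl in E1, E2.
      replace ((x0 + t) * Q') with (x0 * Q' + t * Q') by ring.
      rewrite <- E1.
      transitivity (x0 * Pf t + t * Pf t + - ((mu + 1) * Qf t)); [rewrite <- E2|ring].
      apply Series_ext; intros n; destruct (bs_rec n) as (_ & _ & _ & E3).
      transitivity ((x0 * (INR (S n) * b (S n)) + INR n * b n) * t ^ n); [simpl; ring|].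
      rewrite E3; ring. }
    apply (Rmult_eq_reg_l (x0 + t)); [|lra]. rewrite E; field; lra.
Qed.
End BesselSystemAnalytic.

(** Gronwall's inequality forward and, after the reflection t -> -t, backward. With E the squared
    distance of two solutions, it is uniqueness for the initial value problem. *)
Lemma energy_zero (E E' : R -> R) (r L : R) : E 0 = 0 ->
  (forall t, Rabs t <= r -> is_derive E t (E' t)) ->
  (forall t, Rabs t <= r -> 0 <= E t) ->
  (forall t, Rabs t <= r -> Rabs (E' t) <= L * E t) ->
  forall t, Rabs t <= r -> E t = 0.
Proof.
  intros H0 Hd Hpos HL t Ht; apply Rle_antisym; [|auto].
  assert (Hin : forall x, Rabs x <= Rabs t -> Rabs x <= r) by (intros; lra).
  destruct (Rle_dec 0 t) as [Hs|Hs].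
  - replace 0 with (E 0 * exp (L * (t - 0))) by (rewrite H0; ring).
    apply (gronwall E E'); auto.
    + intros x Hx; apply Hd, Hin. rewrite !Rabs_pos_eq; lra.
    + intros x Hx. eapply Rle_trans; [apply Rle_abs|apply HL, Hin]. rewrite !Rabs_pos_eq; lra.
  - replace (E t) with (E (- - t)) by (f_equal; ring).
    replace 0 with (E (- 0) * exp (L * (- t - 0))) by (rewrite Ropp_0, H0; ring).
    assert (Hn : forall x, 0 <= x <= - t -> Rabs (- x) <= r).
    { intros x Hx; apply Hin; rewrite Rabs_Ropp, Rabs_pos_eq, Rabs_left; lra. }
    apply (gronwall (fun x => E (- x)) (fun x => - E' (- x))); [lra| |].
    + intros x Hx.
      replace (- E' (- x)) with (scal (-1) (E' (- x)))
        by (unfold scal; simpl; unfold mult; simpl; ring).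
      apply (is_derive_comp E Ropp); [apply Hd; auto|].
      auto_derive; auto; ring.
    + intros x Hx; eapply Rle_trans; [apply Rle_abs|].
      rewrite Rabs_Ropp; auto.
Qed.

Lemma is_derive_shift (f : R -> R) (x0 t l : R) :
  is_derive f (x0 + t) l -> is_derive (fun t => f (x0 + t)) t l.
Proof.
  intros Hf.
  replace l with (scal 1 l) by (unfold scal; simpl; unfold mult; simpl; ring).
  apply (is_derive_comp f (fun t => x0 + t)); auto.
  auto_derive; auto; ring.
Qed.

(** Analyticity is drawn from the differential system alone, so J and Y are treated at once: the
    formal Taylor series converges, solves the system, and equals the given solution by
    uniqueness. *)
Lemma bessel_system_analytic (mu x0 : R) (p q : R -> R) :
  bessel_system mu p q -> 0 < x0 -> analytic_at p x0 /\ analytic_at q x0.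
Proof.
  intros Hs Hx0.
  set (a := fun n => fst (fst (bs_state mu x0 (p x0) (q x0) n))).
  set (b := fun n => snd (fst (bs_state mu x0 (p x0) (q x0) n))).
  set (K := (Rabs mu + 3 + x0) / x0).
  set (M := Rabs (p x0) + Rabs (q x0)).
  assert (HK : 1 <= K) by (apply bs_K; auto).
  assert (Hab : forall n, Rabs (a n) <= M * K ^ n /\ Rabs (b n) <= M * K ^ n)
    by (intros n; apply (bs_bound mu x0 (p x0) (q x0) Hx0 n)).
  set (Pf := fun t => Series (fun n => a n * t ^ n)).
  set (Qf := fun t => Series (fun n => b n * t ^ n)).
  set (r := Rmin (x0 / 2) (1 / (2 * K))).
  assert (Hr : 0 < r) by (unfold r; apply Rmin_pos; [lra|apply Rdiv_lt_0_compat; lra]).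
  assert (Hr1 : r <= x0 / 2) by apply Rmin_l.
  assert (Hr2 : K * r < 1).
  { apply Rle_lt_trans with (K * (1 / (2 * K))).
    - apply Rmult_le_compat_l; [lra|apply Rmin_r].
    - replace (K * (1 / (2 * K))) with (1 / 2) by (field; lra). lra. }
  assert (Hser : forall t, Rabs t <= r ->
    is_derive Pf t (mu / (x0 + t) * Pf t - Qf t) /\
    is_derive Qf t (Pf t - (mu + 1) / (x0 + t) * Qf t)).
  { intros t Ht; apply (bs_series_system mu x0 (p x0) (q x0) Hx0).
    - fold K; apply Rle_lt_trans with (K * r); auto. apply Rmult_le_compat_l; lra.
    - apply Rabs_le_between in Ht; lra. }
  set (L := 2 * (Rabs mu + 1) / (x0 / 2)).
  set (u := fun t => p (x0 + t) - Pf t). set (v := fun t => q (x0 + t) - Qf t).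
  (* In the derivative of u^2 + v^2 the cross terms 2 u v cancel; the bound x0 + t >= x0/2 then
     gives the factor L. *)
  assert (Hz : forall t, Rabs t <= r -> u t * u t + v t * v t = 0).
  { apply (energy_zero (fun t => u t * u t + v t * v t)
      (fun t => 2 * (mu / (x0 + t)) * (u t * u t) - 2 * ((mu + 1) / (x0 + t)) * (v t * v t)) r L).
    - assert (Z : forall c : nat -> R, Series (fun n => c n * 0 ^ n) = c O).
      { intros c; rewrite (is_series_unique _ (c 0%nat * 0 ^ 0 + c 1%nat * 0 ^ 1)).
        - simpl; ring.
        - apply (is_series_two (fun n => c n * 0 ^ n)); intros; simpl; ring. }
      unfold u, v, Pf, Qf; rewrite !Z, Rplus_0_r; unfold a, b; simpl; ring.
    - intros t Ht; destruct (Hser t Ht) as [D1 D2].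
      apply Rabs_le_between in Ht.
      destruct (Hs (x0 + t) ltac:(lra)) as [D3 D4].
      apply is_derive_shift in D3; apply is_derive_shift in D4.
      assert (Du := is_derive_minus _ _ _ _ _ D3 D1).
      assert (Dv := is_derive_minus _ _ _ _ _ D4 D2).
      assert (DE := is_derive_plus _ _ _ _ _ (is_derive_mul_R u u t _ _ Du Du)
                                     (is_derive_mul_R v v t _ _ Dv Dv)).
      eapply is_derive_ext; [|evar_last; [exact DE|]].
      + intros; reflexivity.
      + unfold minus, plus, opp; simpl. fold (Pf t) (Qf t).
        unfold u, v; field; lra.
    - intros t _; nra.
    - intros t Ht; apply Rabs_le_between in Ht.
      assert (Hb : forall c w, Rabs c <= Rabs mu + 1 -> 0 <= w ->
        Rabs (2 * (c / (x0 + t)) * w) <= L * w).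
      { intros c w Hc Hw; rewrite !Rabs_mult, (Rabs_pos_eq w), (Rabs_pos_eq 2) by lra.
        apply Rmult_le_compat_r; auto. unfold L, Rdiv.
        rewrite Rmult_assoc, Rabs_mult.
        apply Rmult_le_compat_l; [lra|].
        apply Rmult_le_compat; auto using Rabs_pos.
        rewrite Rabs_pos_eq; [|left; apply Rinv_0_lt_compat; lra].
        apply Rinv_le_contravar; lra. }
      rewrite Rmult_plus_distr_l.
      eapply Rle_trans; [apply Rabs_triang|].
      apply Rplus_le_compat; [|rewrite Rabs_Ropp]; apply Hb; try nra.
      eapply Rle_trans; [apply Rabs_triang|]. rewrite Rabs_R1; lra. }
  assert (Hz2 : forall t, Rabs t <= r -> p (x0 + t) = Pf t /\ q (x0 + t) = Qf t).
  { intros t Ht; specialize (Hz t Ht). assert (u t = 0 /\ v t = 0) by nra.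
    unfold u, v in H; lra. }
  split.
  - apply (analytic_at_of_coef _ _ a M K r); auto; [lra|apply Hab|apply Hz2].
  - apply (analytic_at_of_coef _ _ b M K r); auto; [lra|apply Hab|apply Hz2].
Qed.

(** * The reciprocal Gamma function *)

Definition rg_seq (z : R) (n : nat) : R :=
  prod_f_R0 (fun j => z + INR j) n / (INR (fact n) * Rpower (INR n) z).

(** [Lim_seq] returns a value even for a divergent sequence, so the convergence of Gauss's product
    is a separate fact. *)
Lemma is_lim_seq_rgamma (z : R) : ex_finite_lim_seq (rg_seq z) -> is_lim_seq (rg_seq z) (rgamma z).
Proof.
  intros [l Hl]. unfold rgamma; fold (rg_seq z).
  change (fun n => prod_f_R0 (fun j => z + INR j) n / (INR (fact n) * Rpower (INR n) z))
    with (rg_seq z).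
  rewrite (is_lim_seq_unique _ _ Hl); exact Hl.
Qed.

Lemma INR_fact_pos (n : nat) : 0 < INR (fact n).
Proof. apply lt_0_INR, lt_O_fact. Qed.

Lemma INR_S_pos (n : nat) : 0 < INR (S n).
Proof. apply lt_0_INR, Nat.lt_0_succ. Qed.

Lemma Rpower_pos (x y : R) : 0 < Rpower x y.
Proof. apply exp_pos. Qed.

Lemma ln_le_pred (x : R) : 0 < x -> ln x <= x - 1.
Proof.
  intros Hx; assert (H := exp_ineq1_le (ln x)). rewrite exp_ln in H by auto. lra.
Qed.

Lemma rg_seq_succ (z : R) (n : nat) : (1 <= n)%nat ->
  rg_seq z (S n) =
  rg_seq z n * ((1 + z / INR (S n)) * Rpower (INR n / INR (S n)) z).
Proof.
  intros Hn; unfold rg_seq; cbn [prod_f_R0]; rewrite fact_simpl, mult_INR.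
  assert (H0 : 0 < INR n) by (apply lt_0_INR; lia).
  assert (H1 := INR_S_pos n). assert (H2 := INR_fact_pos n).
  assert (E : Rpower (INR n / INR (S n)) z = Rpower (INR n) z / Rpower (INR (S n)) z).
  { unfold Rdiv; rewrite <- Rpower_mult_distr by (auto using Rinv_0_lt_compat).
    f_equal; rewrite <- Rpower_Ropp. unfold Rpower; rewrite ln_Rinv by auto. f_equal; ring. }
  rewrite E. assert (H3 := Rpower_pos (INR (S n)) z). assert (H4 := Rpower_pos (INR n) z).
  field; lra.
Qed.

Lemma exp_le_compat (x y : R) : x <= y -> exp x <= exp y.
Proof. intros [H| ->]; [left; apply exp_increasing, H|right; reflexivity]. Qed.

Lemma rg_seq_pos (z : R) (n : nat) : 0 <= z -> 0 <= rg_seq z n.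
Proof.
  intros Hz; unfold rg_seq; apply Rmult_le_pos.
  - apply prod_SO_pos; intros m _; assert (H := pos_INR m); lra.
  - left; apply Rinv_0_lt_compat, Rmult_lt_0_compat; auto using INR_fact_pos, Rpower_pos.
Qed.

(** By 1 + x <= exp x and ln x <= x - 1, the factor leading from n to n + 1 is at most exp(z/(n+1))
    exp(-z/(n+1)) = 1. *)
Lemma rg_seq_decr (z : R) (n : nat) : 0 <= z -> (1 <= n)%nat -> rg_seq z (S n) <= rg_seq z n.
Proof.
  intros Hz Hn; rewrite rg_seq_succ by auto.
  rewrite <- (Rmult_1_r (rg_seq z n)) at 2.
  apply Rmult_le_compat_l; [apply rg_seq_pos; auto|].
  assert (H0 : 0 < INR n) by (apply lt_0_INR; lia).
  assert (H1 := INR_S_pos n).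
  assert (Hq : 0 < INR n / INR (S n)) by (apply Rdiv_lt_0_compat; auto).
  apply Rle_trans with (exp (z / INR (S n)) * exp (- (z / INR (S n)))).
  - apply Rmult_le_compat.
    + assert (0 <= z / INR (S n)) by (apply Rdiv_le_0_compat; auto). lra.
    + left; apply Rpower_pos.
    + apply exp_ineq1_le.
    + apply exp_le_compat.
      assert (L := ln_le_pred _ Hq).
      replace (- (z / INR (S n))) with (z * (INR n / INR (S n) - 1))
        by (rewrite S_INR in *; field; lra).
      apply Rmult_le_compat_l; auto.
  - rewrite <- exp_plus, Rplus_opp_r, exp_0; lra.
Qed.

Lemma rgamma_nonneg_cv (z : R) : 0 <= z ->
  is_lim_seq (rg_seq z) (rgamma z) /\ 0 <= rgamma z.
Proof.
  intros Hz.
  assert (Hex : ex_finite_lim_seq (rg_seq z)).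
  { destruct (ex_finite_lim_seq_decr (fun n => rg_seq z (S n)) 0) as [l Hl].
    - intros n; apply rg_seq_decr; auto; lia.
    - intros n; apply rg_seq_pos; auto.
    - exists l; apply is_lim_seq_incr_1; auto. }
  apply is_lim_seq_rgamma in Hex; split; auto.
  apply (is_lim_seq_le (fun _ => 0) (rg_seq z) 0 (rgamma z)); auto using is_lim_seq_const.
  intros n; apply rg_seq_pos; auto.
Qed.

Lemma rg_seq_shift (z : R) (n : nat) : (1 <= n)%nat ->
  rg_seq z n * (1 + (z + 1) / INR n) = z * rg_seq (z + 1) n.
Proof.
  intros Hn; unfold rg_seq.
  assert (H0 : 0 < INR n) by (apply lt_0_INR; lia).
  assert (E : forall n, z * prod_f_R0 (fun j => z + 1 + INR j) n
     = prod_f_R0 (fun j => z + INR j) n * (z + 1 + INR n)).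
  { intros k; induction k as [|k IH]; [simpl; ring|].
    cbn [prod_f_R0]. rewrite <- Rmult_assoc, IH, S_INR. ring. }
  rewrite Rpower_plus, Rpower_1 by auto.
  assert (H2 := INR_fact_pos n). assert (H4 := Rpower_pos (INR n) z).
  transitivity (z * prod_f_R0 (fun j => z + 1 + INR j) n / (INR (fact n) * (Rpower (INR n) z * INR n))).
  - rewrite E; field; lra.
  - field; lra.
Qed.

Lemma is_lim_seq_inv_INR : is_lim_seq (fun n => / INR n) 0.
Proof.
  apply (is_lim_seq_inv INR p_infty); [apply is_lim_seq_INR|discriminate].
Qed.

(** Convergence passes from z + 1 down to z, together with the functional equation. For the
    reciprocal of Gamma the factor z multiplies, so nothing special happens at the poles. *)
Lemma rgamma_cv_down (z : R) : is_lim_seq (rg_seq (z + 1)) (rgamma (z + 1)) ->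
  is_lim_seq (rg_seq z) (rgamma z) /\ rgamma z = z * rgamma (z + 1).
Proof.
  intros H.
  assert (H1 : is_lim_seq (fun n => 1 + (z + 1) * / INR n) 1).
  { replace (Finite 1) with (Finite (1 + (z + 1) * 0)) by (f_equal; ring).
    apply is_lim_seq_plus'; [apply is_lim_seq_const|].
    apply (is_lim_seq_scal_l _ (z + 1) 0), is_lim_seq_inv_INR. }
  assert (H2 : is_lim_seq (fun n => z * rg_seq (z + 1) n / (1 + (z + 1) * / INR n))
                 (z * rgamma (z + 1) / 1)).
  { apply is_lim_seq_div'; auto. apply (is_lim_seq_scal_l _ z (rgamma (z + 1))); auto. }
  assert (H3 : is_lim_seq (rg_seq z) (z * rgamma (z + 1))).
  { replace (z * rgamma (z + 1)) with (z * rgamma (z + 1) / 1) by field.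
    eapply is_lim_seq_ext_loc; [|exact H2].
    apply is_lim_seq_spec in H1; destruct (H1 (mkposreal _ Rlt_0_1)) as [N HN]; simpl in HN.
    exists (S N); intros n Hn; specialize (HN n ltac:(lia)). apply Rabs_def2 in HN.
    rewrite <- rg_seq_shift by lia. unfold Rdiv. field. 
    assert (0 < INR n) by (apply lt_0_INR; lia). 
    split; [lra|]. intros E. assert (1 + (z + 1) * / INR n = 0); [|lra].
    replace (1 + (z + 1) * / INR n) with ((INR n + (z + 1)) / INR n) by (field; lra).
    rewrite E; unfold Rdiv; ring. }
  assert (H4 : is_lim_seq (rg_seq z) (rgamma z)) by (apply is_lim_seq_rgamma; eexists; exact H3).
  split; auto.
  apply is_lim_seq_unique in H3; apply is_lim_seq_unique in H4. rewrite H3 in H4.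
  now injection H4.
Qed.

Lemma rgamma_cv (z : R) : is_lim_seq (rg_seq z) (rgamma z).
Proof.
  destruct (nfloor_ex (Rabs z) (Rabs_pos z)) as [N [_ HN]].
  assert (H : 0 <= z + INR (S N)).
  { rewrite S_INR; assert (H := Rabs_maj2 z); lra. }
  clear HN; revert z H; generalize (S N) as k; clear N; intros N.
  induction N as [|N IH]; intros z Hz.
  - apply rgamma_nonneg_cv; simpl in Hz; lra.
  - apply rgamma_cv_down, IH; auto. rewrite S_INR in Hz; lra.
Qed.


Lemma rgamma_succ (z : R) : rgamma z = z * rgamma (z + 1).
Proof. apply rgamma_cv_down, rgamma_cv. Qed.

Lemma rgamma_1 : rgamma 1 = 1.
Proof.
  assert (H := rgamma_cv 1).
  assert (H1 : is_lim_seq (rg_seq 1) 1).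
  { apply is_lim_seq_ext_loc with (fun n => 1 + / INR n).
    - exists 1%nat; intros n Hn; unfold rg_seq.
      assert (H0 : 0 < INR n) by (apply lt_0_INR; lia).
      rewrite Rpower_1 by auto.
      assert (E : forall k, prod_f_R0 (fun j => 1 + INR j) k = INR (fact k) * (INR k + 1)).
      { induction k as [|k IH]; [simpl; ring|].
        cbn [prod_f_R0]; rewrite IH, fact_simpl, mult_INR, S_INR; ring. }
      rewrite E; assert (H2 := INR_fact_pos n); field; lra.
    - replace (Finite 1) with (Finite (1 + 0)) by (f_equal; ring).
      apply is_lim_seq_plus'; [apply is_lim_seq_const|apply is_lim_seq_inv_INR]. }
  apply is_lim_seq_unique in H; apply is_lim_seq_unique in H1. rewrite H in H1; now injection H1.
Qed.

Lemma rgamma_nat (m : nat) : rgamma (INR m + 1) = / INR (fact m).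
Proof.
  induction m as [|m IH].
  - simpl; rewrite Rplus_0_l, rgamma_1; field.
  - rewrite rgamma_succ in IH. rewrite fact_simpl, mult_INR, S_INR.
    assert (H := INR_fact_pos m). assert (H1 := pos_INR m).
    apply (Rmult_eq_reg_l (INR m + 1)); [|lra]. rewrite IH; field; lra.
Qed.

Lemma rgamma_neg_nat (m : nat) : rgamma (- INR m) = 0.
Proof.
  induction m as [|m IH].
  - simpl; rewrite rgamma_succ; ring.
  - rewrite rgamma_succ, S_INR. replace (- (INR m + 1) + 1) with (- INR m) by ring. rewrite IH; ring.
Qed.

(* Wallis-type bound: [(j + 1/2)^2 >= j (j + 1)] telescopes. *)
Lemma rgamma_half : 0 < rgamma (1 / 2).
Proof.
  assert (H : 1 / 2 <= rgamma (1 / 2)); [|lra].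
  assert (E : forall n, / 4 * (INR (fact n) ^ 2 * INR (S n))
                        <= prod_f_R0 (fun j => 1 / 2 + INR j) n ^ 2).
  { induction n as [|n IH]; [simpl; lra|].
    cbn [prod_f_R0]; rewrite Rpow_mult_distr, fact_simpl, mult_INR.
    apply Rle_trans with (/ 4 * (INR (fact n) ^ 2 * INR (S n)) * (1 / 2 + INR (S n)) ^ 2).
    - rewrite (S_INR (S n)). assert (H := INR_S_pos n). assert (H1 := pow2_ge_0 (INR (fact n))).
      assert (0 <= INR (fact n) ^ 2 * INR (S n)) by nra.
      replace (/ 4 * ((INR (S n) * INR (fact n)) ^ 2 * (INR (S n) + 1)))
        with (INR (fact n) ^ 2 * INR (S n) * (/ 4 * (INR (S n) * (INR (S n) + 1)))) by ring.
      nra.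
    - apply Rmult_le_compat_r; auto; apply pow2_ge_0. }
  apply (is_lim_seq_le_loc (fun _ => 1 / 2) (rg_seq (1 / 2)) (1 / 2) (rgamma (1 / 2)));
    [|apply is_lim_seq_const|apply rgamma_cv].
  exists 1%nat; intros n Hn.
  assert (H0 : 0 < INR n) by (apply lt_0_INR; lia).
  assert (Hp := rg_seq_pos (1 / 2) n ltac:(lra)).
  assert (Hsq : rg_seq (1 / 2) n * rg_seq (1 / 2) n >= / 4); [|nra].
  unfold rg_seq. specialize (E n).
  assert (Hr : Rpower (INR n) (1 / 2) * Rpower (INR n) (1 / 2) = INR n).
  { rewrite <- Rpower_plus. replace (1 / 2 + 1 / 2) with 1 by field. apply Rpower_1; auto. }
  set (p := prod_f_R0 (fun j => 1 / 2 + INR j) n) in *.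
  assert (H1 := INR_fact_pos n). assert (H2 := Rpower_pos (INR n) (1 / 2)).
  replace (p / (INR (fact n) * Rpower (INR n) (1 / 2)) * (p / (INR (fact n) * Rpower (INR n) (1 / 2))))
    with (p ^ 2 / (INR (fact n) ^ 2 * (Rpower (INR n) (1 / 2) * Rpower (INR n) (1 / 2)))) by (field; lra).
  rewrite Hr. apply Rle_ge.
  assert (Hf : 0 < INR (fact n) ^ 2 * INR n) by (apply Rmult_lt_0_compat; auto; apply pow_lt; auto).
  apply (Rmult_le_reg_r (INR (fact n) ^ 2 * INR n)); auto.
  replace (p ^ 2 / (INR (fact n) ^ 2 * INR n) * (INR (fact n) ^ 2 * INR n)) with (p ^ 2) by (field; lra).
  eapply Rle_trans; [|exact E]. rewrite S_INR. assert (0 < INR (fact n) ^ 2) by (apply pow_lt; auto). nra.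
Qed.

Lemma rgamma_half_nat (m : nat) : 0 < rgamma (INR m + 1 / 2).
Proof.
  induction m as [|m IH].
  - simpl; rewrite Rplus_0_l; apply rgamma_half.
  - rewrite rgamma_succ in IH. rewrite S_INR.
    replace (INR m + 1 + 1 / 2) with (INR m + 1 / 2 + 1) by ring.
    assert (H := pos_INR m). nra.
Qed.

Lemma rgamma_neg_half_nat (m : nat) : rgamma (1 / 2 - INR m) <> 0.
Proof.
  induction m as [|m IH].
  - simpl; rewrite Rminus_0_r; assert (H := rgamma_half); lra.
  - rewrite rgamma_succ, S_INR.
    replace (1 / 2 - (INR m + 1) + 1) with (1 / 2 - INR m) by ring.
    apply Rmult_integral_contrapositive; split; auto.
    assert (H := pos_INR m). lra.
Qed.

Lemma bounded_prefix (u : nat -> R) (N : nat) :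
  exists B, forall m, (m <= N)%nat -> Rabs (u m) <= B.
Proof.
  induction N as [|N [B HB]].
  - exists (Rabs (u 0%nat)); intros m Hm. replace m with 0%nat by lia. lra.
  - exists (Rmax B (Rabs (u (S N)))); intros m Hm.
    destruct (Nat.eq_dec m (S N)) as [->|Hne]; [apply Rmax_r|].
    eapply Rle_trans; [apply HB; lia|apply Rmax_l].
Qed.

(** By the functional equation, the step from m to m + 1 multiplies |rgamma (m + s)| r^m by r / |m +
    s|, at most 1 once m >= |s| + r; before that there are finitely many terms. *)
Lemma rgamma_entire (s r : R) : 0 < r -> exists B, forall m, Rabs (rgamma (INR m + s)) * r ^ m <= B.
Proof.
  intros Hr.
  destruct (nfloor_ex (Rabs s + r) ltac:(assert (H := Rabs_pos s); lra)) as [N [_ HN]].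
  destruct (bounded_prefix (fun m => rgamma (INR m + s) * r ^ m) (S N)) as [B HB].
  exists B.
  assert (Hp : forall m, 0 < r ^ m) by (intros; apply pow_lt; auto).
  assert (E : forall m, Rabs (rgamma (INR m + s)) * r ^ m = Rabs (rgamma (INR m + s) * r ^ m)).
  { intros m; rewrite Rabs_mult, (Rabs_pos_eq (r ^ m)); auto; left; auto. }
  assert (Hstep : forall m, (S N <= m)%nat ->
    Rabs (rgamma (INR (S m) + s)) * r ^ S m <= Rabs (rgamma (INR m + s)) * r ^ m).
  { intros m Hm; rewrite (rgamma_succ (INR m + s)), Rabs_mult.
    replace (INR m + s + 1) with (INR (S m) + s) by (rewrite S_INR; ring).
    simpl pow. assert (H2 : r <= Rabs (INR m + s)).
    { assert (H2 := Rabs_maj2 s). apply le_INR in Hm; rewrite S_INR in Hm. rewrite Rabs_pos_eq; lra. }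
    assert (H3 := Rabs_pos (rgamma (INR (S m) + s))).
    specialize (Hp m).
    replace (Rabs (INR m + s) * Rabs (rgamma (INR (S m) + s)) * r ^ m)
      with (Rabs (rgamma (INR (S m) + s)) * r ^ m * Rabs (INR m + s)) by ring.
    replace (Rabs (rgamma (INR (S m) + s)) * (r * r ^ m))
      with (Rabs (rgamma (INR (S m) + s)) * r ^ m * r) by ring.
    apply Rmult_le_compat_l; auto. apply Rmult_le_pos; auto. lra. }
  intros m; destruct (Nat.le_gt_cases m (S N)) as [H|H]; [rewrite E; apply HB; auto|].
  apply Nat.lt_le_incl in H; induction H as [|m Hm IH].
  - rewrite E; apply HB; auto.
  - eapply Rle_trans; [apply Hstep; auto|exact IH].
Qed.

(** * The derivative of 1/Gamma at the integers *)

Lemma exp_le_quadratic (x : R) : x <= 1 / 2 -> exp x <= 1 + x + 2 * x ^ 2.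
Proof.
  intros Hx; assert (H := exp_ineq1_le (- x)).
  rewrite exp_Ropp in H. assert (Hp := exp_pos x).
  assert (H1 : exp x * (1 - x) <= 1).
  { apply (Rmult_le_compat_l (exp x)) in H; [|lra]. rewrite Rinv_r in H by lra. lra. }
  apply (Rmult_le_reg_r (1 - x)); [lra|].
  eapply Rle_trans; [exact H1|]. 
  replace ((1 + x + 2 * x ^ 2) * (1 - x)) with (1 + x * x * (1 - 2 * x)) by ring.
  assert (0 <= x * x * (1 - 2 * x)) by (apply Rmult_le_pos; nra). lra.
Qed.

Lemma exp_sub_le_one_plus (x : R) : Rabs x <= 1 / 2 -> exp (x - 2 * x ^ 2) <= 1 + x.
Proof.
  intros Hx; apply Rabs_le_between in Hx.
  assert (H := exp_ineq1_le (2 * x ^ 2 - x)).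
  assert (Hp := exp_pos (2 * x ^ 2 - x)).
  replace (x - 2 * x ^ 2) with (- (2 * x ^ 2 - x)) by ring. rewrite exp_Ropp.
  apply (Rmult_le_reg_l (exp (2 * x ^ 2 - x))); auto. rewrite Rinv_r by lra.
  apply Rle_trans with ((1 + (2 * x ^ 2 - x)) * (1 + x)); [|apply Rmult_le_compat_r; lra].
  replace ((1 + (2 * x ^ 2 - x)) * (1 + x)) with (1 + x * x * (1 + 2 * x)) by ring.
  assert (0 <= x * x * (1 + 2 * x)) by (apply Rmult_le_pos; nra). lra.
Qed.

Definition harmonic (n : nat) : R := sum_f_R0 (fun j => / INR (S j)) n.

(** The limit is Euler's constant: from index 1 on the sequence decreases and is bounded below. As
    [harmonic n] is the harmonic number of index n + 1, it exceeds the usual sequence by 1/(n+1),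
    which tends to 0. *)
Lemma harmonic_ln_cv : exists g : R, is_lim_seq (fun n => harmonic n - ln (INR n)) g.
Proof.
  assert (Hl : forall n, ln (INR (S n) / INR (S (S n))) = ln (INR (S n)) - ln (INR (S (S n)))).
  { intros n; apply ln_div; apply INR_S_pos. }
  destruct (ex_finite_lim_seq_decr (fun n => harmonic (S n) - ln (INR (S n))) 0) as [g Hg].
  - intros n; unfold harmonic; rewrite (tech5 _ (S n)).
    assert (H := ln_le_pred (INR (S n) / INR (S (S n)))
       (Rdiv_lt_0_compat _ _ (INR_S_pos n) (INR_S_pos (S n)))). rewrite Hl in H.
    assert (H1 := INR_S_pos n).
    assert (INR (S n) / INR (S (S n)) - 1 = - / INR (S (S n)))
      by (rewrite (S_INR (S n)); field; lra).
    assert (/ INR (S (S (S n))) <= / INR (S (S n))).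
    { apply Rinv_le_contravar; [apply INR_S_pos|apply le_INR; lia]. }
    lra.
  - intros n.
    assert (H : ln (INR (S (S n))) <= harmonic n).
    { unfold harmonic; induction n as [|n IH].
      - simpl; assert (H := ln_le_pred (1 + 1) ltac:(lra)); lra.
      - rewrite tech5. assert (H := ln_le_pred (INR (S (S (S n))) / INR (S (S n)))
          (Rdiv_lt_0_compat _ _ (INR_S_pos _) (INR_S_pos _))).
        rewrite ln_div in H by apply INR_S_pos.
        assert (H1 := INR_S_pos (S n)).
        assert (INR (S (S (S n))) / INR (S (S n)) - 1 = / INR (S (S n)))
          by (rewrite (S_INR (S (S n))); field; lra).
        lra. }
    unfold harmonic in *; rewrite tech5.
    assert (ln (INR (S n)) <= ln (INR (S (S n)))).
    { apply ln_le; [apply INR_S_pos|apply le_INR; lia]. }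
    assert (0 < / INR (S (S n))) by (apply Rinv_0_lt_compat, INR_S_pos). lra.
  - exists g; apply is_lim_seq_incr_1; exact Hg.
Qed.

(** A finite form of Weierstrass's product around 1; the factor n^(-e) supplies the logarithm that
    balances the harmonic sum. *)
Lemma rg_seq_one_plus (e : R) (n : nat) : (1 <= n)%nat ->
  rg_seq (1 + e) n = (1 + / INR n) * prod_f_R0 (fun j => 1 + e / INR (S j)) n * exp (- e * ln (INR n)).
Proof.
  intros Hn; unfold rg_seq.
  assert (H0 : 0 < INR n) by (apply lt_0_INR; lia).
  assert (E : forall k, prod_f_R0 (fun j => 1 + e + INR j) k
    = INR (fact (S k)) * prod_f_R0 (fun j => 1 + e / INR (S j)) k).
  { induction k as [|k IH]; [simpl; field|].
    cbn [prod_f_R0]; rewrite IH, (fact_simpl (S k)), mult_INR.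
    assert (H := INR_S_pos (S k)). rewrite (S_INR (S k)) in *. field; lra. }
  rewrite E, Rpower_plus, Rpower_1, fact_simpl, mult_INR, S_INR by auto.
  assert (H2 := INR_fact_pos n).
  replace (exp (- e * ln (INR n))) with (/ Rpower (INR n) e).
  - assert (H3 := Rpower_pos (INR n) e). field; lra.
  - rewrite <- Rpower_Ropp; reflexivity.
Qed.

Lemma prod_one_plus_bounds (e : R) (n : nat) : Rabs e <= 1 / 2 ->
  exp (e * harmonic n - 4 * e ^ 2) <= prod_f_R0 (fun j => 1 + e / INR (S j)) n <= exp (e * harmonic n).
Proof.
  intros He.
  assert (Hsm : forall j, Rabs (e / INR (S j)) <= 1 / 2).
  { intros j; unfold Rdiv at 1; rewrite Rabs_mult, Rabs_inv, (Rabs_pos_eq (INR (S j))) by apply pos_INR.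
    assert (/ INR (S j) <= 1). { rewrite <- Rinv_1; apply Rinv_le_contravar; [lra|]. rewrite S_INR; assert (H := pos_INR j); lra. }
    assert (0 < / INR (S j)) by (apply Rinv_0_lt_compat, INR_S_pos).
    assert (H1 := Rabs_pos e). nra. }
  (* The induction carries 2 - 1/(n+1), an upper bound for the sum of 1/j^2 up to j = n + 1, because
     1/(j+1)^2 <= 1/j - 1/(j+1); it is weakened to 2 at the end. *)
  assert (Hq : forall n, exp (e * harmonic n - 2 * e ^ 2 * (2 - / INR (S n)))
     <= prod_f_R0 (fun j => 1 + e / INR (S j)) n <= exp (e * harmonic n)).
  { intros k; unfold harmonic; induction k as [|k IH].
    - assert (S0 := Hsm 0%nat). simpl in *. split.
      + assert (H := exp_sub_le_one_plus _ S0).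
        replace (e * / 1 - 2 * (e * (e * 1)) * (2 - / 1)) with (e / 1 - 2 * (e / 1) ^ 2) by field. exact H.
      + assert (H := exp_ineq1_le (e * / 1)). exact H.
    - cbn [prod_f_R0 sum_f_R0].
      assert (S0 := Hsm (S k)).
      assert (Hlow := exp_sub_le_one_plus _ S0).
      assert (Hup := exp_ineq1_le (e / INR (S (S k)))).
      assert (Hp := INR_S_pos k). assert (Hp2 := INR_S_pos (S k)).
      destruct IH as [IH1 IH2].
      assert (P1 := exp_pos (e * sum_f_R0 (fun j => / INR (S j)) k - 2 * e ^ 2 * (2 - / INR (S k)))).
      assert (P2 := exp_pos (e / INR (S (S k)) - 2 * (e / INR (S (S k))) ^ 2)).
      split.
      + eapply Rle_trans; [|apply Rmult_le_compat; [| |exact IH1|exact Hlow]]; try lra.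
        rewrite <- exp_plus; apply exp_le_compat.
        assert (E : / INR (S (S k)) ^ 2 <= / INR (S k) - / INR (S (S k))).
        { replace (/ INR (S k) - / INR (S (S k))) with (/ (INR (S k) * INR (S (S k))))
            by (rewrite (S_INR (S k)); field; split; rewrite ?S_INR in *; lra).
          apply Rinv_le_contravar; [nra|]. rewrite (S_INR (S k)) in *. nra. }
        assert (0 <= e ^ 2) by apply pow2_ge_0.
        replace ((e / INR (S (S k))) ^ 2) with (e ^ 2 * / INR (S (S k)) ^ 2) by (field; lra).
        unfold Rdiv. nra.
      + rewrite (Rmult_plus_distr_l e), exp_plus. apply Rmult_le_compat; auto; try lra.
        all: unfold Rdiv in *; lra. }
  destruct (Hq n) as [H1 H2]; split; auto.
  eapply Rle_trans; [|exact H1]. apply exp_le_compat.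
  assert (0 < / INR (S n)) by (apply Rinv_0_lt_compat, INR_S_pos).
  assert (0 <= e ^ 2) by apply pow2_ge_0. nra.
Qed.

(** The gap between the two bounds is of second order in e, so g is the derivative at 1 by a
    sandwich, and no infinite product is differentiated. *)
Lemma rgamma_near_one : exists g, forall e, Rabs e <= 1 / 2 ->
  exp (e * g - 4 * e ^ 2) <= rgamma (1 + e) <= exp (e * g).
Proof.
  destruct harmonic_ln_cv as [g Hg]; exists g; intros e He.
  assert (Hexp : forall c, is_lim_seq (fun n => (1 + / INR n) * exp (e * (harmonic n - ln (INR n)) - c))
     (exp (e * g - c))).
  { intros c. replace (exp (e * g - c)) with ((1 + 0) * exp (e * g - c)) by ring.
    apply is_lim_seq_mult'.
    - apply is_lim_seq_plus'; [apply is_lim_seq_const|apply is_lim_seq_inv_INR].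
    - apply (is_lim_seq_continuous exp); [apply derivable_continuous_pt, derivable_pt_exp|].
      apply is_lim_seq_minus'; [|apply is_lim_seq_const].
      apply (is_lim_seq_scal_l _ e g); auto. }
  assert (Hev : eventually (fun n =>
    (1 + / INR n) * exp (e * (harmonic n - ln (INR n)) - 4 * e ^ 2) <= rg_seq (1 + e) n /\
    rg_seq (1 + e) n <= (1 + / INR n) * exp (e * (harmonic n - ln (INR n)) - 0))).
  { exists 1%nat; intros n Hn; rewrite rg_seq_one_plus by auto.
    destruct (prod_one_plus_bounds e n He) as [H1 H2].
    assert (H3 : 0 < / INR n) by (apply Rinv_0_lt_compat, lt_0_INR; lia).
    assert (Hp := exp_pos (- e * ln (INR n))).
    replace (e * (harmonic n - ln (INR n)) - 4 * e ^ 2) with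
      (e * harmonic n - 4 * e ^ 2 + - e * ln (INR n)) by ring.
    replace (e * (harmonic n - ln (INR n)) - 0) with (e * harmonic n + - e * ln (INR n)) by ring.
    rewrite !exp_plus, <- !Rmult_assoc.
    split; (apply Rmult_le_compat_r; [lra|]); apply Rmult_le_compat_l; lra. }
  split.
  - apply (is_lim_seq_le_loc _ _ _ _ (filter_imp _ _ (fun n H => proj1 H) Hev) (Hexp _) (rgamma_cv _)).
  - rewrite <- (Rminus_0_r (e * g)).
    apply (is_lim_seq_le_loc _ _ _ _ (filter_imp _ _ (fun n H => proj2 H) Hev) (rgamma_cv _) (Hexp _)).
Qed.

Lemma ex_derive_rgamma_1 : ex_derive rgamma 1.
Proof.
  destruct rgamma_near_one as [g Hg]; exists g.
  apply is_derive_Reals.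
  (* 4 comes from the lower bound of [rgamma_near_one], the rest from [exp_le_quadratic] at h g. The
     first entry of [d] below keeps |h| and |h g| under 1/2. *)
  set (C := 4 + 2 * (Rabs g + 2) ^ 2).
  assert (HC : 0 < C) by (unfold C; assert (H := pow2_ge_0 (Rabs g + 2)); lra).
  assert (Hag := Rabs_pos g).
  intros eps Heps.
  set (d := Rmin (1 / (2 * (Rabs g + 1))) (eps / C)).
  assert (Hd : 0 < d) by (unfold d; apply Rmin_pos; apply Rdiv_lt_0_compat; lra).
  exists (mkposreal d Hd); intros h Hh Hhd; simpl in Hhd.
  assert (D1 : d <= 1 / (2 * (Rabs g + 1))) by apply Rmin_l.
  assert (D2 : d <= eps / C) by apply Rmin_r.
  assert (Hhg : Rabs h * (Rabs g + 1) <= 1 / 2).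
  { apply Rle_trans with (1 / (2 * (Rabs g + 1)) * (Rabs g + 1)).
    - apply Rmult_le_compat_r; lra.
    - right; field; lra. }
  assert (Hh0 := Rabs_pos h).
  assert (Hh2 : Rabs h <= 1 / 2) by nra.
  destruct (Hg h Hh2) as [L U]. rewrite rgamma_1.
  assert (Hgh : Rabs (h * g) <= Rabs h * (Rabs g + 1)) by (rewrite Rabs_mult; nra).
  assert (Hgh' : h * g <= 1 / 2) by (assert (H := Rle_abs (h * g)); lra).
  assert (U2 := exp_le_quadratic (h * g) Hgh').
  assert (L2 := exp_ineq1_le (h * g - 4 * h ^ 2)).
  assert (Hsq : (h * g) ^ 2 <= h ^ 2 * (Rabs g + 2) ^ 2).
  { rewrite Rpow_mult_distr; apply Rmult_le_compat_l; [apply pow2_ge_0|].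
    rewrite <- (pow2_abs g). apply pow_incr; lra. }
  assert (Hmain : Rabs (rgamma (1 + h) - 1 - g * h) <= C * h ^ 2).
  { apply Rabs_le; unfold C. assert (0 <= h ^ 2) by apply pow2_ge_0.
    assert (0 <= h ^ 2 * (Rabs g + 2) ^ 2) by (apply Rmult_le_pos; apply pow2_ge_0). split; lra. }
  replace ((rgamma (1 + h) - 1) / h - g) with ((rgamma (1 + h) - 1 - g * h) / h) by (field; auto).
  unfold Rdiv; rewrite Rabs_mult, Rabs_inv.
  assert (Hhp : 0 < Rabs h) by (apply Rabs_pos_lt; auto).
  apply (Rmult_lt_reg_r (Rabs h)); auto. rewrite Rmult_assoc, Rinv_l by lra. rewrite Rmult_1_r.
  eapply Rle_lt_trans; [exact Hmain|].
  rewrite <- (pow2_abs h). simpl; rewrite Rmult_1_r, <- Rmult_assoc.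
  apply Rmult_lt_compat_r; auto.
  apply Rlt_le_trans with (C * (eps / C)); [apply Rmult_lt_compat_l; lra|right; field; lra].
Qed.

Lemma is_derive_rgamma_down (z l : R) : is_derive rgamma (z + 1) l ->
  is_derive rgamma z (rgamma (z + 1) + z * l).
Proof.
  intros H.
  apply (is_derive_ext (fun t => t * rgamma (t + 1))); [intros; symmetry; apply rgamma_succ|].
  replace (rgamma (z + 1) + z * l) with (1 * rgamma (z + 1) + z * l) by ring.
  apply (is_derive_mul_R (fun t => t) (fun t => rgamma (t + 1))).
  - auto_derive; auto.
  - replace l with (scal 1 l) by (unfold scal; simpl; unfold mult; simpl; ring).
    apply (is_derive_comp rgamma (fun t => t + 1)); auto. auto_derive; auto; ring.
Qed.

Lemma ex_derive_rgamma_up (z : R) : z <> 0 -> ex_derive rgamma z -> ex_derive rgamma (z + 1).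
Proof.
  intros Hz H.
  apply (ex_derive_ext_loc (fun t => rgamma (t - 1) / (t - 1))).
  - assert (Hp : 0 < Rabs z) by (apply Rabs_pos_lt; auto).
    exists (mkposreal _ Hp); intros y Hy.
    unfold ball in Hy; simpl in Hy; unfold AbsRing_ball, abs, minus, plus, opp in Hy; simpl in Hy.
    revert y Hy; change (forall y : R, Rabs (y + - (z + 1)) < Rabs z -> rgamma (y - 1) / (y - 1) = rgamma y); intros y Hy.
    rewrite (rgamma_succ (y - 1)). replace (y - 1 + 1) with y by ring. field.
    intros E. replace (y + - (z + 1)) with (- z) in Hy by lra. rewrite Rabs_Ropp in Hy; lra.
  - apply ex_derive_div; [| |replace (z + 1 - 1) with z by ring; auto].
    + apply (ex_derive_comp rgamma (fun t => t - 1)); [replace (z + 1 - 1) with z by ring; auto|].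
      auto_derive; auto.
    + auto_derive; auto.
Qed.

(** Upwards from 1 the functional equation is solved for rgamma (z + 1), dividing by a positive z;
    downwards it only multiplies. The form m - n + 1 is the one that occurs in the series. *)
Lemma ex_derive_rgamma_int (m n : nat) : ex_derive rgamma (INR m - INR n + 1).
Proof.
  induction n as [|n IH].
  - rewrite Rminus_0_r; induction m as [|m IH].
    + simpl; rewrite Rplus_0_l; apply ex_derive_rgamma_1.
    + rewrite S_INR; apply ex_derive_rgamma_up; auto.
      assert (H := pos_INR m); lra.
  - destruct IH as [l Hl]; eexists; apply is_derive_rgamma_down.
    rewrite S_INR. replace (INR m - (INR n + 1) + 1 + 1) with (INR m - INR n + 1) by ring. exact Hl.
Qed.

Definition drg (z : R) : R := Derive rgamma z.

Lemma drg_succ (m n : nat) : let z := INR m - INR n in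
  drg z = rgamma (z + 1) + z * drg (z + 1).
Proof.
  intros z; apply is_derive_unique, is_derive_rgamma_down, Derive_correct, ex_derive_rgamma_int.
Qed.

Definition rg_quot (m n : nat) (z : R) : R :=
  (rgamma (INR m - INR n + 1 + z) - rgamma (INR m - INR n + 1)) / z.

Lemma diff_quot_cv (f : R -> R) (x l : R) (z : nat -> R) :
  is_derive f x l -> is_lim_seq z 0 -> (forall k, z k <> 0) ->
  is_lim_seq (fun k => (f (x + z k) - f x) / z k) l.
Proof.
  intros Hf Hz Hz0; apply is_derive_Reals in Hf.
  apply is_lim_seq_spec; intros eps.
  destruct (Hf eps (cond_pos eps)) as [d Hd].
  apply is_lim_seq_spec in Hz; destruct (Hz d) as [N HN].
  exists N; intros k Hk; apply Hd; auto.
  specialize (HN k Hk); now rewrite Rminus_0_r in HN.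
Qed.

Lemma is_lim_seq_bounded (u : nat -> R) (l : R) : is_lim_seq u l ->
  exists B, forall k, Rabs (u k) <= B.
Proof.
  intros H; apply is_lim_seq_spec in H; destruct (H (mkposreal _ Rlt_0_1)) as [N HN]; simpl in HN.
  destruct (bounded_prefix u N) as [B HB].
  exists (Rmax B (Rabs l + 1)); intros k.
  destruct (Nat.le_gt_cases k N) as [Hk|Hk].
  - eapply Rle_trans; [apply HB; auto|apply Rmax_l].
  - eapply Rle_trans; [|apply Rmax_r]. specialize (HN k ltac:(lia)).
    replace (u k) with (l + (u k - l)) by ring.
    eapply Rle_trans; [apply Rabs_triang|]. lra.
Qed.

Lemma rg_quot_cv (m n : nat) (z : nat -> R) : is_lim_seq z 0 -> (forall k, z k <> 0) ->
  is_lim_seq (fun k => rg_quot m n (z k)) (drg (INR m - INR n + 1)).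
Proof.
  intros Hz Hz0; apply diff_quot_cv; auto. apply Derive_correct, ex_derive_rgamma_int.
Qed.

(** The majorant for the termwise limit, uniform in m. For m <= n + 1 each sequence is bounded
    because it converges; beyond that the functional equation gives a recursion from m to m + 1. *)
Lemma rg_quot_bounded (n : nat) (z : nat -> R) : is_lim_seq z 0 -> (forall k, z k <> 0) ->
  (forall k, Rabs (z k) <= 1 / 2) -> exists B, forall m k, Rabs (rg_quot m n (z k)) <= B.
Proof.
  intros Hz Hz0 Hz1.
  assert (Hpre : forall N, exists B, forall m, (m <= N)%nat -> forall k, Rabs (rg_quot m n (z k)) <= B).
  { induction N as [|N [B HB]].
    - destruct (is_lim_seq_bounded _ _ (rg_quot_cv 0 n z Hz Hz0)) as [B HB].
      exists B; intros m Hm k. replace m with 0%nat by lia. apply HB.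
    - destruct (is_lim_seq_bounded _ _ (rg_quot_cv (S N) n z Hz Hz0)) as [B' HB'].
      exists (Rmax B B'); intros m Hm k. destruct (Nat.eq_dec m (S N)) as [->|Hne].
      + eapply Rle_trans; [apply HB'|apply Rmax_r].
      + eapply Rle_trans; [apply HB; lia|apply Rmax_l]. }
  destruct (Hpre (S n)) as [B HB].
  (* Beyond n + 1 one has p + z >= 3/2, and the recursion sends a bound Q to (Q + 1) / (3/2), which
     is at most Q once Q >= 2. *)
  exists (Rmax B 2). intros m; destruct (Nat.le_gt_cases m (S n)) as [Hm|Hm].
  - intros k; eapply Rle_trans; [apply HB; auto|apply Rmax_l].
  - apply Nat.lt_le_incl in Hm; induction Hm as [|m Hm IH]; intros k.
    + eapply Rle_trans; [apply HB; auto|apply Rmax_l].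
    + specialize (IH k).
      set (p := INR m - INR n + 1) in *.
      assert (Hp : 2 <= p).
      { unfold p; apply le_INR in Hm; rewrite S_INR in Hm; lra. }
      assert (Hzk := Hz1 k). apply Rabs_le_between in Hzk.
      assert (E : rg_quot (S m) n (z k) = (rg_quot m n (z k) - rgamma p / p) / (p + z k)).
      { unfold rg_quot; rewrite S_INR.
        replace (INR m + 1 - INR n + 1 + z k) with (p + z k + 1) by (unfold p; ring).
        replace (INR m + 1 - INR n + 1) with (p + 1) by (unfold p; ring). fold p.
        rewrite (rgamma_succ (p + z k)), (rgamma_succ p).
        specialize (Hz0 k). field. repeat split; auto; lra. }
      assert (Hg : Rabs (rgamma p / p) <= 1).
      { replace p with (INR (m - n) + 1) by (rewrite minus_INR by lia; unfold p; ring).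
        rewrite rgamma_nat. assert (H1 := INR_fact_pos (m - n)).
        assert (H2 := pos_INR (m - n)).
        assert (1 <= INR (fact (m - n))) by (apply (le_INR 1), lt_O_fact).
        rewrite Rabs_pos_eq.
        - unfold Rdiv; rewrite <- Rinv_mult, <- Rinv_1. apply Rinv_le_contravar; nra.
        - apply Rdiv_le_0_compat; [left; apply Rinv_0_lt_compat; auto|lra]. }
      rewrite E; unfold Rdiv at 1; rewrite Rabs_mult, Rabs_inv, (Rabs_pos_eq (p + z k)) by lra.
      apply (Rmult_le_reg_r (p + z k)); [lra|]. rewrite Rmult_assoc, Rinv_l, Rmult_1_r by lra.
      assert (Hmax := Rmax_r B 2).
      unfold Rminus; eapply Rle_trans; [apply Rabs_triang|]. rewrite Rabs_Ropp. nra.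
Qed.

(** * Bessel functions *)

Definition entire (a : nat -> R) : Prop :=
  forall r, 0 < r -> exists B, forall m, Rabs (a m) * r ^ m <= B.

Lemma entire_geometric (a : nat -> R) (y : R) : entire a ->
  exists B q, 0 < q /\ (forall m, Rabs (a m) <= B * q ^ m) /\ q * Rabs y < 1.
Proof.
  intros Ha; assert (Hy := Rabs_pos y).
  destruct (Ha (Rabs y + 1) ltac:(lra)) as [B HB].
  exists B, (/ (Rabs y + 1)); split; [apply Rinv_0_lt_compat; lra|split].
  - intros m; assert (Hp : 0 < (Rabs y + 1) ^ m) by (apply pow_lt; lra).
    apply (Rmult_le_reg_r ((Rabs y + 1) ^ m)); auto.
    rewrite Rmult_assoc, <- Rpow_mult_distr, Rinv_l, pow1, Rmult_1_r by lra. apply HB.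
  - apply (Rmult_lt_reg_l (Rabs y + 1)); [lra|].
    rewrite <- Rmult_assoc, Rinv_r by lra. lra.
Qed.

Lemma entire_ex_series (a : nat -> R) (y : R) : entire a ->
  ex_series (fun m => Rabs (a m * y ^ m)) /\ ex_series (fun m => a m * y ^ m).
Proof.
  intros Ha; destruct (entire_geometric a y Ha) as (B & q & Hq & HB & Hqy).
  apply (ex_series_mul_pow a B q); auto; lra.
Qed.

Lemma entire_is_derive (a : nat -> R) (y : R) : entire a ->
  is_derive (PSeries a) y (PSeries (PS_derive a) y) /\
  ex_series (fun m => INR (S m) * a (S m) * y ^ m).
Proof.
  intros Ha; destruct (entire_geometric a y Ha) as (B & q & Hq & HB & Hqy).
  apply is_derive_Series_pow, (CV_radius_gt a B q); auto.
Qed.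

Lemma entire_plus (a b : nat -> R) : entire a -> entire b -> entire (fun m => a m + b m).
Proof.
  intros Ha Hb r Hr; destruct (Ha r Hr) as [A HA]; destruct (Hb r Hr) as [B HB].
  exists (A + B); intros m; specialize (HA m); specialize (HB m).
  assert (Hp : 0 < r ^ m) by (apply pow_lt; auto).
  assert (Ht := Rabs_triang (a m) (b m)). nra.
Qed.

Lemma entire_rgamma (c : nat -> R) (C s : R) : (forall m, Rabs (c m) <= C) ->
  entire (fun m => c m * rgamma (INR m + s)).
Proof.
  intros Hc r Hr; destruct (rgamma_entire s r Hr) as [B HB].
  exists (C * B); intros m; rewrite Rabs_mult, Rmult_assoc.
  apply Rmult_le_compat; auto using Rabs_pos.
  apply Rmult_le_pos; [apply Rabs_pos|apply pow_le; lra].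
Qed.

Lemma rgamma_bounded (s : R) : exists B, forall m, Rabs (rgamma (INR m + s)) <= B.
Proof.
  destruct (rgamma_entire s 1 Rlt_0_1) as [B HB]; exists B; intros m.
  specialize (HB m); rewrite pow1 in HB; lra.
Qed.

Lemma pow_neg1_abs (m : nat) : Rabs ((-1) ^ m) = 1.
Proof. rewrite <- RPow_abs, Rabs_left by lra. replace (- -1) with 1 by ring. apply pow1. Qed.

(** * The entire part of J and the Bessel system *)

Definition cE (s : R) (m : nat) : R :=
  (-1) ^ m * rgamma (INR m + s + 1) * rgamma (INR m + 1).

Lemma cE_entire (s : R) : entire (cE s).
Proof.
  destruct (rgamma_bounded (s + 1)) as [B HB].
  apply (entire_rgamma (fun m => (-1) ^ m * rgamma (INR m + s + 1)) B).
  intros m; rewrite Rabs_mult, pow_neg1_abs, Rmult_1_l, Rplus_assoc. apply HB.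
Qed.

Lemma cE_derive (s : R) (m : nat) : INR (S m) * cE s (S m) = - cE (s + 1) m.
Proof.
  unfold cE; rewrite S_INR, (rgamma_succ (INR m + 1)).
  replace (INR m + 1 + s + 1) with (INR m + (s + 1) + 1) by ring. simpl; ring.
Qed.

Lemma cE_rec (s : R) (m : nat) : cE s m = (INR m + (s + 1)) * cE (s + 1) m.
Proof.
  unfold cE; rewrite (rgamma_succ (INR m + s + 1)).
  replace (INR m + (s + 1) + 1) with (INR m + s + 1 + 1) by ring. ring.
Qed.

(** With y = (x/2)^2, J_s(x) = (x/2)^s bE s y: the Bessel-Clifford function at -y, which is regular
    at y = 0. Writing 1/m! as [rgamma (INR m + 1)] in [cE] puts both factors under the same
    functional equation. *)
Definition bE (s y : R) : R := PSeries (cE s) y.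

Lemma bE_derive (s y : R) : is_derive (bE s) y (- bE (s + 1) y).
Proof.
  destruct (entire_is_derive _ y (cE_entire s)) as [H _].
  replace (- bE (s + 1) y) with (PSeries (PS_derive (cE s)) y); [exact H|].
  unfold bE, PSeries; rewrite <- Series_opp. apply Series_ext; intros m.
  unfold PS_derive; rewrite cE_derive; ring.
Qed.

Lemma bE_rec (s y : R) : bE s y = (s + 1) * bE (s + 1) y - y * bE (s + 2) y.
Proof.
  destruct (entire_is_derive _ y (cE_entire (s + 1))) as [_ H].
  destruct (entire_ex_series _ y (cE_entire (s + 1))) as [_ H1].
  assert (H2 := Series_shift_pow _ _ H). apply Series_correct in H1.
  assert (H3 := is_series_unique _ _ (is_series_plus _ _ _ _ (is_series_scal_R (s + 1) _ _ H1) H2)).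
  change plus with Rplus in H3; cbv beta in H3.
  transitivity (Series (fun n => (s + 1) * (cE (s + 1) n * y ^ n) + INR n * cE (s + 1) n * y ^ n)).
  - apply Series_ext; intros m. rewrite (cE_rec s); ring.
  - rewrite H3. unfold bE, PSeries. 
    replace (Series (fun n => INR (S n) * cE (s + 1) (S n) * y ^ n))
      with (- Series (fun k => cE (s + 2) k * y ^ k)); [ring|].
    rewrite <- Series_opp; apply Series_ext; intros m.
    rewrite cE_derive. replace (s + 1 + 1) with (s + 2) by ring. ring.
Qed.

Lemma bessel_J_bE (s x : R) : bessel_J s x = Rpower (x / 2) s * bE s ((x / 2) ^ 2).
Proof.
  unfold bessel_J, bE, PSeries, cE; f_equal; apply Series_ext; intros m.
  rewrite rgamma_nat, <- pow_mult; reflexivity.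
Qed.

Lemma Rpower_succ (x s : R) : 0 < x -> Rpower (x / 2) (s + 1) = Rpower (x / 2) s * (x / 2).
Proof. intros Hx; rewrite Rpower_plus, Rpower_1; auto; lra. Qed.

Lemma is_derive_Rpower_mul (s x : R) (B : R -> R) (B' : R) : 0 < x -> is_derive B x B' ->
  is_derive (fun x => Rpower (x / 2) s * B x) x (Rpower (x / 2) s * (s / x * B x + B')).
Proof.
  intros Hx HB.
  assert (HR : is_derive (fun x => Rpower (x / 2) s) x (s / x * Rpower (x / 2) s)).
  { unfold Rpower; auto_derive; [lra|].
    replace (x * / 2) with (x / 2) by reflexivity. field; lra. }
  replace (Rpower (x / 2) s * (s / x * B x + B'))
    with (s / x * Rpower (x / 2) s * B x + Rpower (x / 2) s * B') by ring.
  apply (is_derive_mul_R (fun x => Rpower (x / 2) s) B); auto.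
Qed.

Lemma is_derive_sq_half (f : R -> R) (x l : R) : is_derive f ((x / 2) ^ 2) l ->
  is_derive (fun x => f ((x / 2) ^ 2)) x (x / 2 * l).
Proof.
  intros H; apply (is_derive_comp f (fun x => (x / 2) ^ 2)); auto.
  auto_derive; auto; field.
Qed.

Lemma bessel_J_system (s : R) : bessel_system s (bessel_J s) (bessel_J (s + 1)).
Proof.
  assert (D : forall s x, 0 < x -> is_derive (bessel_J s) x (s / x * bessel_J s x - bessel_J (s + 1) x)).
  { clear s; intros s x Hx.
    apply (is_derive_ext (fun x => Rpower (x / 2) s * bE s ((x / 2) ^ 2)));
      [intros; symmetry; apply bessel_J_bE|].
    rewrite !bessel_J_bE, Rpower_succ by auto.
    replace (s / x * (Rpower (x / 2) s * bE s ((x / 2) ^ 2)) -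
      Rpower (x / 2) s * (x / 2) * bE (s + 1) ((x / 2) ^ 2))
      with (Rpower (x / 2) s * (s / x * bE s ((x / 2) ^ 2) + x / 2 * - bE (s + 1) ((x / 2) ^ 2))) by ring.
    apply (is_derive_Rpower_mul s x (fun x => bE s ((x / 2) ^ 2))); auto.
    apply is_derive_sq_half, bE_derive. }
  intros x Hx; split; [apply D; auto|].
  replace (bessel_J s x - (s + 1) / x * bessel_J (s + 1) x)
    with ((s + 1) / x * bessel_J (s + 1) x - bessel_J (s + 1 + 1) x); [apply D; auto|].
  rewrite !bessel_J_bE, (bE_rec s), !Rpower_succ by auto.
  replace (s + 1 + 1) with (s + 2) by ring. field; lra.
Qed.

Lemma bessel_system_lin (mu a b : R) (p1 q1 p2 q2 : R -> R) :
  bessel_system mu p1 q1 -> bessel_system mu p2 q2 ->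
  bessel_system mu (fun x => a * p1 x + b * p2 x) (fun x => a * q1 x + b * q2 x).
Proof.
  intros H1 H2 x Hx; destruct (H1 x Hx) as [A1 B1]; destruct (H2 x Hx) as [A2 B2]; split.
  - replace (mu / x * (a * p1 x + b * p2 x) - (a * q1 x + b * q2 x))
      with (plus (a * (mu / x * p1 x - q1 x)) (b * (mu / x * p2 x - q2 x)))
      by (unfold plus; simpl; ring).
    apply (is_derive_plus (fun x => a * p1 x) (fun x => b * p2 x)); apply is_derive_scal; auto.
  - replace (a * p1 x + b * p2 x - (mu + 1) / x * (a * q1 x + b * q2 x))
      with (plus (a * (p1 x - (mu + 1) / x * q1 x)) (b * (p2 x - (mu + 1) / x * q2 x)))
      by (unfold plus; simpl; ring).
    apply (is_derive_plus (fun x => a * q1 x) (fun x => b * q2 x)); apply is_derive_scal; auto.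
Qed.

Lemma bessel_system_ext (mu : R) (p q p' q' : R -> R) :
  (forall x, 0 < x -> p x = p' x) -> (forall x, 0 < x -> q x = q' x) ->
  bessel_system mu p q -> bessel_system mu p' q'.
Proof.
  intros Hp Hq H x Hx; destruct (H x Hx) as [A B].
  rewrite <- Hp, <- Hq by auto.
  assert (L : locally x (fun y => 0 < y)) by (apply open_gt; auto).
  split; (eapply is_derive_ext_loc; [|eassumption]); eapply filter_imp; try exact L;
    intros y Hy; auto.
Qed.

(** The sign of the partner is forced by the recurrences; it is also the sign that sin((s+1) PI) = -
    sin(s PI) produces in the quotient defining Y, so J and Y satisfy one system. *)
Lemma bessel_J_neg_system (s : R) :
  bessel_system s (bessel_J (- s)) (fun x => - bessel_J (- (s + 1)) x).
Proof.
  intros x Hx; destruct (bessel_J_system (- (s + 1)) x Hx) as [A B].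
  replace (- (s + 1) + 1) with (- s) in * by ring. split.
  - replace (s / x * bessel_J (- s) x - - bessel_J (- (s + 1)) x)
      with (bessel_J (- (s + 1)) x - - s / x * bessel_J (- s) x); auto.
    unfold Rdiv; ring.
  - replace (bessel_J (- s) x - (s + 1) / x * - bessel_J (- (s + 1)) x)
      with (opp (- (s + 1) / x * bessel_J (- (s + 1)) x - bessel_J (- s) x)).
    + apply (is_derive_opp (bessel_J (- (s + 1)))); auto.
    + unfold opp; simpl; unfold Rdiv; ring.
Qed.

(** * Wronskians, and Y of non-integer order *)

Lemma bessel_wronskian (mu : R) (p1 q1 p2 q2 : R -> R) :
  bessel_system mu p1 q1 -> bessel_system mu p2 q2 ->
  exists c, forall x, 0 < x -> x * (q1 x * p2 x - p1 x * q2 x) = c.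
Proof.
  intros H1 H2.
  set (W := fun x => x * (q1 x * p2 x - p1 x * q2 x)).
  assert (D : forall x, 0 < x -> is_derive W x 0).
  { intros x Hx; destruct (H1 x Hx) as [A1 B1]; destruct (H2 x Hx) as [A2 B2].
    assert (DD := is_derive_minus _ _ _ _ _ (is_derive_mul_R _ _ _ _ _ B1 A2)
                   (is_derive_mul_R _ _ _ _ _ A1 B2)).
    assert (D1 : is_derive (fun x : R => x) x 1) by (auto_derive; auto).
    assert (D2 := is_derive_mul_R _ _ _ _ _ D1 DD).
    eapply is_derive_ext; [|evar_last; [exact D2|]].
    - intros; reflexivity.
    - unfold minus, plus, opp; simpl. field; lra. }
  exists (W 1); intros x Hx; fold (W x).
  assert (Hm : forall a b, 0 < a -> a <= b -> W a = W b).
  { intros a b Ha Hab. apply Rle_antisym.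
    - assert (E := decreasing_of_derive (fun x => - W x) (fun _ => - 0) a b Hab). simpl in E.
      assert (- W b <= - W a); [|lra]. apply E.
      + intros y Hy. apply (is_derive_opp W y 0), D; lra.
      + intros; lra.
    - apply (decreasing_of_derive W (fun _ => 0)); auto; intros; [apply D|]; lra. }
  destruct (Rle_dec 1 x); [symmetry|]; apply Hm; lra.
Qed.

(** Lets the behaviour of a Wronskian as x -> 0 be read off once powers of x are divided out and
    only entire functions of y = (x/2)^2 remain. *)
Lemma eq_zero_at_0 (f : R -> R) : continuous f 0 -> (forall y, 0 < y -> f y = 0) -> f 0 = 0.
Proof.
  intros Hc Hf.
  assert (H : is_lim_seq (fun n => f (/ (INR n + 1))) (f 0)).
  { apply (filterlim_comp _ _ _ (fun n => / (INR n + 1)) f eventually (locally 0)); auto.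
    assert (L : is_lim_seq (fun n => / (INR n + 1)) 0).
    { apply (is_lim_seq_ext (fun n => / INR (S n))); [intros; now rewrite S_INR|].
      apply (is_lim_seq_incr_1 (fun n => / INR n)), is_lim_seq_inv_INR. }
    exact L. }
  apply (is_lim_seq_ext _ (fun _ => 0)) in H.
  - apply is_lim_seq_unique in H; rewrite Lim_seq_const in H. now injection H.
  - intros n; apply Hf, Rinv_0_lt_compat. assert (Hn := pos_INR n); lra.
Qed.

Lemma bE_0 (s : R) : bE s 0 = rgamma (s + 1).
Proof.
  unfold bE; rewrite PSeries_0; unfold cE; simpl.
  rewrite !Rplus_0_l, rgamma_1; ring.
Qed.

(** Were the Wronskian zero, dividing by the powers of x/2 would leave an identity between entire
    functions of y; at y = 0 it says rgamma (s + 1) rgamma (- s) = 0, against the hypotheses. *)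
Lemma bessel_Y_nonint (s : R) : sin (s * PI) <> 0 ->
  rgamma (s + 1) <> 0 -> rgamma (- s) <> 0 ->
  bessel_system s (bessel_Y s) (bessel_Y (s + 1)) /\
  exists c, c <> 0 /\ forall x, 0 < x ->
    x * (bessel_J (s + 1) x * bessel_Y s x - bessel_J s x * bessel_Y (s + 1) x) = c.
Proof.
  intros Hs Hr1 Hr2.
  assert (Hsin : sin ((s + 1) * PI) = - sin (s * PI)).
  { rewrite Rmult_plus_distr_r, Rmult_1_l; apply neg_sin. }
  assert (Hcos : cos ((s + 1) * PI) = - cos (s * PI)).
  { rewrite Rmult_plus_distr_r, Rmult_1_l; apply neg_cos. }
  assert (E1 : forall x, bessel_Y s x
     = cos (s * PI) / sin (s * PI) * bessel_J s x + - / sin (s * PI) * bessel_J (- s) x).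
  { intros x; unfold bessel_Y; destruct (Req_EM_T (sin (s * PI)) 0) as [E|E]; [tauto|].
    unfold bessel_Y_quotient; field; auto. }
  assert (E2 : forall x, bessel_Y (s + 1) x
     = cos (s * PI) / sin (s * PI) * bessel_J (s + 1) x + - / sin (s * PI) * - bessel_J (- (s + 1)) x).
  { intros x; unfold bessel_Y; rewrite Hsin.
    destruct (Req_EM_T (- sin (s * PI)) 0) as [E|E]; [lra|].
    unfold bessel_Y_quotient; rewrite Hsin, Hcos; field; auto. }
  assert (HY : bessel_system s (bessel_Y s) (bessel_Y (s + 1))).
  { eapply bessel_system_ext; [| |apply (bessel_system_lin s (cos (s * PI) / sin (s * PI)) (- / sin (s * PI)));
       [apply bessel_J_system|apply bessel_J_neg_system]].
    - intros; symmetry; apply E1.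
    - intros; symmetry; apply E2. }
  split; auto.
  destruct (bessel_wronskian _ _ _ _ _ (bessel_J_system s) HY) as [c Hc].
  exists c; split; auto. intros Hc0; subst c.
  assert (K : forall y, 0 < y -> y * (bE (s + 1) y * bE (- s) y) + bE s y * bE (- (s + 1)) y = 0).
  { intros y Hy. set (x := 2 * sqrt y).
    assert (Hsq : 0 < sqrt y) by (apply sqrt_lt_R0; auto).
    assert (Hx : 0 < x) by (unfold x; lra).
    assert (Hxy : (x / 2) ^ 2 = y).
    { unfold x. replace (2 * sqrt y / 2) with (sqrt y) by field. simpl; rewrite Rmult_1_r; apply sqrt_sqrt; lra. }
    specialize (Hc x Hx). rewrite E1, E2, !bessel_J_bE, Hxy in Hc.
    assert (P1 : Rpower (x / 2) (s + 1) * Rpower (x / 2) (- s) = x / 2).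
    { rewrite <- Rpower_plus. replace (s + 1 + - s) with 1 by ring. apply Rpower_1; lra. }
    assert (P2 : Rpower (x / 2) s * Rpower (x / 2) (- (s + 1)) = / (x / 2)).
    { rewrite <- Rpower_plus. replace (s + - (s + 1)) with (- (1)) by ring.
      rewrite Rpower_Ropp, Rpower_1; auto; lra. }
    apply (Rmult_eq_reg_l (-2 / sin (s * PI))).
    2: { unfold Rdiv; apply Rmult_integral_contrapositive; split; [lra|apply Rinv_neq_0_compat; auto]. }
    rewrite Rmult_0_r, <- Hc.
    set (p := Rpower (x / 2) (s + 1)) in *. set (q := Rpower (x / 2) (- s)) in *.
    set (p' := Rpower (x / 2) s) in *. set (q' := Rpower (x / 2) (- (s + 1))) in *.
    transitivity (- / sin (s * PI) * (x * (p * q * (bE (s + 1) y * bE (- s) y)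
      + p' * q' * (bE s y * bE (- (s + 1)) y)))); [|field; auto].
    rewrite P1, P2.
    set (a := bE (s + 1) y * bE (- s) y); set (b := bE s y * bE (- (s + 1)) y).
    rewrite <- Hxy. field. split; auto; lra. }
  assert (K0 : 0 * (bE (s + 1) 0 * bE (- s) 0) + bE s 0 * bE (- (s + 1)) 0 = 0).
  { apply (eq_zero_at_0 (fun y => y * (bE (s + 1) y * bE (- s) y) + bE s y * bE (- (s + 1)) y)); auto.
    apply (ex_derive_continuous (fun y => y * (bE (s + 1) y * bE (- s) y) + bE s y * bE (- (s + 1)) y)).
    assert (X : forall s y, ex_derive (bE s) y) by (intros; eexists; apply bE_derive).
    auto_derive; repeat split; auto. }
  rewrite !bE_0 in K0. replace (- (s + 1) + 1) with (- s) in K0 by ring.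
  rewrite Rmult_0_l, Rplus_0_l in K0. apply Rmult_integral in K0; tauto.
Qed.

(** * Y of integer order *)

Definition cT (n m : nat) : R :=
  (-1) ^ (m + n) * rgamma (INR m - INR n + 1) * rgamma (INR m + 1).

(* Up to the sign (-1)^(m+n), the derivative at e = 0 of
   rgamma(m+1+e) rgamma(m-n+1) - rgamma(m+1) rgamma(m-n+1-e). *)
Definition cH (n m : nat) : R :=
  (-1) ^ (m + n) * drg (INR m + 1) * rgamma (INR m - INR n + 1)
  + (-1) ^ (m + n) * drg (INR m - INR n + 1) * rgamma (INR m + 1).

Lemma drg_bounded (n : nat) : exists B, forall m, Rabs (drg (INR m - INR n + 1)) <= B.
Proof.
  set (z := fun k => / INR (S (S k))).
  assert (Hz : is_lim_seq z 0).
  { apply (is_lim_seq_incr_1 (fun k => / INR (S k))), (is_lim_seq_incr_1 (fun k => / INR k)), is_lim_seq_inv_INR. }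
  assert (Hz0 : forall k, z k <> 0) by (intros k; apply Rinv_neq_0_compat, not_0_INR; lia).
  destruct (rg_quot_bounded n z Hz Hz0) as [B HB].
  { intros k; unfold z; rewrite Rabs_pos_eq by (left; apply Rinv_0_lt_compat, INR_S_pos).
    unfold Rdiv; rewrite Rmult_1_l; apply Rinv_le_contravar; [lra|].
    apply (le_INR 2); lia. }
  exists B; intros m.
  apply (is_lim_seq_le (fun k => Rabs (rg_quot m n (z k))) (fun _ => B)
           (Rabs (drg (INR m - INR n + 1))) B); auto using is_lim_seq_const.
  apply (is_lim_seq_abs _ (drg (INR m - INR n + 1))), rg_quot_cv; auto.
Qed.

Lemma entire_sign_rgamma (c : nat -> R) (C s : R) (n : nat) : (forall m, Rabs (c m) <= C) ->
  entire (fun m => (-1) ^ (m + n) * c m * rgamma (INR m + s)).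
Proof.
  intros Hc; apply (entire_rgamma (fun m => (-1) ^ (m + n) * c m) C); intros m.
  rewrite Rabs_mult, pow_neg1_abs, Rmult_1_l; auto.
Qed.

Lemma entire_ext (a b : nat -> R) : (forall m, a m = b m) -> entire a -> entire b.
Proof.
  intros E Ha r Hr; destruct (Ha r Hr) as [B HB]; exists B; intros m; rewrite <- E; auto.
Qed.

Lemma cT_entire (n : nat) : entire (cT n).
Proof.
  destruct (rgamma_bounded (- INR n + 1)) as [B HB].
  apply (entire_sign_rgamma (fun m => rgamma (INR m - INR n + 1)) B).
  intros m. replace (INR m - INR n + 1) with (INR m + (- INR n + 1)) by ring. apply HB.
Qed.

Lemma cH_parts_entire (n : nat) :
  entire (fun m => (-1) ^ (m + n) * drg (INR m + 1) * rgamma (INR m - INR n + 1)) /\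
  entire (fun m => (-1) ^ (m + n) * drg (INR m - INR n + 1) * rgamma (INR m + 1)).
Proof.
  destruct (drg_bounded 0) as [A HA]; destruct (drg_bounded n) as [B HB]; split.
  - apply (entire_ext (fun m => (-1) ^ (m + n) * drg (INR m + 1) * rgamma (INR m + (- INR n + 1)))).
    + intros m; do 2 f_equal; ring.
    + apply (entire_sign_rgamma (fun m => drg (INR m + 1)) A).
      intros m; specialize (HA m); simpl in HA; rewrite Rminus_0_r in HA; exact HA.
  - apply (entire_sign_rgamma (fun m => drg (INR m - INR n + 1)) B); auto.
Qed.

Lemma cH_entire (n : nat) : entire (cH n).
Proof. apply entire_plus; apply cH_parts_entire. Qed.

Lemma cT_lower (n m : nat) : INR m * cT n m = INR n * cT n m - cT (S n) m.
Proof.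
  unfold cT; rewrite S_INR, Nat.add_succ_r.
  replace (INR m - (INR n + 1) + 1) with (INR m - INR n) by ring.
  rewrite (rgamma_succ (INR m - INR n)); simpl; ring.
Qed.

Lemma cT_raise (n m : nat) : INR (S m) * cT (S n) (S m) = cT n m.
Proof.
  unfold cT; rewrite !S_INR, (rgamma_succ (INR m + 1)).
  replace (INR m + 1 - (INR n + 1) + 1) with (INR m - INR n + 1) by ring.
  rewrite Nat.add_succ_r; simpl; ring.
Qed.

(** The differentiated companion of [cT_lower]: differentiating rgamma z = z rgamma (z + 1) leaves
    the extra term [cT n m]. *)
Lemma cH_lower (n m : nat) : INR m * cH n m = INR n * cH n m - cH (S n) m - cT n m.
Proof.
  unfold cH, cT; rewrite S_INR, Nat.add_succ_r.
  replace (INR m - (INR n + 1) + 1) with (INR m - INR n) by ring.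
  rewrite (rgamma_succ (INR m - INR n)), (drg_succ m n); simpl; ring.
Qed.

Lemma cH_raise (n m : nat) : INR (S m) * cH (S n) (S m) = cH n m - cT (S n) (S m).
Proof.
  unfold cH, cT; rewrite !S_INR, (rgamma_succ (INR m + 1)).
  assert (E := drg_succ (S m) 0); simpl (INR 0) in E; rewrite S_INR, Rminus_0_r in E; cbv zeta in E.
  replace (INR m + 1 - (INR n + 1) + 1) with (INR m - INR n + 1) by ring.
  rewrite E, Nat.add_succ_r; simpl; ring.
Qed.

(** J_n(x) = (x/2)^(-n) fT n y: the terms m < n vanish because 1/Gamma has zeros there. Using the
    prefactor of J_(-n) for J_n as well lets the two be compared coefficient by coefficient. *)
Definition fT (n : nat) (y : R) : R := PSeries (cT n) y.
Definition fH (n : nat) (y : R) : R := PSeries (cH n) y.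

Lemma lower_derive (a b : nat -> R) (c y : R) : entire a -> entire b ->
  (forall m, INR m * a m = c * a m - b m) ->
  exists l, is_derive (PSeries a) y l /\ y * l = c * PSeries a y - PSeries b y.
Proof.
  intros Ha Hb Hab.
  destruct (entire_is_derive a y Ha) as [D E]; eexists; split; [exact D|].
  assert (S1 := is_series_unique _ _ (Series_shift_pow a y E)).
  transitivity (Series (fun n => INR n * a n * y ^ n)); [rewrite S1; reflexivity|].
  unfold PSeries; rewrite <- Series_scal_l, <- Series_minus.
  - apply Series_ext; intros m; rewrite Hab; ring.
  - apply (ex_series_scal_l (V := R_NormedModule)), entire_ex_series; auto.
  - apply entire_ex_series; auto.
Qed.

Lemma fT_derive (n : nat) (y : R) : is_derive (fT (S n)) y (fT n y).
Proof.
  destruct (entire_is_derive _ y (cT_entire (S n))) as [D _].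
  replace (fT n y) with (PSeries (PS_derive (cT (S n))) y); [exact D|].
  apply PSeries_ext; intros m; apply cT_raise.
Qed.

Lemma fT_incr (n : nat) (y : R) :
  ex_series (fun m => cT (S n) (S m) * y ^ m) /\
  fT (S n) y = y * Series (fun m => cT (S n) (S m) * y ^ m).
Proof.
  split.
  - destruct (entire_geometric _ y (cT_entire (S n))) as (B & q & Hq & HB & Hy).
    apply (ex_series_mul_pow _ (B * q) q); auto; [|lra].
    intros m; eapply Rle_trans; [apply HB|]. simpl; right; ring.
  - unfold fT, PSeries. rewrite (Series_incr_n_aux _ 1), <- Series_scal_l.
    + apply Series_ext; intros m; simpl; ring.
    + intros k Hk. replace k with 0%nat by lia. unfold cT.
      rewrite S_INR; simpl (INR 0). replace (0 - (INR n + 1) + 1) with (- INR n) by ring.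
      rewrite rgamma_neg_nat; ring.
Qed.

Lemma fH_derive (n : nat) (y : R) : exists l,
  is_derive (fH (S n)) y l /\ y * l = y * fH n y - fT (S n) y.
Proof.
  destruct (entire_is_derive _ y (cH_entire (S n))) as [D E]; eexists; split; [exact D|].
  destruct (fT_incr n y) as [F ->].
  rewrite <- Rmult_minus_distr_l; f_equal.
  unfold fH, PSeries; rewrite <- Series_minus; auto; [|apply entire_ex_series, cH_entire].
  apply Series_ext; intros m; unfold PS_derive; rewrite cH_raise; ring.
Qed.

(** The classical logarithmic formula for Y_n. [fH] holds both the digamma series and the finite sum
    of negative powers of x: for m < n, where 1/Gamma vanishes, its derivative does not. *)
Definition Y_int (n : nat) (x : R) : R :=
  Rpower (x / 2) (- INR n) * ((2 * ln (x / 2) * fT n ((x / 2) ^ 2) + fH n ((x / 2) ^ 2)) / PI).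

Lemma Y_int_system (n : nat) : bessel_system (INR n) (Y_int n) (Y_int (S n)).
Proof.
  intros x Hx; set (y := (x / 2) ^ 2).
  assert (HPI := PI_RGT_0).
  assert (Dln : is_derive (fun x => 2 * ln (x / 2)) x (2 / x)).
  { auto_derive; [lra|]. replace (x * / 2) with (x / 2) by reflexivity. field; lra. }
  (* Stated for arbitrary derivatives t of [fT k] and h of [fH k]: the first equation of the system
     takes k = n and the lowering recursions, the second k = n + 1 and the raising ones. *)
  assert (Dgen : forall k (t h : R), is_derive (fT k) y t -> is_derive (fH k) y h ->
    is_derive (Y_int k) x (Rpower (x / 2) (- INR k) *
      (- INR k / x * ((2 * ln (x / 2) * fT k y + fH k y) / PI)
       + (2 / x * fT k y + 2 * ln (x / 2) * (x / 2 * t) + x / 2 * h) * / PI))).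
  { intros k t h Ht Hh; unfold Y_int.
    apply (is_derive_Rpower_mul (- INR k) x
      (fun x => (2 * ln (x / 2) * fT k ((x / 2) ^ 2) + fH k ((x / 2) ^ 2)) / PI)); auto.
    apply is_derive_sq_half in Ht; apply is_derive_sq_half in Hh.
    assert (D1 := is_derive_mul_R _ _ _ _ _ Dln Ht).
    assert (D2 := is_derive_plus _ _ _ _ _ D1 Hh).
    assert (D3 := is_derive_scal _ _ (/ PI) _ D2).
    eapply is_derive_ext; [|evar_last; [exact D3|]].
    - assert (X : forall s, / PI * (2 * ln (s / 2) * fT k ((s / 2) ^ 2) + fH k ((s / 2) ^ 2))
        = (2 * ln (s / 2) * fT k ((s / 2) ^ 2) + fH k ((s / 2) ^ 2)) / PI)
        by (intros; field; lra). exact X.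
    - change plus with Rplus; cbv beta; fold y; ring. }
  assert (ER : Rpower (x / 2) (- INR (S n)) = Rpower (x / 2) (- INR n) * (2 / x)).
  { rewrite S_INR. replace (- INR n) with (- (INR n + 1) + 1) by ring.
    rewrite Rpower_succ by auto. field; lra. }
  split.
  - destruct (lower_derive (cT n) (cT (S n)) (INR n) y) as (t & Ht & Et);
      auto using cT_entire, cT_lower.
    destruct (lower_derive (cH n) (fun m => cH (S n) m + cT n m) (INR n) y) as (h & Hh & Eh);
      auto using cH_entire, entire_plus, cT_entire.
    { intros m; rewrite cH_lower; ring. }
    assert (Es : PSeries (fun m => cH (S n) m + cT n m) y = fH (S n) y + fT n y).
    { unfold fH, fT, PSeries; rewrite <- Series_plus by (apply entire_ex_series; auto using cH_entire, cT_entire).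
      apply Series_ext; intros; ring. }
    rewrite Es in Eh. fold (fT n y) in Et; fold (fT (S n) y) in Et; fold (fH n y) in Eh.
    replace (INR n / x * Y_int n x - Y_int (S n) x) with (Rpower (x / 2) (- INR n) *
      (- INR n / x * ((2 * ln (x / 2) * fT n y + fH n y) / PI)
       + (2 / x * fT n y + 2 * ln (x / 2) * (x / 2 * t) + x / 2 * h) * / PI)); [apply Dgen; auto|].
    unfold Y_int; fold y; rewrite ER.
    replace (x / 2 * t) with (2 / x * (y * t)) by (unfold y; field; lra).
    replace (x / 2 * h) with (2 / x * (y * h)) by (unfold y; field; lra).
    rewrite Et, Eh; field; lra.
  - destruct (fH_derive n y) as (h & Hh & Eh).
    assert (Ht := fT_derive n y).
    replace (Y_int n x - (INR n + 1) / x * Y_int (S n) x) with (Rpower (x / 2) (- INR (S n)) *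
      (- INR (S n) / x * ((2 * ln (x / 2) * fT (S n) y + fH (S n) y) / PI)
       + (2 / x * fT (S n) y + 2 * ln (x / 2) * (x / 2 * fT n y) + x / 2 * h) * / PI)); [apply Dgen; auto|].
    unfold Y_int; fold y; rewrite ER.
    replace (x / 2 * h) with (2 / x * (y * h)) by (unfold y; field; lra).
    rewrite Eh, S_INR. unfold y; field; lra.
Qed.

Lemma Series_index_shift (u : nat -> R) (n : nat) (y : R) :
  Series (fun m => (-1) ^ (m + n) * u m * rgamma (INR m - INR n + 1) * y ^ m)
  = y ^ n * Series (fun j => (-1) ^ j * u (n + j)%nat * rgamma (INR j + 1) * y ^ j).
Proof.
  rewrite (Series_incr_n_aux _ n), <- Series_scal_l.
  - apply Series_ext; intros j; rewrite plus_INR.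
    replace (INR n + INR j - INR n + 1) with (INR j + 1) by ring.
    replace (n + j + n)%nat with (2 * n + j)%nat by lia.
    rewrite (pow_add (-1) (2 * n)), (pow_add y), pow_1_even; ring.
  - intros k Hk.
    replace (INR k - INR n + 1) with (- INR (n - S k)) by (rewrite minus_INR, S_INR by lia; ring).
    rewrite rgamma_neg_nat; ring.
Qed.

Lemma Rpower_sq (x : R) (n : nat) : 0 < x -> Rpower (x / 2) (INR n) = Rpower (x / 2) (- INR n) * ((x / 2) ^ 2) ^ n.
Proof.
  intros Hx; rewrite Rpower_Ropp, Rpower_pow, <- pow_mult by lra.
  replace (2 * n)%nat with (n + n)%nat by lia. rewrite pow_add. field.
  apply pow_nonzero; lra.
Qed.

Lemma bessel_J_int (n : nat) (x : R) : 0 < x ->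
  bessel_J (INR n) x = Rpower (x / 2) (- INR n) * fT n ((x / 2) ^ 2).
Proof.
  intros Hx; rewrite bessel_J_bE, Rpower_sq, Rmult_assoc by auto. f_equal; symmetry.
  unfold fT, bE, PSeries, cT, cE.
  rewrite (Series_ext _ (fun m => (-1) ^ (m + n) * rgamma (INR m + 1) * rgamma (INR m - INR n + 1) * ((x / 2) ^ 2) ^ m))
    by (intros; ring).
  rewrite (Series_index_shift (fun m => rgamma (INR m + 1))). f_equal; apply Series_ext; intros j.
  rewrite plus_INR. replace (INR n + INR j + 1) with (INR j + INR n + 1) by ring. reflexivity.
Qed.

Lemma sin_int_PI (n : nat) (t : R) : sin ((INR n + t) * PI) = (-1) ^ n * sin (t * PI).
Proof.
  induction n as [|n IH].
  - simpl; f_equal; rewrite Rmult_1_l; f_equal; ring.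
  - rewrite S_INR. replace ((INR n + 1 + t) * PI) with ((INR n + t) * PI + PI) by ring.
    rewrite neg_sin, IH; simpl; ring.
Qed.

Lemma cos_int_PI (n : nat) (t : R) : cos ((INR n + t) * PI) = (-1) ^ n * cos (t * PI).
Proof.
  induction n as [|n IH].
  - simpl; rewrite Rmult_1_l; f_equal; ring.
  - rewrite S_INR. replace ((INR n + 1 + t) * PI) with ((INR n + t) * PI + PI) by ring.
    rewrite neg_cos, IH; simpl; ring.
Qed.

(** The remainders of the series of J_(n+z) and J_(-n-z) after their values at z = 0 are removed and
    a factor z is taken out; [sS] will be evaluated at - z. *)
Definition sT (n : nat) (y z : R) : R :=
  Series (fun m => (-1) ^ (m + n) * rg_quot m 0 z * rgamma (INR m - INR n + 1) * y ^ m).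
Definition sS (n : nat) (y z : R) : R :=
  Series (fun m => (-1) ^ (m + n) * rg_quot m n z * rgamma (INR m + 1) * y ^ m).

Lemma rgamma_quot (m n : nat) (z : R) : z <> 0 ->
  rgamma (INR m - INR n + 1 + z) = rgamma (INR m - INR n + 1) + z * rg_quot m n z.
Proof. intros Hz; unfold rg_quot; field; auto. Qed.

Lemma sT_sS_cv (n : nat) (y : R) (z : nat -> R) : is_lim_seq z 0 -> (forall k, z k <> 0) ->
  (forall k, Rabs (z k) <= 1 / 2) ->
  (forall k, ex_series (fun m => (-1) ^ (m + n) * rg_quot m 0 (z k) * rgamma (INR m - INR n + 1) * y ^ m)) /\
  (forall k, ex_series (fun m => (-1) ^ (m + n) * rg_quot m n (z k) * rgamma (INR m + 1) * y ^ m)) /\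
  is_lim_seq (fun k => sT n y (z k))
    (Series (fun m => (-1) ^ (m + n) * drg (INR m + 1) * rgamma (INR m - INR n + 1) * y ^ m)) /\
  is_lim_seq (fun k => sS n y (z k))
    (Series (fun m => (-1) ^ (m + n) * drg (INR m - INR n + 1) * rgamma (INR m + 1) * y ^ m)).
Proof.
  intros Hz Hz0 Hz1.
  assert (gen : forall n' s, exists b, ex_series b /\
    (forall k m, Rabs ((-1) ^ (m + n) * rg_quot m n' (z k) * rgamma (INR m + s) * y ^ m) <= b m) /\
    (forall m, is_lim_seq (fun k => (-1) ^ (m + n) * rg_quot m n' (z k) * rgamma (INR m + s) * y ^ m)
       ((-1) ^ (m + n) * drg (INR m - INR n' + 1) * rgamma (INR m + s) * y ^ m))).
  { intros n' s; destruct (rg_quot_bounded n' z Hz Hz0 Hz1) as [B HB].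
    exists (fun m => B * Rabs (rgamma (INR m + s) * y ^ m)); split; [|split].
    - apply (ex_series_scal_l (V := R_NormedModule)).
      apply entire_ex_series.
      apply (entire_ext (fun m => 1 * rgamma (INR m + s))); [intros; ring|].
      apply (entire_rgamma (fun _ => 1) 1); intros; rewrite Rabs_R1; lra.
    - intros k m; rewrite (Rmult_assoc _ (rgamma _)), Rabs_mult.
      apply Rmult_le_compat_r; [apply Rabs_pos|].
      rewrite Rabs_mult, pow_neg1_abs, Rmult_1_l; auto.
    - intros m; apply is_lim_seq_mult'; [|apply is_lim_seq_const].
      apply is_lim_seq_mult'; [|apply is_lim_seq_const].
      apply is_lim_seq_mult'; [apply is_lim_seq_const|apply rg_quot_cv; auto]. }
  assert (EqT : forall m, INR m - INR n + 1 = INR m + (- INR n + 1)) by (intros; ring).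
  destruct (gen 0%nat (- INR n + 1)) as (b & Hb & Hbd & Hl).
  destruct (gen n 1) as (b' & Hb' & Hbd' & Hl').
  split; [|split; [|split]].
  - intros k; apply (ex_series_Rabs_le _ b); auto. intros m; rewrite EqT; auto.
  - intros k; apply (ex_series_Rabs_le _ b'); auto.
  - apply (Series_dominated _ _ b); auto.
    + intros k m; rewrite EqT; auto.
    + intros m; rewrite EqT. specialize (Hl m); simpl in Hl; rewrite Rminus_0_r in Hl; exact Hl.
  - apply (Series_dominated _ _ b'); auto.
Qed.

(** The indeterminacy 0/0 is isolated in elementary functions: [fT], common to both terms,
    multiplies a quotient free of series, and the remainders carry z / sin(z PI), which tends to
    1/PI. *)
Lemma bessel_Y_quotient_expand (n : nat) (x z : R) : 0 < x -> z <> 0 -> sin (z * PI) <> 0 ->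
  let y := (x / 2) ^ 2 in
  ex_series (fun m => (-1) ^ (m + n) * rg_quot m 0 z * rgamma (INR m - INR n + 1) * y ^ m) ->
  ex_series (fun m => (-1) ^ (m + n) * rg_quot m n (- z) * rgamma (INR m + 1) * y ^ m) ->
  bessel_Y_quotient (INR n + z) x =
  Rpower (x / 2) (- INR n) *
    (fT n y * ((cos (z * PI) * Rpower (x / 2) z - Rpower (x / 2) (- z)) / sin (z * PI))
     + z / sin (z * PI) * (cos (z * PI) * Rpower (x / 2) z * sT n y z + Rpower (x / 2) (- z) * sS n y (- z))).
Proof.
  intros Hx Hz Hs y HT HS.
  assert (HT0 : ex_series (fun m => cT n m * y ^ m)) by (apply entire_ex_series, cT_entire).
  assert (E1 : y ^ n * bE (INR n + z) y = fT n y + z * sT n y z).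
  { unfold sT, fT, PSeries; rewrite <- Series_scal_l, <- Series_plus; auto.
    2: apply (ex_series_scal_l (V := R_NormedModule)); auto.
    rewrite (Series_ext _ (fun m => (-1) ^ (m + n) * rgamma (INR m + 1 + z) * rgamma (INR m - INR n + 1) * y ^ m)).
    - rewrite (Series_index_shift (fun m => rgamma (INR m + 1 + z))). f_equal.
      unfold bE, PSeries, cE; apply Series_ext; intros j. rewrite plus_INR.
      replace (INR n + INR j + 1 + z) with (INR j + (INR n + z) + 1) by ring. reflexivity.
    - intros m; unfold cT. assert (E := rgamma_quot m 0 z Hz).
      simpl (INR 0) in E; rewrite Rminus_0_r in E; rewrite E; ring. }
  assert (E2 : bE (- (INR n + z)) y = (-1) ^ n * (fT n y - z * sS n y (- z))).
  { unfold sS, fT, PSeries; rewrite <- Series_scal_l, <- Series_minus, <- Series_scal_l; auto.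
    2: apply (ex_series_scal_l (V := R_NormedModule)); auto.
    unfold bE, PSeries, cE; apply Series_ext; intros m.
    assert (E := rgamma_quot m n (- z) (Ropp_neq_0_compat _ Hz)).
    replace (INR m + - (INR n + z) + 1) with (INR m - INR n + 1 + - z) by ring.
    rewrite E; unfold cT. rewrite pow_add.
    assert (P : (-1) ^ n * (-1) ^ n = 1).
    { rewrite <- pow_add. replace (n + n)%nat with (2 * n)%nat by lia. apply pow_1_even. }
    transitivity ((-1) ^ m * ((-1) ^ n * (-1) ^ n) * (rgamma (INR m - INR n + 1) + - z * rg_quot m n (- z)) *
       rgamma (INR m + 1) * y ^ m); [rewrite P; ring|ring]. }
  unfold bessel_Y_quotient; rewrite !bessel_J_bE; fold y.
  rewrite sin_int_PI, cos_int_PI, E2.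
  rewrite (Ropp_plus_distr (INR n)), !Rpower_plus, (Rpower_sq x n Hx). fold y.
  assert (Hsg : (-1) ^ n <> 0) by (apply pow_nonzero; lra).
  transitivity (Rpower (x / 2) (- INR n) * (cos (z * PI) * Rpower (x / 2) z * (y ^ n * bE (INR n + z) y) -
    Rpower (x / 2) (- z) * (fT n y - z * sS n y (- z))) / sin (z * PI)).
  - field; auto.
  - rewrite E1; field; auto.
Qed.

Lemma bessel_Y_int (n : nat) (x : R) : 0 < x -> bessel_Y (INR n) x = Y_int n x.
Proof.
  intros Hx; assert (HPI := PI_RGT_0).
  unfold bessel_Y; destruct (Req_EM_T (sin (INR n * PI)) 0) as [_|E].
  2: { exfalso; apply E. replace (INR n) with (INR n + 0) by ring.
       rewrite sin_int_PI, Rmult_0_l, sin_0; ring. }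
  (* By definition [Lim] at n is the [Lim_seq] along n + 1/(k + 1). The index is shifted by one so
     that z <= 1/2, as the uniform bound asks; this also keeps sin(z PI) positive. *)
  set (z := fun k => / (INR (S k) + 1)).
  assert (Hz : is_lim_seq z 0).
  { apply (is_lim_seq_ext (fun k => / INR (S (S k)))); [intros; unfold z; now rewrite (S_INR (S n0))|].
    apply (is_lim_seq_incr_1 (fun k => / INR (S k))), (is_lim_seq_incr_1 (fun k => / INR k)), is_lim_seq_inv_INR. }
  assert (Hzp : forall k, 0 < z k <= 1 / 2).
  { intros k; unfold z; assert (H := pos_INR k); rewrite S_INR; split.
    - apply Rinv_0_lt_compat; lra.
    - unfold Rdiv; rewrite Rmult_1_l; apply Rinv_le_contravar; lra. }
  assert (Hz0 : forall k, z k <> 0) by (intros k; specialize (Hzp k); lra).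
  set (y := (x / 2) ^ 2).
  assert (Hz' : is_lim_seq (fun k => - z k) 0).
  { replace (Finite 0) with (Rbar_opp 0) by (simpl; f_equal; ring). apply -> is_lim_seq_opp; auto. }
  destruct (sT_sS_cv n y z Hz Hz0) as (XT & _ & LT & _).
  { intros k; specialize (Hzp k); rewrite Rabs_pos_eq; lra. }
  destruct (sT_sS_cv n y (fun k => - z k) Hz') as (_ & XS & _ & LS).
  { intros k; specialize (Hzp k); lra. }
  { intros k; specialize (Hzp k); rewrite Rabs_Ropp, Rabs_pos_eq; lra. }
  assert (Hs : forall k, sin (z k * PI) <> 0).
  { intros k; specialize (Hzp k); apply Rgt_not_eq, sin_gt_0; nra. }
  assert (Lsin : is_lim_seq (fun k => sin (z k * PI) / z k) PI).
  { eapply is_lim_seq_ext; [|apply (diff_quot_cv (fun t => sin (t * PI)) 0 PI z); auto].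
    - intros k; simpl. rewrite Rmult_0_l, sin_0, Rplus_0_l, Rminus_0_r; reflexivity.
    - auto_derive; auto. rewrite Rmult_0_l, cos_0; ring. }
  assert (Lnum : is_lim_seq (fun k => (cos (z k * PI) * Rpower (x / 2) (z k) - Rpower (x / 2) (- z k)) / z k)
                   (2 * ln (x / 2))).
  { eapply is_lim_seq_ext; [|apply (diff_quot_cv
      (fun t => cos (t * PI) * Rpower (x / 2) t - Rpower (x / 2) (- t)) 0 (2 * ln (x / 2)) z); auto].
    - intros k; simpl. rewrite Rmult_0_l, cos_0, Rplus_0_l, Ropp_0; unfold Rpower. 
      rewrite Rmult_0_l, exp_0. f_equal; ring.
    - unfold Rpower; auto_derive; auto. rewrite !Rmult_0_l, Ropp_0, Rmult_0_l, sin_0, cos_0, exp_0; ring. }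
  assert (Lcont : forall f : R -> R, continuity_pt f 0 -> is_lim_seq (fun k => f (z k)) (f 0)).
  { intros f Hf; apply is_lim_seq_continuous; auto. }
  assert (Lpsi : is_lim_seq (fun k => z k / sin (z k * PI)) (/ PI)).
  { eapply is_lim_seq_ext; [|apply (is_lim_seq_inv (fun k => sin (z k * PI) / z k) PI); [exact Lsin|]].
    - intros k; simpl; field; auto.
    - intros E; injection E; lra. }
  assert (Lphi : is_lim_seq (fun k => (cos (z k * PI) * Rpower (x / 2) (z k) - Rpower (x / 2) (- z k)) / sin (z k * PI))
                   (2 * ln (x / 2) * / PI)).
  { eapply is_lim_seq_ext; [|apply (is_lim_seq_mult' _ _ _ _ Lnum Lpsi)].
    intros k; simpl; field; auto. }
  assert (Lc : is_lim_seq (fun k => cos (z k * PI) * Rpower (x / 2) (z k)) 1).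
  { replace 1 with (cos (0 * PI) * Rpower (x / 2) 0)
      by (unfold Rpower; rewrite !Rmult_0_l, cos_0, exp_0; ring).
    apply (Lcont (fun t => cos (t * PI) * Rpower (x / 2) t)).
    apply continuity_pt_filterlim, (ex_derive_continuous (fun t => cos (t * PI) * Rpower (x / 2) t)).
    unfold Rpower; auto_derive; auto. }
  assert (Lm : is_lim_seq (fun k => Rpower (x / 2) (- z k)) 1).
  { replace 1 with (Rpower (x / 2) (- 0))
      by (unfold Rpower; rewrite Ropp_0, Rmult_0_l, exp_0; ring).
    apply (Lcont (fun t => Rpower (x / 2) (- t))).
    apply continuity_pt_filterlim, (ex_derive_continuous (fun t => Rpower (x / 2) (- t))).
    unfold Rpower; auto_derive; auto. }
  set (ST := Series (fun m => (-1) ^ (m + n) * drg (INR m + 1) * rgamma (INR m - INR n + 1) * y ^ m)) in *.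
  set (SS := Series (fun m => (-1) ^ (m + n) * drg (INR m - INR n + 1) * rgamma (INR m + 1) * y ^ m)) in *.
  assert (Ltot : is_lim_seq (fun k => bessel_Y_quotient (INR n + z k) x)
    (Rpower (x / 2) (- INR n) * (fT n y * (2 * ln (x / 2) * / PI) + / PI * (1 * ST + 1 * SS)))).
  { apply (is_lim_seq_ext (fun k => Rpower (x / 2) (- INR n) *
    (fT n y * ((cos (z k * PI) * Rpower (x / 2) (z k) - Rpower (x / 2) (- z k)) / sin (z k * PI))
     + z k / sin (z k * PI) * (cos (z k * PI) * Rpower (x / 2) (z k) * sT n y (z k)
        + Rpower (x / 2) (- z k) * sS n y (- z k))))).
    - intros k; symmetry; apply bessel_Y_quotient_expand; auto.
    - apply is_lim_seq_mult'; [apply is_lim_seq_const|].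
      apply is_lim_seq_plus'; apply is_lim_seq_mult'; [apply is_lim_seq_const|exact Lphi|exact Lpsi|].
      apply is_lim_seq_plus'; apply is_lim_seq_mult'; auto. }
  assert (EH : ST + SS = fH n y).
  { unfold ST, SS, fH, PSeries; rewrite <- Series_plus.
    - apply Series_ext; intros m; unfold cH; ring.
    - apply entire_ex_series, (cH_parts_entire n).
    - apply entire_ex_series, (cH_parts_entire n). }
  assert (E : Lim_seq (fun k => bessel_Y_quotient (INR n + / (INR k + 1)) x) =
    Rpower (x / 2) (- INR n) * (fT n y * (2 * ln (x / 2) * / PI) + / PI * (1 * ST + 1 * SS)))
    by (apply is_lim_seq_unique, is_lim_seq_incr_1; exact Ltot).
  unfold Lim, Rbar_loc_seq; rewrite E; simpl real.
  unfold Y_int; fold y. rewrite <- EH. field; lra.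
Qed.

(** The zeros of 1/Gamma are simple. This makes the leading coefficient of Y_(n+1) at 0 nonzero. *)
Lemma drg_neg_nat (n : nat) : drg (- INR n) <> 0.
Proof.
  induction n as [|n IH].
  - assert (E := drg_succ 0 0); simpl in E. rewrite Rminus_0_r in E.
    simpl; rewrite Ropp_0, E, Rplus_0_l, rgamma_1. lra.
  - assert (E := drg_succ 0 (S n)); simpl (INR 0) in E; cbv zeta in E. rewrite S_INR in *.
    replace (0 - (INR n + 1)) with (- (INR n + 1)) in E by ring.
    replace (- (INR n + 1) + 1) with (- INR n) in E by ring.
    rewrite E, rgamma_neg_nat, Rplus_0_l.
    apply Rmult_integral_contrapositive; split; auto. assert (H := pos_INR n); lra.
Qed.

(** The logarithms cancel in the Wronskian, because they multiply the product of [fT n] and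
    [fT (S n)] in both terms. If it were zero, the identity left after dividing by powers of x would
    give fH (S n) 0 = 0 at y = 0, that is drg (- n) = 0. *)
Lemma bessel_pair_int (n : nat) :
  bessel_system (INR n) (bessel_Y (INR n)) (bessel_Y (INR n + 1)) /\
  exists c, c <> 0 /\ forall x, 0 < x ->
    x * (bessel_J (INR n + 1) x * bessel_Y (INR n) x - bessel_J (INR n) x * bessel_Y (INR n + 1) x) = c.
Proof.
  assert (HPI := PI_RGT_0).
  assert (HY : bessel_system (INR n) (bessel_Y (INR n)) (bessel_Y (INR n + 1))).
  { apply (bessel_system_ext _ (Y_int n) (Y_int (S n))); [| |apply Y_int_system];
      intros x Hx; rewrite <- ?S_INR, bessel_Y_int; auto. }
  split; auto.
  destruct (bessel_wronskian _ _ _ _ _ (bessel_J_system (INR n)) HY) as [c Hc].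
  exists c; split; auto. intros Hc0; subst c.
  assert (K : forall y, 0 < y -> y * (bE (INR n + 1) y * fH n y) - bE (INR n) y * fH (S n) y = 0).
  { intros y Hy. set (x := 2 * sqrt y).
    assert (Hsq : 0 < sqrt y) by (apply sqrt_lt_R0; auto).
    assert (Hx : 0 < x) by (unfold x; lra).
    assert (Hxy : (x / 2) ^ 2 = y).
    { unfold x. replace (2 * sqrt y / 2) with (sqrt y) by field. simpl; rewrite Rmult_1_r; apply sqrt_sqrt; lra. }
    specialize (Hc x Hx). rewrite <- S_INR, !bessel_Y_int, !bessel_J_int in Hc by auto.
    unfold Y_int in Hc; rewrite Hxy in Hc.
    assert (ET : forall k, fT k y = y ^ k * bE (INR k) y).
    { intros k; assert (E1 := bessel_J_int k x Hx).
      rewrite bessel_J_bE, Rpower_sq, Rmult_assoc, Hxy in E1 by auto.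
      apply Rmult_eq_reg_l in E1; auto. apply Rgt_not_eq, Rpower_pos. }
    rewrite !ET in Hc. rewrite <- S_INR.
    assert (P1 := Rpower_pos (x / 2) (- INR n)). assert (P2 := Rpower_pos (x / 2) (- INR (S n))).
    assert (P3 : 0 < y ^ n) by (apply pow_lt; auto).
    apply (Rmult_eq_reg_l (x * Rpower (x / 2) (- INR n) * Rpower (x / 2) (- INR (S n)) * y ^ n / PI)).
    - rewrite Rmult_0_r; etransitivity; [|exact Hc]. simpl pow; field; lra.
    - apply Rgt_not_eq, Rdiv_lt_0_compat; auto. repeat apply Rmult_lt_0_compat; auto; lra. }
  assert (X : forall k y, ex_derive (fH k) y).
  { intros k y; eexists; apply entire_is_derive, cH_entire. }
  assert (X' : forall s y, ex_derive (bE s) y) by (intros; eexists; apply bE_derive).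
  assert (K0 : 0 * (bE (INR n + 1) 0 * fH n 0) - bE (INR n) 0 * fH (S n) 0 = 0).
  { apply (eq_zero_at_0 (fun y => y * (bE (INR n + 1) y * fH n y) - bE (INR n) y * fH (S n) y)); auto.
    apply (ex_derive_continuous (fun y => y * (bE (INR n + 1) y * fH n y) - bE (INR n) y * fH (S n) y)).
    auto_derive; repeat split; auto. }
  rewrite Rmult_0_l, bE_0, rgamma_nat in K0.
  assert (Hf := INR_fact_pos n).
  assert (K1 : fH (S n) 0 = 0).
  { apply (Rmult_eq_reg_l (/ INR (fact n))); [lra|]. apply Rinv_neq_0_compat; lra. }
  unfold fH in K1; rewrite PSeries_0 in K1; unfold cH in K1.
  rewrite S_INR in K1; simpl (INR 0) in K1.
  replace (0 - (INR n + 1) + 1) with (- INR n) in K1 by ring.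
  rewrite rgamma_neg_nat, Rplus_0_l, rgamma_1 in K1.
  assert (Hd := drg_neg_nat n).
  assert ((-1) ^ (0 + S n) <> 0) by (apply pow_nonzero; lra).
  assert ((-1) ^ (0 + S n) * drg (- INR n) <> 0) by (apply Rmult_integral_contrapositive; auto).
  lra.
Qed.

(** The orders that occur, d being an integer. At a half-integer sin(s PI) is 1 or -1, and neither s
    + 1 nor - s is a pole of Gamma. *)
Lemma bessel_pair (s : R) (n : nat) : s = INR n \/ s = INR n + 1 / 2 ->
  bessel_system s (bessel_J s) (bessel_J (s + 1)) /\
  bessel_system s (bessel_Y s) (bessel_Y (s + 1)) /\
  exists c, c <> 0 /\ forall x, 0 < x ->
    x * (bessel_J (s + 1) x * bessel_Y s x - bessel_J s x * bessel_Y (s + 1) x) = c.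
Proof.
  intros Hs; split; [apply bessel_J_system|].
  destruct Hs as [-> | ->]; [apply bessel_pair_int|].
  apply bessel_Y_nonint.
  - rewrite sin_int_PI. replace (1 / 2 * PI) with (PI / 2) by field. rewrite sin_PI2, Rmult_1_r.
    apply pow_nonzero; lra.
  - replace (INR n + 1 / 2 + 1) with (INR (S n) + 1 / 2) by (rewrite S_INR; ring).
    apply Rgt_not_eq, rgamma_half_nat.
  - replace (- (INR n + 1 / 2)) with (1 / 2 - INR (S n)) by (rewrite S_INR; field).
    apply rgamma_neg_half_nat.
Qed.

(** * The radial equation *)

(* [g = df/dr]; the k-derivatives come from the scaling f(r,k) = r^(-nu) Z(k r). *)
Definition radial_solution (n : nat) (nu Lam : R) (f g : R -> R -> R) : Prop :=
  forall r k, 0 < r -> 0 < k ->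
    is_derive (fun r => f r k) r (g r k) /\
    is_derive (fun r => g r k) r (- (INR n / r) * g r k - (k ^ 2 - Lam / r ^ 2) * f r k) /\
    is_derive (fun k => f r k) k ((r * g r k + nu * f r k) / k) /\
    is_derive (fun k => g r k) k ((- nu * g r k - (k ^ 2 * r - Lam / r) * f r k) / k).

Lemma is_derive_pow_n (n : nat) (r : R) : 0 < r ->
  is_derive (fun r => r ^ n) r (INR n / r * r ^ n).
Proof.
  intros Hr; auto_derive; auto. destruct n as [|n]; simpl; field; lra.
Qed.

Lemma bounded_derive_diff (f f' : R -> R) (a b M : R) : a <= b ->
  (forall x, a <= x <= b -> is_derive f x (f' x)) ->
  (forall x, a <= x <= b -> - M <= f' x) -> f a - M * (b - a) <= f b.
Proof.
  intros Hab Hd HM.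
  assert (H := decreasing_of_derive (fun x => - (f x + M * x)) (fun x => - (f' x + M)) a b Hab).
  cbv beta in H. assert (- (f b + M * b) <= - (f a + M * a)); [|lra].
  apply H.
  - intros x Hx. specialize (Hd x Hx).
    apply (is_derive_opp (fun x => f x + M * x) x (f' x + M)).
    apply (is_derive_plus f (fun x => M * x)); auto. auto_derive; auto; ring.
  - intros x Hx; specialize (HM x Hx); lra.
Qed.

Section Radial.
Variables (n : nat) (nu Lam C R1 R2 : R) (f1 g1 f2 g2 : R -> R -> R).
Hypothesis Hnu : INR n = 2 * nu + 1.
Hypothesis HC : C <> 0.
Hypothesis HR1 : 0 < R1.
Hypothesis HR12 : R1 < R2.
Hypothesis S1 : radial_solution n nu Lam f1 g1.
Hypothesis S2 : radial_solution n nu Lam f2 g2.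
Hypothesis HW : forall r k, 0 < r -> 0 < k -> r ^ n * (f1 r k * g2 r k - g1 r k * f2 r k) = C.

(** Cramer's rule for the initial data (1, a) at R1, whose determinant is the Wronskian C / R1^n.
    The coefficients, hence U and V, are affine in a. *)
Definition rP (a k : R) : R := R1 ^ n / C * (g2 R1 k - a * f2 R1 k).
Definition rQ (a k : R) : R := - (R1 ^ n / C * (g1 R1 k - a * f1 R1 k)).
Definition rU (a r k : R) : R := rP a k * f1 r k + rQ a k * f2 r k.
Definition rV (a r k : R) : R := rP a k * g1 r k + rQ a k * g2 r k.

Lemma R1n_pos : 0 < R1 ^ n.
Proof using HR1. apply pow_lt; auto. Qed.

Lemma rU_R1 (a k : R) : 0 < k -> rU a R1 k = 1.
Proof using HW HR1 HC.
  intros Hk; assert (H := HW R1 k HR1 Hk).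
  unfold rU, rP, rQ.
  transitivity (R1 ^ n * (f1 R1 k * g2 R1 k - g1 R1 k * f2 R1 k) / C); [field; auto|].
  rewrite H; field; auto.
Qed.

Lemma rV_R1 (a k : R) : 0 < k -> rV a R1 k = a.
Proof using HW HR1 HC.
  intros Hk; assert (H := HW R1 k HR1 Hk).
  unfold rV, rP, rQ.
  transitivity (a * (R1 ^ n * (f1 R1 k * g2 R1 k - g1 R1 k * f2 R1 k)) / C); [field; auto|].
  rewrite H; field; auto.
Qed.

Lemma rU_derive (a r k : R) : 0 < r -> 0 < k -> is_derive (fun r => rU a r k) r (rV a r k).
Proof using S1 S2.
  intros Hr Hk; destruct (S1 r k Hr Hk) as (A & _); destruct (S2 r k Hr Hk) as (B & _).
  apply (is_derive_plus (fun r => rP a k * f1 r k) (fun r => rQ a k * f2 r k));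
    apply is_derive_scal; auto.
Qed.

Lemma rV_derive (a r k : R) : 0 < r -> 0 < k -> is_derive (fun r => rV a r k) r
  (- (INR n / r) * rV a r k - (k ^ 2 - Lam / r ^ 2) * rU a r k).
Proof using S1 S2.
  intros Hr Hk; destruct (S1 r k Hr Hk) as (_ & A & _); destruct (S2 r k Hr Hk) as (_ & B & _).
  evar_last.
  - apply (is_derive_plus (fun r => rP a k * g1 r k) (fun r => rQ a k * g2 r k));
    apply is_derive_scal; eassumption.
  - change plus with Rplus; unfold rU, rV; ring.
Qed.

Lemma radial_wronskian (a b r k : R) : 0 < r -> 0 < k ->
  r ^ n * (rU a r k * rV b r k - rV a r k * rU b r k) = (b - a) * R1 ^ n.
Proof using HW HR1 HC.
  intros Hr Hk; assert (H := HW r k Hr Hk); assert (H1 := HW R1 k HR1 Hk).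
  transitivity ((b - a) * (R1 ^ n / C) * (R1 ^ n * (f1 R1 k * g2 R1 k - g1 R1 k * f2 R1 k)) / C
    * (r ^ n * (f1 r k * g2 r k - g1 r k * f2 r k))).
  - unfold rU, rV, rP, rQ; field; auto.
  - rewrite H, H1; field; auto.
Qed.

(** The k-derivatives are written out by means of the scaling relations in [radial_solution]. Being
    explicit in r, they can be differentiated in r directly, without exchanging mixed
    derivatives. *)
Definition rPk (a k : R) : R :=
  R1 ^ n / C * ((- nu * g2 R1 k - (k ^ 2 * R1 - Lam / R1) * f2 R1 k) / k
                - a * ((R1 * g2 R1 k + nu * f2 R1 k) / k)).
Definition rQk (a k : R) : R :=
  - (R1 ^ n / C * ((- nu * g1 R1 k - (k ^ 2 * R1 - Lam / R1) * f1 R1 k) / k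
                - a * ((R1 * g1 R1 k + nu * f1 R1 k) / k))).
Definition rUk (a r k : R) : R :=
  rPk a k * f1 r k + rQk a k * f2 r k + (r * rV a r k + nu * rU a r k) / k.
Definition rVk (a r k : R) : R :=
  rPk a k * g1 r k + rQk a k * g2 r k
  + (- nu * rV a r k - (k ^ 2 * r - Lam / r) * rU a r k) / k.

Lemma rP_derive (a k : R) : 0 < k ->
  is_derive (rP a) k (rPk a k) /\ is_derive (rQ a) k (rQk a k).
Proof using S1 S2 HR1.
  intros Hk; destruct (S1 R1 k HR1 Hk) as (_ & _ & A1 & B1).
  destruct (S2 R1 k HR1 Hk) as (_ & _ & A2 & B2). split.
  - apply (is_derive_scal (fun k => g2 R1 k - a * f2 R1 k)).
    apply (is_derive_minus (fun k => g2 R1 k) (fun k => a * f2 R1 k)); auto.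
    apply is_derive_scal; auto.
  - apply (is_derive_opp (fun k => R1 ^ n / C * (g1 R1 k - a * f1 R1 k))).
    apply (is_derive_scal (fun k => g1 R1 k - a * f1 R1 k)).
    apply (is_derive_minus (fun k => g1 R1 k) (fun k => a * f1 R1 k)); auto.
    apply is_derive_scal; auto.
Qed.

Lemma rU_derive_k (a r k : R) : 0 < r -> 0 < k ->
  is_derive (fun k => rU a r k) k (rUk a r k) /\ is_derive (fun k => rV a r k) k (rVk a r k).
Proof using S1 S2 HR1.
  intros Hr Hk; destruct (S1 r k Hr Hk) as (_ & _ & A1 & B1).
  destruct (S2 r k Hr Hk) as (_ & _ & A2 & B2).
  destruct (rP_derive a k Hk) as [DP DQ]. split.
  - evar_last.
    + apply (is_derive_plus (fun k => rP a k * f1 r k) (fun k => rQ a k * f2 r k));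
        apply is_derive_mul_R; eassumption.
    + change plus with Rplus; unfold rUk, rU, rV; field; lra.
  - evar_last.
    + apply (is_derive_plus (fun k => rP a k * g1 r k) (fun k => rQ a k * g2 r k));
        apply is_derive_mul_R; eassumption.
    + change plus with Rplus; unfold rVk, rU, rV; field; lra.
Qed.

Lemma is_derive_const_eq (h : R -> R) (c k l : R) : 0 < k ->
  (forall x, 0 < x -> h x = c) -> is_derive h k l -> l = 0.
Proof.
  intros Hk Hc Hl.
  assert (L : locally k (fun x => 0 < x)) by (apply open_gt; auto).
  assert (H : is_derive h k 0).
  { apply (is_derive_ext_loc (fun _ => c)); [|auto_derive; auto].
    eapply filter_imp; [|exact L]. intros x Hx; symmetry; apply Hc; auto. }
  apply is_derive_unique in H; apply is_derive_unique in Hl; lra.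
Qed.

(** The initial data 1 and a do not depend on k. *)
Lemma rUk_R1 (a k : R) : 0 < k -> rUk a R1 k = 0 /\ rVk a R1 k = 0.
Proof using S1 S2 HR1 HW HC.
  intros Hk; destruct (rU_derive_k a R1 k HR1 Hk) as [D1 D2]; split.
  - apply (is_derive_const_eq _ 1 k _ Hk (rU_R1 a) D1).
  - apply (is_derive_const_eq _ a k _ Hk (rV_R1 a) D2).
Qed.

(** Lagrange's identity in differential form: the k-derivative of U solves the radial equation with
    source -2 k U, and the weight r^n absorbs the first-order terms. *)
Lemma rG_derive (a r k : R) : 0 < r -> 0 < k ->
  is_derive (fun r => r ^ n * (rU a r k * rVk a r k - rV a r k * rUk a r k)) r
    (- 2 * k * r ^ n * rU a r k ^ 2).
Proof using S1 S2 Hnu.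
  intros Hr Hk; destruct (S1 r k Hr Hk) as (A1 & B1 & _); destruct (S2 r k Hr Hk) as (A2 & B2 & _).
  assert (DU := rU_derive a r k Hr Hk). assert (DV := rV_derive a r k Hr Hk).
  assert (Dp := is_derive_pow_n n r Hr).
  assert (E1 : Derive (fun r : R => f1 r k) r = _) by (apply is_derive_unique; exact A1).
  assert (E2 : Derive (fun r : R => f2 r k) r = _) by (apply is_derive_unique; exact A2).
  assert (E3 : Derive (fun r : R => rU a r k) r = _) by (apply is_derive_unique; exact DU).
  assert (E4 : Derive (fun r : R => rV a r k) r = _) by (apply is_derive_unique; exact DV).
  assert (F1 : Derive (fun r : R => g1 r k) r = _) by (apply is_derive_unique; exact B1).
  assert (F2 : Derive (fun r : R => g2 r k) r = _) by (apply is_derive_unique; exact B2).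
  assert (DUk : is_derive (fun r => rUk a r k) r (rPk a k * g1 r k + rQk a k * g2 r k +
    (rV a r k + r * (- (INR n / r) * rV a r k - (k ^ 2 - Lam / r ^ 2) * rU a r k) + nu * rV a r k) / k)).
  { unfold rUk; auto_derive.
    - repeat split; eexists; eassumption.
    - rewrite E1, E2, E3, E4; field; lra. }
  assert (DVk : is_derive (fun r => rVk a r k) r
    (rPk a k * (- (INR n / r) * g1 r k - (k ^ 2 - Lam / r ^ 2) * f1 r k)
     + rQk a k * (- (INR n / r) * g2 r k - (k ^ 2 - Lam / r ^ 2) * f2 r k) +
    (- nu * (- (INR n / r) * rV a r k - (k ^ 2 - Lam / r ^ 2) * rU a r k)
     - (k ^ 2 + Lam / r ^ 2) * rU a r k - (k ^ 2 * r - Lam / r) * rV a r k) / k)).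
  { unfold rVk; auto_derive.
    - repeat split; try (eexists; eassumption); lra.
    - rewrite F1, F2, E3, E4; field; lra. }
  evar_last.
  - apply (is_derive_mul_R (fun r => r ^ n) (fun r => rU a r k * rVk a r k - rV a r k * rUk a r k)); [exact Dp|].
    apply (is_derive_minus (fun r => rU a r k * rVk a r k) (fun r => rV a r k * rUk a r k));
      apply is_derive_mul_R; eassumption.
  - unfold minus; change plus with Rplus; change opp with Ropp.
    rewrite Hnu; unfold rUk, rVk. 
    set (p := r ^ n). unfold rU, rV. field; lra.
Qed.

(* The Lagrange identity: the bracket equals -(2k / R2^n) times the integral of
   r^n U^2 over [R1, R2]. *)
Lemma lagrange_neg (a k : R) : 0 < k ->
  rU a R2 k * rVk a R2 k - rV a R2 k * rUk a R2 k < 0.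
Proof using S1 S2 HR1 HR12 HW HC Hnu.
  intros Hk.
  set (G := fun r => r ^ n * (rU a r k * rVk a r k - rV a r k * rUk a r k)).
  assert (DG : forall r, 0 < r -> is_derive G r (- 2 * k * r ^ n * rU a r k ^ 2))
    by (intros; apply rG_derive; auto).
  assert (G1 : G R1 = 0).
  { unfold G; destruct (rUk_R1 a k Hk) as [-> ->]; ring. }
  assert (Hc : continuous (fun r => rU a r k) R1).
  { apply (ex_derive_continuous (fun r => rU a r k)); eexists; apply rU_derive; auto. }
  assert (Hloc : locally R1 (fun r => 0 < rU a r k)).
  { apply (Hc (fun y => 0 < y)). rewrite rU_R1 by auto. apply open_gt; lra. }
  destruct Hloc as [eps Heps].
  (* Strict decrease is secured on a short interval after R1, where U is near 1; further on U may
     vanish, and G is only nonincreasing. *)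
  set (b := Rmin R2 (R1 + eps / 2)). assert (He := cond_pos eps).
  assert (Hb1 : R1 < b) by (unfold b; apply Rmin_glb_lt; lra).
  assert (Hb2 : b <= R2) by apply Rmin_l.
  assert (Hb3 : b <= R1 + eps / 2) by apply Rmin_r.
  assert (Gb : G b < G R1).
  { apply (strictly_decreasing_of_derive G (fun r => - 2 * k * r ^ n * rU a r k ^ 2)); auto.
    - intros r Hr; apply DG; lra.
    - intros r Hr; assert (0 < rU a r k).
      { apply Heps; unfold ball; simpl; unfold AbsRing_ball, abs, minus, plus, opp; simpl.
        apply Rabs_def1; lra. }
      assert (0 < r ^ n) by (apply pow_lt; lra).
      assert (0 < 2 * k * r ^ n * rU a r k ^ 2) by (repeat apply Rmult_lt_0_compat; lra).
      lra. }
  assert (G2 : G R2 <= G b).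
  { apply (decreasing_of_derive G (fun r => - 2 * k * r ^ n * rU a r k ^ 2)); auto.
    - intros r Hr; apply DG; lra.
    - intros r Hr. assert (0 < r ^ n) by (apply pow_lt; lra). assert (H9 := pow2_ge_0 (rU a r k)).
      assert (0 <= 2 * k * r ^ n * rU a r k ^ 2) by (apply Rmult_le_pos; [repeat apply Rmult_le_pos; lra|auto]). lra. }
  unfold G in G2, G1, Gb. assert (0 < R2 ^ n) by (apply pow_lt; lra). nra.
Qed.

Lemma rUk_continuous (a r k : R) : 0 < r -> 0 < k ->
  continuous (fun k => rUk a r k) k /\ continuous (fun k => rVk a r k) k.
Proof using S1 S2 HR1.
  intros Hr Hk.
  destruct (S1 r k Hr Hk) as (_ & _ & A1 & B1). destruct (S2 r k Hr Hk) as (_ & _ & A2 & B2).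
  destruct (S1 R1 k HR1 Hk) as (_ & _ & A3 & B3). destruct (S2 R1 k HR1 Hk) as (_ & _ & A4 & B4).
  destruct (rU_derive_k a r k Hr Hk) as [DU DV].
  split; [apply (ex_derive_continuous (fun k => rUk a r k))|apply (ex_derive_continuous (fun k => rVk a r k))];
    unfold rUk, rVk, rPk, rQk; auto_derive; repeat split; try (eexists; eassumption); lra.
Qed.

Lemma rU_pos_of_nonzero (a k : R) : 0 < k ->
  (forall r, R1 <= r <= R2 -> rU a r k <> 0) -> forall r, R1 <= r <= R2 -> 0 < rU a r k.
Proof using S1 S2 HR1 HW HC.
  intros Hk Hne r Hr; destruct (Rlt_le_dec 0 (rU a r k)) as [H|H]; auto.
  assert (Hlt : rU a r k < 0) by (specialize (Hne r Hr); lra).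
  assert (HU1 := rU_R1 a k Hk).
  assert (HRr : R1 < r).
  { destruct (Req_dec r R1) as [->|]; lra. }
  destruct (Ranalysis5.IVT_interv (fun r => - rU a r k) R1 r) as [z [Hz1 Hz2]]; auto; try lra.
  - intros x Hx. apply continuity_pt_filterlim, (ex_derive_continuous (fun r => - rU a r k)).
    eexists; apply (is_derive_opp (fun r => rU a r k)), rU_derive; lra.
  - exfalso; apply (Hne z); lra.
Qed.

(** For such k the coefficient k^2 - Lam / r^2 is negative on the whole interval, and solutions do
    not oscillate: r^n U V is nondecreasing from a nonnegative value, so U^2 is nondecreasing as
    well and U stays at least 1. *)
Lemma small_k_positive (a k : R) : 0 < Lam -> 0 <= a -> 0 < k -> k ^ 2 < Lam / R2 ^ 2 ->
  0 < rU a R2 k /\ 0 < rV a R2 k.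
Proof using S1 S2 HR1 HR12 HW HC.
  intros HL Ha Hk HkL.
  assert (Hq : forall r, R1 <= r <= R2 -> 0 < Lam / r ^ 2 - k ^ 2).
  { intros r Hr. assert (Lam / R2 ^ 2 <= Lam / r ^ 2); [|lra].
    apply Rmult_le_compat_l; [lra|]. apply Rinv_le_contravar; [apply pow_lt; lra|].
    apply pow_incr; lra. }
  set (T := fun r => r ^ n * (rU a r k * rV a r k)).
  set (T' := fun r => r ^ n * (rV a r k ^ 2 + (Lam / r ^ 2 - k ^ 2) * rU a r k ^ 2)).
  assert (DT : forall r, 0 < r -> is_derive T r (T' r)).
  { intros r Hr; evar_last.
    - apply (is_derive_mul_R (fun r => r ^ n) (fun r => rU a r k * rV a r k)).
      + apply is_derive_pow_n; auto.
      + apply is_derive_mul_R; [apply rU_derive|apply rV_derive]; auto.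
    - unfold T'; field; lra. }
  assert (HT' : forall r, R1 <= r <= R2 -> 0 <= T' r).
  { intros r Hr; unfold T'. specialize (Hq r Hr). apply Rmult_le_pos; [apply pow_le; lra|].
    apply Rplus_le_le_0_compat; [apply pow2_ge_0|apply Rmult_le_pos; [lra|apply pow2_ge_0]]. }
  assert (T1 : T R1 = R1 ^ n * a) by (unfold T; rewrite rU_R1, rV_R1 by auto; ring).
  assert (HR := R1n_pos).
  assert (Tpos : forall r, R1 <= r <= R2 -> 0 <= T r).
  { intros r Hr. assert (H := bounded_derive_diff T T' R1 r 0 ltac:(lra)).
    assert (T R1 - 0 * (r - R1) <= T r); [|rewrite T1 in *; nra].
    apply H; intros x Hx; [apply DT|rewrite Ropp_0; apply HT']; lra. }
  assert (Uge : forall r, R1 <= r <= R2 -> 1 <= rU a r k ^ 2).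
  { intros r Hr.
    assert (H := bounded_derive_diff (fun r => rU a r k * rU a r k)
      (fun r => rV a r k * rU a r k + rU a r k * rV a r k) R1 r 0 ltac:(lra)). cbv beta in H.
    rewrite rU_R1 in H by auto.
    assert (1 * 1 - 0 * (r - R1) <= rU a r k * rU a r k); [|simpl; lra].
    apply H; intros x Hx.
    - apply (is_derive_mul_R (fun r => rU a r k) (fun r => rU a r k)); apply rU_derive; lra.
    - specialize (Tpos x ltac:(lra)); unfold T in Tpos.
      assert (0 < x ^ n) by (apply pow_lt; lra). nra. }
  assert (Upos := rU_pos_of_nonzero a k Hk).
  assert (HU2 : 0 < rU a R2 k).
  { apply Upos; [|lra]. intros r Hr E; specialize (Uge r Hr); rewrite E in Uge; simpl in Uge; lra. }
  split; auto.
  assert (HT2 : T R1 < T R2).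
  { assert (- T R2 < - T R1); [|lra].
    apply (strictly_decreasing_of_derive (fun r => - T r) (fun r => - T' r)); auto.
    - intros r Hr; apply (is_derive_opp T), DT; lra.
    - intros r Hr; unfold T'. specialize (Hq r Hr); specialize (Uge r Hr).
      assert (0 < r ^ n) by (apply pow_lt; lra). assert (H0 := pow2_ge_0 (rV a r k)).
      assert (0 < (Lam / r ^ 2 - k ^ 2) * rU a r k ^ 2) by (apply Rmult_lt_0_compat; lra).
      assert (0 < r ^ n * (rV a r k ^ 2 + (Lam / r ^ 2 - k ^ 2) * rU a r k ^ 2))
        by (apply Rmult_lt_0_compat; lra). lra. }
  assert (HT3 : 0 < T R2) by (rewrite T1 in HT2; nra).
  unfold T in HT3. assert (0 < R2 ^ n) by (apply pow_lt; lra).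
  assert (0 < rU a R2 k * rV a R2 k) by nra. nra.
Qed.

(** For Lam = 0 the equation reads (r^n V)' = - k^2 r^n U, so r^n V stays within O(k^2) of R1^n a.
    If a > 0 this keeps V positive; if a = 0 it makes V negative, the trace of the Neumann
    eigenvalue 0. *)
Lemma small_k_zero_Lam (a : R) : Lam = 0 -> 0 <= a -> exists kap, 0 < kap /\
  forall k, 0 < k < kap -> 0 < rU a R2 k /\ (0 < a -> 0 < rV a R2 k) /\ (a = 0 -> rV a R2 k < 0).
Proof using S1 S2 HR1 HR12 HW HC.
  intros HL Ha.
  set (L := R2 - R1). assert (HLp : 0 < L) by (unfold L; lra).
  (* Gronwall for U^2 + V^2 with rate 1, valid since k <= 1; adding 1 turns the bound on U^2 into
     one on |U|. *)
  set (M := (1 + a ^ 2) * exp (1 * L) + 1).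
  assert (HM : 0 < M).
  { unfold M; assert (H := exp_pos (1 * L)); assert (H1 := pow2_ge_0 a). nra. }
  assert (HR := R1n_pos). assert (HR2 : 0 < R2 ^ n) by (apply pow_lt; lra).
  set (K := R2 ^ n * M * L). assert (HK : 0 < K) by (unfold K; repeat apply Rmult_lt_0_compat; auto).
  (* k^2 K bounds the decrease of r^n V. The second entry gives k^2 K L <= R1^n / 2, hence U >= 1/2;
     the third gives k^2 K < R1^n a when a > 0, and its value 1 is a filler when a = 0. *)
  set (kap := Rmin 1 (Rmin (R1 ^ n / (2 * K * L)) (if Rlt_dec 0 a then R1 ^ n * a / K else 1))).
  assert (Hif : 0 < (if Rlt_dec 0 a then R1 ^ n * a / K else 1)).
  { destruct (Rlt_dec 0 a); [|lra]. apply Rdiv_lt_0_compat; auto; nra. }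
  assert (Hkap : 0 < kap).
  { unfold kap; repeat apply Rmin_pos; auto; try lra. apply Rdiv_lt_0_compat; auto; nra. }
  exists kap; split; auto. intros k [Hk Hkk].
  assert (K1 : kap <= 1) by apply Rmin_l.
  assert (K2 : kap <= R1 ^ n / (2 * K * L)) by (eapply Rle_trans; [apply Rmin_r|apply Rmin_l]).
  assert (K3 : kap <= if Rlt_dec 0 a then R1 ^ n * a / K else 1)
    by (eapply Rle_trans; [apply Rmin_r|apply Rmin_r]).
  assert (Hk2 : 0 < k ^ 2 <= k) by (split; [apply pow_lt; auto|simpl; nra]).
  assert (Ub : forall r, R1 <= r <= R2 -> Rabs (rU a r k) <= M).
  { intros r Hr.
    assert (HE : rU a r k * rU a r k + rV a r k * rV a r k <= (1 + a ^ 2) * exp (1 * L)).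
    { assert (Hg := gronwall (fun r => rU a r k * rU a r k + rV a r k * rV a r k)
        (fun r => 2 * (1 - k ^ 2) * (rU a r k * rV a r k) - 2 * (INR n / r) * rV a r k ^ 2) R1 r 1 ltac:(lra)).
      cbv beta in Hg. rewrite rU_R1, rV_R1 in Hg by auto.
      eapply Rle_trans; [apply Hg|].
      - intros x Hx; evar_last.
        + apply (is_derive_plus (fun r => rU a r k * rU a r k) (fun r => rV a r k * rV a r k));
            apply is_derive_mul_R; [apply rU_derive|apply rU_derive|apply rV_derive|apply rV_derive]; lra.
        + change plus with Rplus. rewrite HL; field; lra.
      - intros x Hx. assert (0 <= INR n / x) by (apply Rdiv_le_0_compat; [apply pos_INR|lra]).
        assert (0 <= INR n / x * rV a x k ^ 2) by (apply Rmult_le_pos; [lra|apply pow2_ge_0]).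
        assert (0 <= 1 - k ^ 2 <= 1) by lra.
        set (u := rU a x k) in *; set (v := rV a x k) in *.
        assert (Hq1 := Rle_0_sqr (u - v)). assert (Hq2 := Rle_0_sqr u). assert (Hq3 := Rle_0_sqr v).
        unfold Rsqr in *. assert (2 * (u * v) <= u * u + v * v) by lra.
        assert ((1 - k ^ 2) * (2 * (u * v)) <= (1 - k ^ 2) * (u * u + v * v))
          by (apply Rmult_le_compat_l; lra).
        assert ((1 - k ^ 2) * (u * u + v * v) <= 1 * (u * u + v * v))
          by (apply Rmult_le_compat_r; lra).
        lra.
      - apply Rmult_le_compat; [nra|left; apply exp_pos|simpl; lra|].
        apply exp_le_compat; unfold L; lra. }
    unfold M; assert (H0 := Rle_0_sqr (rV a r k)); unfold Rsqr in H0.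
    assert (H1 := Rabs_pos (rU a r k)).
    assert (H2 : Rabs (rU a r k) * Rabs (rU a r k) = rU a r k * rU a r k)
      by (rewrite <- Rabs_mult; apply Rabs_pos_eq, Rle_0_sqr). nra. }
  assert (DT : forall r, 0 < r -> is_derive (fun r => r ^ n * rV a r k) r (- (k ^ 2 * (r ^ n * rU a r k)))).
  { intros r Hr; evar_last.
    - apply (is_derive_mul_R (fun r => r ^ n) (fun r => rV a r k)).
      + apply is_derive_pow_n; auto.
      + apply rV_derive; auto.
    - rewrite HL; field; lra. }
  assert (Tge : forall r, R1 <= r <= R2 -> R1 ^ n * a - k ^ 2 * K <= r ^ n * rV a r k).
  { intros r Hr.
    assert (H := bounded_derive_diff (fun r => r ^ n * rV a r k)
       (fun r => - (k ^ 2 * (r ^ n * rU a r k))) R1 r (k ^ 2 * (R2 ^ n * M)) ltac:(lra)).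
    cbv beta in H. rewrite rV_R1 in H by auto.
    eapply Rle_trans; [|apply H].
    - unfold K. assert (k ^ 2 * (R2 ^ n * M) * (r - R1) <= k ^ 2 * (R2 ^ n * M) * L).
      { apply Rmult_le_compat_l; [|unfold L; lra].
        apply Rmult_le_pos; [lra|]. left; apply Rmult_lt_0_compat; auto. }
      lra.
    - intros x Hx; apply DT; lra.
    - intros x Hx. apply Ropp_le_contravar, Rmult_le_compat_l; [lra|].
      eapply Rle_trans; [apply Rle_abs|]. rewrite Rabs_mult.
      rewrite Rabs_pos_eq by (apply pow_le; lra).
      apply Rmult_le_compat; [apply pow_le; lra|apply Rabs_pos| |apply Ub; lra].
      apply pow_incr; lra. }
  assert (HkK : k ^ 2 * K * L <= R1 ^ n / 2).
  { apply Rle_trans with (R1 ^ n / (2 * K * L) * (K * L)).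
    - rewrite Rmult_assoc. apply Rmult_le_compat_r; [|lra]. left; apply Rmult_lt_0_compat; auto.
    - right; field; split; lra. }
  assert (Uge : forall r, R1 <= r <= R2 -> 1 / 2 <= rU a r k).
  { intros r Hr.
    assert (H := bounded_derive_diff (fun r => rU a r k) (fun r => rV a r k) R1 r
      (k ^ 2 * K / R1 ^ n) ltac:(lra)). cbv beta in H. rewrite rU_R1 in H by auto.
    eapply Rle_trans; [|apply H].
    - assert (k ^ 2 * K / R1 ^ n * (r - R1) <= 1 / 2); [|lra].
      apply Rle_trans with (k ^ 2 * K / R1 ^ n * L).
      + apply Rmult_le_compat_l; [|unfold L; lra]. apply Rdiv_le_0_compat; auto. nra.
      + apply (Rmult_le_reg_r (R1 ^ n)); auto. field_simplify; lra.
    - intros x Hx; apply rU_derive; lra.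
    - intros x Hx. specialize (Tge x ltac:(lra)).
      assert (Hxn : R1 ^ n <= x ^ n) by (apply pow_incr; lra).
      assert (0 <= R1 ^ n * a) by nra.
      apply (Rmult_le_reg_l (x ^ n)); [lra|].
      eapply Rle_trans; [|exact Tge].
      assert (k ^ 2 * K <= x ^ n * (k ^ 2 * K / R1 ^ n)); [|lra].
      apply Rle_trans with (R1 ^ n * (k ^ 2 * K / R1 ^ n)); [right; field; lra|].
      apply Rmult_le_compat_r; auto. apply Rdiv_le_0_compat; auto; nra. }
  split; [|split].
  - specialize (Uge R2 ltac:(lra)); lra.
  - intros Hap. destruct (Rlt_dec 0 a) as [_|]; [|lra].
    specialize (Tge R2 ltac:(lra)).
    assert (k ^ 2 * K < R1 ^ n * a).
    { apply Rle_lt_trans with (k * K); [apply Rmult_le_compat_r; lra|].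
      apply Rlt_le_trans with (R1 ^ n * a / K * K); [|right; field; lra].
      apply Rmult_lt_compat_r; lra. }
    assert (0 < R2 ^ n * rV a R2 k) by lra. nra.
  - intros ->.
    assert (R2 ^ n * rV 0 R2 k < R1 ^ n * rV 0 R1 k).
    { apply (strictly_decreasing_of_derive (fun r => r ^ n * rV 0 r k)
        (fun r => - (k ^ 2 * (r ^ n * rU 0 r k)))); auto.
      - intros r Hr; apply DT; lra.
      - intros r Hr; specialize (Uge r Hr). assert (0 < r ^ n) by (apply pow_lt; lra).
        assert (0 < k ^ 2 * (r ^ n * rU 0 r k)) by (repeat apply Rmult_lt_0_compat; lra). lra. }
    rewrite rV_R1 in H by auto. nra.
Qed.

End Radial.

Lemma sin_cos_nat_PI (m : nat) : sin (INR m * PI) = 0 /\ cos (INR m * PI) = (-1) ^ m.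
Proof.
  assert (Hs := sin_int_PI m 0). assert (Hc := cos_int_PI m 0).
  rewrite Rplus_0_r, Rmult_0_l in *. rewrite sin_0 in Hs; rewrite cos_0 in Hc. split; lra.
Qed.

(* Liouville substitution W = r^(n/2) U, for which W'' + (k^2 - q) W = 0 with q
   bounded; then k W cos(k(r - R1)) - W' sin(k(r - R1)) has derivative
   -q W sin(k(r - R1)), bounded independently of k. *)
Lemma oscillation_bound (n : nat) (Lam R1 R2 : R) : 0 < R1 -> R1 < R2 ->
  exists M, forall (k : R) (U V : R -> R), 1 <= k ->
    (forall r, R1 <= r <= R2 -> is_derive U r (V r) /\
       is_derive V r (- (INR n / r) * V r - (k ^ 2 - Lam / r ^ 2) * U r)) ->
    U R1 = 1 -> V R1 = 0 ->
    forall m, k * (R2 - R1) = INR m * PI ->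
    k * Rpower R1 (INR n / 2) - M <= (-1) ^ m * (k * (Rpower R2 (INR n / 2) * U R2)).
Proof.
  intros HR1 HR12.
  set (L := R2 - R1). assert (HL : 0 < L) by (unfold L; lra).
  (* The potential left by the substitution is c0 / r^2; n (n - 2) / 4 comes from differentiating
     r^(n/2) twice. *)
  set (c0 := Lam + INR n * (INR n - 2) / 4).
  set (Q := Rabs c0 / R1 ^ 2).
  assert (HR1s : 0 < R1 ^ 2) by (apply pow_lt; auto).
  assert (HQ : 0 <= Q) by (apply Rdiv_le_0_compat; auto using Rabs_pos).
  set (w0 := Rpower R1 (INR n / 2)). set (x0 := w0 * (INR n / (2 * R1))).
  (* Bounds W^2 independently of k >= 1: the energy (k W)^2 + W'^2 starts at most at k^2 (w0^2 +
     x0^2) and grows at a rate at most 4 Q. *)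
  set (M2 := (w0 ^ 2 + x0 ^ 2) * exp (4 * Q * L)).
  assert (HM2 : 0 <= M2).
  { apply Rmult_le_pos; [|left; apply exp_pos]. assert (H := pow2_ge_0 w0). assert (H1 := pow2_ge_0 x0). lra. }
  exists (Q * (1 + M2) * L). intros k U V Hk HUV HU1 HV1 m Hm.
  set (rho := fun r => Rpower r (INR n / 2)).
  assert (Drho : forall r, 0 < r -> is_derive rho r (INR n / (2 * r) * rho r)).
  { intros r Hr; unfold rho, Rpower; auto_derive; auto. field; lra. }
  set (W := fun r => rho r * U r).
  set (X := fun r => rho r * (V r + INR n / (2 * r) * U r)).
  assert (DW : forall r, R1 <= r <= R2 -> is_derive W r (X r)).
  { intros r Hr; destruct (HUV r Hr) as [A B]; evar_last.
    - apply (is_derive_mul_R rho U); [apply Drho; lra|exact A].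
    - unfold X; ring. }
  assert (DX : forall r, R1 <= r <= R2 -> is_derive X r ((c0 / r ^ 2 - k ^ 2) * W r)).
  { intros r Hr; destruct (HUV r Hr) as [A B].
    assert (D1 : is_derive (fun r => INR n / (2 * r)) r (- (INR n / (2 * r ^ 2))))
      by (auto_derive; [lra|field; lra]).
    evar_last.
    - apply (is_derive_mul_R rho (fun r => V r + INR n / (2 * r) * U r)); [apply Drho; lra|].
      apply (is_derive_plus V (fun r => INR n / (2 * r) * U r)); [exact B|].
      apply (is_derive_mul_R (fun r => INR n / (2 * r)) U); [exact D1|exact A].
    - change plus with Rplus; unfold W, c0; field; lra. }
  set (cs := fun r => cos (k * (r - R1))). set (sn := fun r => sin (k * (r - R1))).
  assert (Dcs : forall r, is_derive cs r (- k * sn r)) by (intros; unfold cs, sn; auto_derive; auto; unfold Rminus; ring).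
  assert (Dsn : forall r, is_derive sn r (k * cs r)) by (intros; unfold cs, sn; auto_derive; auto; unfold Rminus; ring).
  set (p := fun r => k * W r * cs r - X r * sn r).
  assert (Dp : forall r, R1 <= r <= R2 -> is_derive p r (- (c0 / r ^ 2) * W r * sn r)).
  { intros r Hr; evar_last.
    - apply (is_derive_minus (fun r => k * W r * cs r) (fun r => X r * sn r)).
      + apply (is_derive_mul_R (fun r => k * W r) cs); [apply is_derive_scal, DW; auto|apply Dcs].
      + apply (is_derive_mul_R X sn); [apply DX; auto|apply Dsn].
    - unfold minus; change plus with Rplus; change opp with Ropp. ring. }
  assert (Hq : forall r, R1 <= r <= R2 -> Rabs (c0 / r ^ 2) <= Q).
  { intros r Hr; unfold Q, Rdiv; rewrite Rabs_mult. apply Rmult_le_compat_l; [apply Rabs_pos|].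
    assert (R1 ^ 2 <= r ^ 2) by (apply pow_incr; lra).
    rewrite Rabs_inv, (Rabs_pos_eq (r ^ 2)) by lra. apply Rinv_le_contravar; auto. }
  assert (HE : forall r, R1 <= r <= R2 -> k * W r * (k * W r) + X r * X r <= k ^ 2 * M2).
  { intros r Hr.
    assert (Hg := gronwall (fun r => k * W r * (k * W r) + X r * X r)
      (fun r => 2 * (c0 / r ^ 2) * (W r * X r)) R1 r (4 * Q) ltac:(lra)). cbv beta in Hg.
    assert (Hw1 : W R1 = w0) by (unfold W, rho, w0; rewrite HU1; ring).
    assert (Hx1 : X R1 = x0) by (unfold X, rho, x0, w0; rewrite HU1, HV1; ring).
    rewrite Hw1, Hx1 in Hg. eapply Rle_trans; [apply Hg|].
    - intros x Hx; evar_last.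
      + apply (is_derive_plus (fun r => k * W r * (k * W r)) (fun r => X r * X r)).
        * apply (is_derive_mul_R (fun r => k * W r) (fun r => k * W r)); apply is_derive_scal, DW; lra.
        * apply (is_derive_mul_R X X); apply DX; lra.
      + change plus with Rplus; field; lra.
    - intros x Hx. specialize (Hq x ltac:(lra)).
      set (u := W x) in *; set (v := X x) in *; set (c := c0 / x ^ 2) in *.
      assert (Ha : Rabs (2 * c * (u * v)) <= Q * (k * u * (k * u) + v * v)).
      { rewrite !Rabs_mult, (Rabs_pos_eq 2) by lra.
        assert (Ha1 : 2 * (Rabs u * Rabs v) <= k * u * (k * u) + v * v).
        { assert (Hu : Rabs u * Rabs u = u * u) by (rewrite <- Rabs_mult; apply Rabs_pos_eq, Rle_0_sqr).
          assert (Hv : Rabs v * Rabs v = v * v) by (rewrite <- Rabs_mult; apply Rabs_pos_eq, Rle_0_sqr).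
          assert (Hs := Rle_0_sqr (Rabs u - Rabs v)); unfold Rsqr in Hs.
          assert (Hu0 := Rle_0_sqr u); unfold Rsqr in Hu0.
          assert (u * u <= k * u * (k * u)); [|lra].
          replace (k * u * (k * u)) with (k * k * (u * u)) by ring.
          assert (1 <= k * k) by nra. nra. }
        replace (2 * Rabs c * (Rabs u * Rabs v)) with (Rabs c * (2 * (Rabs u * Rabs v))) by ring.
        apply Rmult_le_compat; auto using Rabs_pos.
        apply Rmult_le_pos; [lra|]. apply Rmult_le_pos; apply Rabs_pos. }
      assert (Ha2 := Rle_abs (2 * c * (u * v))).
      assert (0 <= Q * (k * u * (k * u) + v * v)).
      { apply Rmult_le_pos; auto. assert (H1 := Rle_0_sqr (k * u)). assert (H2 := Rle_0_sqr v). unfold Rsqr in *; lra. }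
      lra.
    - unfold M2. assert (1 <= k ^ 2) by (simpl; nra).
      replace (k ^ 2 * ((w0 ^ 2 + x0 ^ 2) * exp (4 * Q * L))) with ((k ^ 2 * (w0 ^ 2 + x0 ^ 2)) * exp (4 * Q * L)) by ring.
      assert (Hx0 := pow2_ge_0 x0). assert (Hw0 := pow2_ge_0 w0). assert (Hk0 := pow2_ge_0 (k * w0)).
      apply Rmult_le_compat.
      + simpl in *; nra.
      + left; apply exp_pos.
      + replace (k * w0 * (k * w0)) with (k ^ 2 * w0 ^ 2) by ring. replace (x0 * x0) with (x0 ^ 2) by ring. nra.
      + apply exp_le_compat, Rmult_le_compat_l; [lra|unfold L; lra]. }
  assert (HWb : forall r, R1 <= r <= R2 -> Rabs (W r) <= 1 + M2).
  { intros r Hr; specialize (HE r Hr).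
    assert (H1 : W r * W r <= M2).
    { assert (Hk2 : 0 < k ^ 2) by (apply pow_lt; lra).
      apply (Rmult_le_reg_l (k ^ 2)); auto. assert (H2 := Rle_0_sqr (X r)); unfold Rsqr in H2.
      replace (k ^ 2 * (W r * W r)) with (k * W r * (k * W r)) by ring. lra. }
    assert (H2 : Rabs (W r) * Rabs (W r) = W r * W r)
      by (rewrite <- Rabs_mult; apply Rabs_pos_eq, Rle_0_sqr).
    assert (H3 := Rabs_pos (W r)). nra. }
  assert (Hb : forall r, R1 <= r <= R2 -> - (Q * (1 + M2)) <= - (c0 / r ^ 2) * W r * sn r).
  { intros r Hr.
    assert (Rabs (- (c0 / r ^ 2) * W r * sn r) <= Q * (1 + M2)).
    { rewrite !Rabs_mult, Rabs_Ropp.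
      assert (Hsn : Rabs (sn r) <= 1) by (apply Rabs_le, SIN_bound).
      specialize (Hq r Hr); specialize (HWb r Hr).
      rewrite <- (Rmult_1_r (Q * (1 + M2))).
      apply Rmult_le_compat; auto using Rabs_pos.
      - apply Rmult_le_pos; apply Rabs_pos.
      - apply Rmult_le_compat; auto using Rabs_pos. }
    apply Rabs_le_between in H; lra. }
  assert (Hfin := bounded_derive_diff p _ R1 R2 (Q * (1 + M2)) ltac:(lra) Dp Hb).
  (* At R2 the argument k (R2 - R1) is m PI: the sine term drops out and the cosine is (-1)^m, so
     p(R2) = (-1)^m k W(R2). *)
  destruct (sin_cos_nat_PI m) as [Hs Hc].
  unfold p, cs, sn in Hfin. fold L in Hm, Hfin. rewrite Hm, Hs, Hc in Hfin.
  rewrite Rminus_diag, Rmult_0_r, cos_0, sin_0 in Hfin.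
  unfold W, rho in Hfin; rewrite HU1 in Hfin. unfold w0; lra.
Qed.

(** * The Neumann boundary value problem *)

Lemma closed_interval_nondecreasing (f f' : R -> R) (a b : R) : a <= b ->
  continuous_on (fun r => a <= r <= b) f ->
  (forall r, a < r < b -> is_derive f r (f' r)) ->
  (forall r, a < r < b -> 0 <= f' r) -> f a <= f b.
Proof.
  intros Hab Hc Hd Hpos. destruct (Req_dec a b) as [->|Hne]; [lra|].
  (* Projection onto [a, b]. Continuity of f is only relative to the interval; f composed with [cl]
     is continuous on the whole line, as the mean value theorem requires. *)
  set (cl := fun x => Rmax a (Rmin x b)).
  assert (Hcl : forall x, a <= cl x <= b).
  { intros x; unfold cl; split; [apply Rmax_l|]. apply Rmax_lub; [lra|apply Rmin_r]. }
  assert (Hid : forall x, a <= x <= b -> cl x = x).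
  { intros x Hx; unfold cl; rewrite Rmin_left by lra. apply Rmax_right; lra. }
  assert (Hclc : forall x, continuous cl x).
  { intros x; apply continuity_pt_filterlim; intros eps Heps.
    exists eps; split; auto. intros y [_ Hy]; simpl in *; unfold R_dist in *.
    eapply Rle_lt_trans; [|exact Hy].
    unfold cl, Rmax, Rmin; repeat destruct Rle_dec; unfold Rabs; repeat destruct Rcase_abs; lra. }
  set (F := fun x => f (cl x)).
  assert (HF : forall x, continuity_pt F x).
  { intros x; apply continuity_pt_filterlim.
    apply (filterlim_comp _ _ _ cl f (locally x) (within (fun r => a <= r <= b) (locally (cl x)))
             (locally (f (cl x)))); [|apply Hc; auto].
    intros P HP; unfold filtermap. specialize (Hclc x _ HP).
    unfold filtermap in Hclc. eapply filter_imp; [|exact Hclc]. intros y Hy; apply Hy; auto. }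
  (* The derivative is set to 0 off the open interval, since the point returned by the theorem may
     be an endpoint. *)
  destruct (MVT_gen F a b (fun c => if Rlt_dec a c then if Rlt_dec c b then f' c else 0 else 0)) as (c & Hcab & E).
  - rewrite Rmin_left, Rmax_right by lra. intros x Hx.
    destruct (Rlt_dec a x); [|lra]. destruct (Rlt_dec x b); [|lra].
    apply (is_derive_ext_loc f); [|apply Hd; lra].
    apply (locally_interval _ x a b); simpl; try lra.
    intros y Hy1 Hy2; unfold F; rewrite Hid; auto; simpl in *; lra.
  - intros x _; apply HF.
  - unfold F in E; rewrite !Hid in E by lra.
    assert (0 <= (if Rlt_dec a c then if Rlt_dec c b then f' c else 0 else 0) * (b - a)); [|lra].
    apply Rmult_le_pos; [|lra]. destruct (Rlt_dec a c); [|lra]. destruct (Rlt_dec c b); [|lra]. auto.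
Qed.

Lemma continuous_on_mult_R (D : R -> Prop) (f g : R -> R) :
  continuous_on D f -> continuous_on D g -> continuous_on D (fun x => f x * g x).
Proof.
  intros Hf Hg x Hx. eapply filterlim_comp_2; [apply Hf; auto|apply Hg; auto|].
  apply (filterlim_mult (K := R_AbsRing)).
Qed.

Lemma continuous_on_opp_R (D : R -> Prop) (f : R -> R) :
  continuous_on D f -> continuous_on D (fun x => - f x).
Proof.
  intros Hf x Hx. eapply filterlim_comp; [apply Hf; auto|].
  apply (filterlim_opp (V := R_NormedModule)).
Qed.

Lemma continuous_on_minus_R (D : R -> Prop) (f g : R -> R) :
  continuous_on D f -> continuous_on D g -> continuous_on D (fun x => f x - g x).
Proof.
  intros Hf Hg x Hx. unfold Rminus.
  assert (Hn := continuous_on_opp_R D g Hg x Hx).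
  eapply (filterlim_comp_2 f (fun x => - g x) Rplus (Hf x Hx) Hn).
  apply (filterlim_plus (V := R_NormedModule)).
Qed.

Lemma continuous_on_of_derive (D : R -> Prop) (f : R -> R) :
  (forall x, D x -> exists l, is_derive f x l) -> continuous_on D f.
Proof.
  intros H; apply continuous_on_forall; intros x Hx.
  apply (ex_derive_continuous f), H, Hx.
Qed.

Lemma closed_interval_constant (f : R -> R) (a b : R) : a <= b ->
  continuous_on (fun r => a <= r <= b) f ->
  (forall r, a < r < b -> is_derive f r 0) -> f a = f b.
Proof.
  intros Hab Hc Hd; apply Rle_antisym.
  - apply (closed_interval_nondecreasing f (fun _ => 0)); auto; intros; lra.
  - assert (- f a <= - f b); [|lra].
    apply (closed_interval_nondecreasing (fun x => - f x) (fun _ => - 0)); auto; try (intros; lra).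
    + apply continuous_on_opp_R; auto.
    + intros r Hr; apply (is_derive_opp f r 0), Hd; auto.
Qed.

(** T = r^n u u' vanishes at both ends by the Neumann conditions and is nondecreasing, as the
    potential exceeds [lam]; so T' = 0 and u vanishes. This excludes lam < 0, and lam = 0 when l >
    0. *)
Lemma neumann_not_below (d l : nat) (R1 R2 lam : R) : (2 <= d)%nat -> 0 < R1 -> R1 < R2 ->
  (forall r, R1 < r < R2 -> 0 < INR l * (INR l + INR d - 2) / r ^ 2 - lam) ->
  ~ SL_eigenvalue d l R1 R2 0 0 lam.
Proof.
  intros Hd HR1 HR12 Hq (u & v & Hu & Hv & Hode & Hb1 & Hb2 & r0 & Hr0 & Hne).
  set (n := (d - 1)%nat).
  assert (Hn : INR d - 1 = INR n) by (unfold n; rewrite minus_INR by lia; simpl; ring).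
  set (Lam := INR l * (INR l + INR d - 2)) in *.
  set (T := fun r => r ^ n * (u r * v r)).
  set (T' := fun r => r ^ n * (v r ^ 2 + (Lam / r ^ 2 - lam) * u r ^ 2)).
  assert (DT : forall r, R1 < r < R2 -> is_derive T r (T' r)).
  { intros r Hr; destruct (Hode r Hr) as [Du (w & Dv & E)]; evar_last.
    - apply (is_derive_mul_R (fun r => r ^ n) (fun r => u r * v r)).
      + apply is_derive_pow_n; lra.
      + apply (is_derive_mul_R u v); [exact Du|exact Dv].
    - rewrite Hn in E. replace w with (- (INR n / r * v r) - (lam - Lam / r ^ 2) * u r) by lra.
      unfold T'; field; lra. }
  assert (HT0 : forall r, R1 < r < R2 -> 0 <= T' r).
  { intros r Hr; unfold T'; specialize (Hq r Hr). apply Rmult_le_pos; [apply pow_le; lra|].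
    apply Rplus_le_le_0_compat; [apply pow2_ge_0|apply Rmult_le_pos; [lra|apply pow2_ge_0]]. }
  assert (HTc : forall a b, R1 <= a -> b <= R2 -> continuous_on (fun r => a <= r <= b) T).
  { intros a b Ha Hb.
    apply (continuous_on_subset (fun r => R1 <= r <= R2)); [intros; lra|].
    apply (continuous_on_mult_R _ (fun r => r ^ n) (fun r => u r * v r)).
    - apply continuous_on_of_derive; intros x Hx; eexists; apply is_derive_pow_n; lra.
    - apply (continuous_on_mult_R _ u v); auto. }
  assert (Tz : forall r, R1 < r < R2 -> T r = 0).
  { intros r Hr. assert (E1 : T R1 = 0) by (unfold T; replace (v R1) with 0 by lra; ring).
    assert (E2 : T R2 = 0) by (unfold T; replace (v R2) with 0 by lra; ring).
    apply Rle_antisym.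
    - rewrite <- E2; apply (closed_interval_nondecreasing T T'); [lra|apply HTc; lra| |];
        intros x Hx; [apply DT|apply HT0]; lra.
    - rewrite <- E1; apply (closed_interval_nondecreasing T T'); [lra|apply HTc; lra| |];
        intros x Hx; [apply DT|apply HT0]; lra. }
  assert (Uz : forall r, R1 < r < R2 -> u r = 0 /\ v r = 0).
  { intros r Hr.
    assert (E : T' r = 0).
    { assert (D0 : is_derive T r 0).
      { apply (is_derive_ext_loc (fun _ => 0)); [|auto_derive; auto].
        apply (locally_interval _ r R1 R2); simpl; try lra.
        intros y Hy1 Hy2; symmetry; apply Tz; simpl in *; lra. }
      apply is_derive_unique in D0. assert (D1 := DT r Hr). apply is_derive_unique in D1. lra. }
    unfold T' in E; specialize (Hq r Hr). assert (0 < r ^ n) by (apply pow_lt; lra).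
    apply Rmult_integral in E; destruct E as [E|E]; [lra|].
    assert (H1 := pow2_ge_0 (v r)). assert (H2 := pow2_ge_0 (u r)).
    assert (H3 : 0 <= (Lam / r ^ 2 - lam) * u r ^ 2) by (apply Rmult_le_pos; lra).
    assert (H4 : (Lam / r ^ 2 - lam) * u r ^ 2 = 0) by lra.
    apply Rmult_integral in H4; destruct H4 as [H4|H4]; [lra|].
    split; [apply (Rsqr_0_uniq)|apply (Rsqr_0_uniq)]; unfold Rsqr; simpl in *; lra. }
  assert (Ud : forall r, R1 < r < R2 -> is_derive u r 0).
  { intros r Hr; destruct (Hode r Hr) as [Du _]. destruct (Uz r Hr) as [_ Ev]. rewrite Ev in Du; exact Du. }
  assert (Hc : forall a b, R1 <= a -> a <= b -> b <= R2 -> u a = u b).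
  { intros a b Ha Hab Hb; apply closed_interval_constant; auto.
    - apply (continuous_on_subset (fun r => R1 <= r <= R2)); auto; intros; lra.
    - intros r Hr; apply Ud; lra. }
  set (m := (R1 + R2) / 2).
  assert (Hm : R1 < m < R2) by (unfold m; lra).
  apply Hne. destruct (Uz m Hm) as [Em _].
  destruct (Rle_dec r0 m).
  - rewrite (Hc r0 m); auto; lra.
  - rewrite <- (Hc m r0); auto; lra.
Qed.

Lemma neumann_zero (d : nat) (R1 R2 : R) : R1 < R2 -> SL_eigenvalue d 0 R1 R2 0 0 0.
Proof.
  intros HR; exists (fun _ => 1), (fun _ => 0).
  assert (Hc : forall c : R, continuous_on (fun r : R => R1 <= r <= R2) (fun _ : R => c)).
  { intros c; apply continuous_on_forall; intros; apply continuous_const. }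
  split; [auto|split; [auto|split; [|split; [lra|split; [lra|]]]]].
  - intros r Hr; split; [auto_derive; auto|]. exists 0; split; [auto_derive; auto|simpl; unfold Rdiv; ring].
  - exists R1; split; lra.
Qed.

(** An eigenfunction u is compared with the solutions of slopes 0 and 1 at R1. Its Wronskian with
    the first is zero at R1, hence everywhere; if V at R2 were nonzero, then u(R2) = 0, the
    Wronskian with the second would vanish too, and u = 0 because the two solutions are
    independent. *)
Lemma neumann_positive (d l : nat) (C R1 R2 : R) (f1 g1 f2 g2 : R -> R -> R) (k : R) :
  let n := (d - 1)%nat in let Lam := INR l * (INR l + INR d - 2) in let nu := INR d / 2 - 1 in
  (2 <= d)%nat -> C <> 0 -> 0 < R1 -> R1 < R2 ->
  radial_solution n nu Lam f1 g1 -> radial_solution n nu Lam f2 g2 ->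
  (forall r k, 0 < r -> 0 < k -> r ^ n * (f1 r k * g2 r k - g1 r k * f2 r k) = C) ->
  0 < k ->
  (SL_eigenvalue d l R1 R2 0 0 (k ^ 2) <-> rV n C R1 f1 g1 f2 g2 0 R2 k = 0).
Proof.
  intros n Lam nu Hd HC HR1 HR12 S1 S2 HW Hk.
  assert (Hn : INR d - 1 = INR n) by (unfold n; rewrite minus_INR by lia; simpl; ring).
  set (U := fun a r => rU n C R1 f1 g1 f2 g2 a r k).
  set (V := fun a r => rV n C R1 f1 g1 f2 g2 a r k).
  assert (DU : forall a r, 0 < r -> is_derive (U a) r (V a r)).
  { intros a r Hr; apply (rU_derive n nu Lam C R1 f1 g1 f2 g2 S1 S2); auto. }
  assert (DV : forall a r, 0 < r -> is_derive (V a) r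
     (- (INR n / r) * V a r - (k ^ 2 - Lam / r ^ 2) * U a r)).
  { intros a r Hr; apply (rV_derive n nu Lam C R1 f1 g1 f2 g2 S1 S2); auto. }
  assert (U1 : forall a, U a R1 = 1) by (intros; apply rU_R1; auto).
  assert (V1 : forall a, V a R1 = a) by (intros; apply rV_R1; auto).
  fold (V 0 R2). split.
  - intros (u & v & Hu & Hv & Hode & Hb1 & Hb2 & r0 & Hr0 & Hne).
    set (W := fun a r => r ^ n * (u r * V a r - v r * U a r)).
    assert (HWc : forall a r, R1 <= r <= R2 -> W a r = W a R1).
    { intros a r Hr; symmetry; apply closed_interval_constant; [lra| |].
      - apply (continuous_on_subset (fun r => R1 <= r <= R2)); [intros; lra|].
        apply (continuous_on_mult_R _ (fun r => r ^ n) (fun r => u r * V a r - v r * U a r)).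
        + apply continuous_on_of_derive; intros x Hx; eexists; apply is_derive_pow_n; lra.
        + apply (continuous_on_minus_R _ (fun r => u r * V a r) (fun r => v r * U a r)).
          * apply (continuous_on_mult_R _ u (V a)); auto.
            apply continuous_on_of_derive; intros x Hx; eexists; apply DV; lra.
          * apply (continuous_on_mult_R _ v (U a)); auto.
            apply continuous_on_of_derive; intros x Hx; eexists; apply DU; lra.
      - intros x Hx; destruct (Hode x ltac:(lra)) as [Du (w & Dv & E)]; evar_last.
        + apply (is_derive_mul_R (fun r => r ^ n) (fun r => u r * V a r - v r * U a r)).
          * apply is_derive_pow_n; lra.
          * apply (is_derive_minus (fun r => u r * V a r) (fun r => v r * U a r)).
            -- apply (is_derive_mul_R u (V a)); [exact Du|apply DV; lra].
            -- apply (is_derive_mul_R v (U a)); [exact Dv|apply DU; lra].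
        + rewrite Hn in E. replace w with (- (INR n / x * v x) - (k ^ 2 - Lam / x ^ 2) * u x) by (unfold Lam; lra).
          unfold minus; change plus with Rplus; change opp with Ropp. field; lra. }
    assert (HR2n : 0 < R2 ^ n) by (apply pow_lt; lra).
    assert (v1 : v R1 = 0) by lra. assert (v2 : v R2 = 0) by lra.
    assert (E0 : W 0 R1 = 0) by (unfold W; rewrite V1, v1; ring).
    assert (E2 := HWc 0 R2 ltac:(lra)). rewrite E0 in E2. unfold W in E2. rewrite v2 in E2.
    assert (E3 : u R2 * V 0 R2 = 0) by (apply (Rmult_eq_reg_l (R2 ^ n)); lra).
    apply Rmult_integral in E3; destruct E3 as [E3|E3]; [exfalso|exact E3].
    assert (E4 : W 1 R1 = 0).
    { rewrite <- (HWc 1 R2) by lra. unfold W; rewrite E3, v2; ring. }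
    assert (Z0 := HWc 0 r0 Hr0). assert (Z1 := HWc 1 r0 Hr0). rewrite E0 in Z0; rewrite E4 in Z1.
    assert (Hr0n : 0 < r0 ^ n) by (apply pow_lt; lra). unfold W in Z0, Z1.
    assert (HD := radial_wronskian n C R1 f1 g1 f2 g2 HC HR1 HW 0 1 r0 k ltac:(lra) Hk).
    fold (U 0 r0) (U 1 r0) (V 0 r0) (V 1 r0) in HD.
    assert (HR1n : 0 < R1 ^ n) by (apply pow_lt; lra).
    assert (Y0 : u r0 * V 0 r0 - v r0 * U 0 r0 = 0) by (apply (Rmult_eq_reg_l (r0 ^ n)); lra).
    assert (Y1 : u r0 * V 1 r0 - v r0 * U 1 r0 = 0) by (apply (Rmult_eq_reg_l (r0 ^ n)); lra).
    apply Hne.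
    assert (X : u r0 * (U 0 r0 * V 1 r0 - V 0 r0 * U 1 r0) = 0).
    { transitivity (U 0 r0 * (u r0 * V 1 r0 - v r0 * U 1 r0) - U 1 r0 * (u r0 * V 0 r0 - v r0 * U 0 r0)); [ring|].
      rewrite Y0, Y1; ring. }
    apply Rmult_integral in X; destruct X as [X|X]; auto.
    rewrite X in HD. exfalso; lra.
  - intros HV. exists (U 0), (V 0).
    split; [|split; [|split; [|split; [|split]]]].
    + apply continuous_on_of_derive; intros x Hx; eexists; apply DU; lra.
    + apply continuous_on_of_derive; intros x Hx; eexists; apply DV; lra.
    + intros r Hr; split; [apply DU; lra|]. eexists; split; [apply DV; lra|].
      fold Lam; rewrite Hn; ring.
    + rewrite V1; ring.
    + rewrite HV; ring.
    + exists R1; rewrite U1; split; lra.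
Qed.

(** * Cylinder functions as radial solutions *)

Lemma radial_of_bessel (d l : nat) (mu0 nu0 : R) (Z0 Z1 : R -> R) : (2 <= d)%nat ->
  nu0 = INR d / 2 - 1 -> mu0 = INR l + nu0 -> bessel_system mu0 Z0 Z1 ->
  radial_solution (d - 1) nu0 (INR l * (INR l + INR d - 2))
    (fun r k => Rpower r (- nu0) * Z0 (k * r))
    (fun r k => Rpower r (- nu0) * (INR l / r * Z0 (k * r) - k * Z1 (k * r))).
Proof.
  intros Hd Hnu Hmu HZ r k Hr Hk.
  assert (Hn : INR (d - 1) = 2 * nu0 + 1) by (rewrite minus_INR by lia; simpl; lra).
  assert (HD : INR d = 2 * nu0 + 2) by lra.
  assert (Hkr : 0 < k * r) by (apply Rmult_lt_0_compat; auto).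
  destruct (HZ (k * r) Hkr) as [D0 D1].
  assert (R0 : is_derive (fun r => Z0 (k * r)) r (k * (mu0 / (k * r) * Z0 (k * r) - Z1 (k * r)))).
  { apply (is_derive_comp Z0 (fun r => k * r)); [exact D0|auto_derive; auto; ring]. }
  assert (Rr1 : is_derive (fun r => Z1 (k * r)) r (k * (Z0 (k * r) - (mu0 + 1) / (k * r) * Z1 (k * r)))).
  { apply (is_derive_comp Z1 (fun r => k * r)); [exact D1|auto_derive; auto; ring]. }
  assert (K0 : is_derive (fun k => Z0 (k * r)) k (r * (mu0 / (k * r) * Z0 (k * r) - Z1 (k * r)))).
  { apply (is_derive_comp Z0 (fun k => k * r)); [exact D0|auto_derive; auto; ring]. }
  assert (K1 : is_derive (fun k => Z1 (k * r)) k (r * (Z0 (k * r) - (mu0 + 1) / (k * r) * Z1 (k * r)))).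
  { apply (is_derive_comp Z1 (fun k => k * r)); [exact D1|auto_derive; auto; ring]. }
  assert (Dp : is_derive (fun r => Rpower r (- nu0)) r (- nu0 / r * Rpower r (- nu0))).
  { unfold Rpower; auto_derive; auto. field; lra. }
  assert (Dl : is_derive (fun r => INR l / r) r (- (INR l / r ^ 2))) by (auto_derive; [lra|field; lra]).
  split; [|split; [|split]].
  - evar_last; [apply (is_derive_mul_R (fun r => Rpower r (- nu0)) (fun r => Z0 (k * r))); eassumption|].
    rewrite Hmu; field; lra.
  - evar_last.
    + apply (is_derive_mul_R (fun r => Rpower r (- nu0)) (fun r => INR l / r * Z0 (k * r) - k * Z1 (k * r))); [exact Dp|].
      apply (is_derive_minus (fun r => INR l / r * Z0 (k * r)) (fun r => k * Z1 (k * r))).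
      * apply (is_derive_mul_R (fun r => INR l / r) (fun r => Z0 (k * r))); [exact Dl|exact R0].
      * apply is_derive_scal; exact Rr1.
    + unfold minus; change plus with Rplus; change opp with Ropp.
      rewrite Hn, HD, Hmu; field; lra.
  - evar_last; [apply is_derive_scal; exact K0|]. rewrite Hmu; field; lra.
  - evar_last.
    + apply is_derive_scal, (is_derive_minus (fun k => INR l / r * Z0 (k * r)) (fun k => k * Z1 (k * r))).
      * apply is_derive_scal; exact K0.
      * apply (is_derive_mul_R (fun k => k) (fun k => Z1 (k * r))); [auto_derive; auto|exact K1].
    + unfold minus; change plus with Rplus; change opp with Ropp.
      rewrite HD, Hmu; field; lra.
Qed.

(** The weight r^(d-1) and the two prefactors r^(-nu) combine to r, as d - 1 = 2 nu + 1. *)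
Lemma radial_bessel_wronskian (d l : nat) (nu0 c : R) (J0 J1 Y0 Y1 : R -> R) : (2 <= d)%nat ->
  nu0 = INR d / 2 - 1 ->
  (forall x, 0 < x -> x * (J1 x * Y0 x - J0 x * Y1 x) = c) ->
  forall r k, 0 < r -> 0 < k ->
  r ^ (d - 1) * (Rpower r (- nu0) * J0 (k * r) * (Rpower r (- nu0) * (INR l / r * Y0 (k * r) - k * Y1 (k * r)))
    - Rpower r (- nu0) * (INR l / r * J0 (k * r) - k * J1 (k * r)) * (Rpower r (- nu0) * Y0 (k * r))) = c.
Proof.
  intros Hd Hnu Hc r k Hr Hk.
  assert (Hp : r ^ (d - 1) * (Rpower r (- nu0) * Rpower r (- nu0)) = r).
  { rewrite <- Rpower_pow, <- !Rpower_plus by auto.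
    replace (INR (d - 1) + (- nu0 + - nu0)) with 1 by (rewrite minus_INR by lia; simpl; lra).
    apply Rpower_1; auto. }
  rewrite <- (Hc (k * r)) by (apply Rmult_lt_0_compat; auto).
  transitivity (r ^ (d - 1) * (Rpower r (- nu0) * Rpower r (- nu0)) *
    (k * (J1 (k * r) * Y0 (k * r) - J0 (k * r) * Y1 (k * r)))); [ring|].
  rewrite Hp; ring.
Qed.

(** * Phase *)

Definition polar (x y t : R) : Prop := exists rho, 0 < rho /\ x = rho * cos t /\ y = rho * sin t.

Definition norm2 (x y : R) : R := sqrt (x * x + y * y).

(* The oriented angle in (-PI, PI) between two non-antiparallel vectors, by the
   half-angle formula tan(t/2) = sin t / (1 + cos t). *)
Definition angle (x1 y1 x2 y2 : R) : R :=
  2 * atan ((x1 * y2 - y1 * x2) / (norm2 x1 y1 * norm2 x2 y2 + (x1 * x2 + y1 * y2))).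

Lemma norm2_sq (x1 y1 x2 y2 : R) :
  (norm2 x1 y1 * norm2 x2 y2) ^ 2 = (x1 * y2 - y1 * x2) ^ 2 + (x1 * x2 + y1 * y2) ^ 2.
Proof.
  unfold norm2; rewrite Rpow_mult_distr, !pow2_sqrt by nra. ring.
Qed.

(** The squares of the cross and dot products add up to the square of the product of norms, so the
    sum vanishes only if the cross product is 0 and the dot product is not positive. *)
Lemma angle_den_pos (x1 y1 x2 y2 : R) :
  x1 * y2 - y1 * x2 <> 0 \/ 0 < x1 * x2 + y1 * y2 ->
  0 < norm2 x1 y1 * norm2 x2 y2 + (x1 * x2 + y1 * y2).
Proof.
  intros H; assert (E := norm2_sq x1 y1 x2 y2).
  assert (HN : 0 <= norm2 x1 y1 * norm2 x2 y2) by (apply Rmult_le_pos; apply sqrt_pos).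
  set (N := norm2 x1 y1 * norm2 x2 y2) in *. set (c := x1 * y2 - y1 * x2) in *.
  set (d := x1 * x2 + y1 * y2) in *.
  destruct H as [H|H]; [|lra].
  assert (0 < c ^ 2) by (apply pow2_gt_0; auto).
  assert (N ^ 2 - d ^ 2 > 0) by lra. simpl in *; nra.
Qed.

Lemma cos_sin_2atan (t : R) :
  cos (2 * atan t) = (1 - t ^ 2) / (1 + t ^ 2) /\ sin (2 * atan t) = 2 * t / (1 + t ^ 2).
Proof.
  assert (Hc : 0 < cos (atan t)).
  { destruct (atan_bound t); apply cos_gt_0; lra. }
  assert (Ht : sin (atan t) = t * cos (atan t)).
  { assert (E := tan_atan t); unfold tan in E.
    apply (Rmult_eq_reg_r (/ cos (atan t))); [|apply Rinv_neq_0_compat; lra].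
    unfold Rdiv in E; rewrite E; field; lra. }
  assert (Hs := sin2_cos2 (atan t)); unfold Rsqr in Hs; rewrite Ht in Hs.
  assert (Hc2 : cos (atan t) * cos (atan t) * (1 + t ^ 2) = 1) by (simpl; lra).
  assert (Hp : 0 < 1 + t ^ 2) by (assert (H := pow2_ge_0 t); lra).
  assert (Hc3 : cos (atan t) * cos (atan t) = / (1 + t ^ 2)).
  { apply (Rmult_eq_reg_r (1 + t ^ 2)); [|lra]. rewrite Hc2; field; lra. }
  rewrite sin_2a, cos_2a, Ht; split.
  - transitivity ((1 - t ^ 2) * (cos (atan t) * cos (atan t))); [simpl; ring|]. rewrite Hc3; reflexivity.
  - transitivity (2 * t * (cos (atan t) * cos (atan t))); [simpl; ring|]. rewrite Hc3; reflexivity.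
Qed.

Lemma polar_angle (x1 y1 x2 y2 t : R) :
  polar x1 y1 t -> (x1 * y2 - y1 * x2 <> 0 \/ 0 < x1 * x2 + y1 * y2) ->
  polar x2 y2 (t + angle x1 y1 x2 y2).
Proof.
  intros (rho & Hrho & Hx & Hy) Hnd.
  assert (Hden := angle_den_pos _ _ _ _ Hnd). assert (E := norm2_sq x1 y1 x2 y2).
  assert (Hn1 : norm2 x1 y1 = rho).
  { unfold norm2. rewrite Hx, Hy.
    replace (rho * cos t * (rho * cos t) + rho * sin t * (rho * sin t))
      with (rho * rho * (Rsqr (sin t) + Rsqr (cos t))) by (unfold Rsqr; ring).
    rewrite sin2_cos2, Rmult_1_r. apply sqrt_square; lra. }
  unfold angle.
  set (N := norm2 x1 y1 * norm2 x2 y2) in *.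
  assert (HN0 : 0 <= N) by (apply Rmult_le_pos; apply sqrt_pos).
  set (c := x1 * y2 - y1 * x2) in *. set (d := x1 * x2 + y1 * y2) in *.
  assert (HN : 0 < N).
  { destruct HN0 as [|HN0]; auto. exfalso. rewrite <- HN0 in E.
    assert (H1 := pow2_ge_0 c). assert (H2 := pow2_ge_0 d).
    destruct Hnd as [Hnd|Hnd]; [apply pow2_gt_0 in Hnd|assert (0 < d ^ 2) by (apply pow_lt; auto)]; lra. }
  set (tau := c / (N + d)).
  destruct (cos_sin_2atan tau) as [Ec Es].
  assert (H1t : 1 + tau ^ 2 = 2 * N / (N + d)).
  { unfold tau. transitivity ((N ^ 2 + 2 * N * d + (c ^ 2 + d ^ 2)) / (N + d) ^ 2); [field; lra|].
    rewrite <- E; field; lra. }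
  assert (Ec' : cos (2 * atan tau) = d / N).
  { rewrite Ec. replace (1 - tau ^ 2) with (2 - (1 + tau ^ 2)) by ring. rewrite H1t. field; lra. }
  assert (Es' : sin (2 * atan tau) = c / N).
  { rewrite Es, H1t. unfold tau; field; lra. }
  assert (Hr2 : x1 * x1 + y1 * y1 = rho * rho).
  { rewrite Hx, Hy. transitivity (rho * rho * (Rsqr (sin t) + Rsqr (cos t))); [unfold Rsqr; ring|].
    rewrite sin2_cos2; ring. }
  exists (N / rho); split; [apply Rdiv_lt_0_compat; auto|].
  rewrite cos_plus, sin_plus, Ec', Es'. split.
  - transitivity ((rho * cos t * d - rho * sin t * c) / (rho * rho)); [|field; lra].
    rewrite <- Hx, <- Hy, <- Hr2. unfold c, d; field. rewrite Hr2; nra.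
  - transitivity ((rho * sin t * d + rho * cos t * c) / (rho * rho)); [|field; lra].
    rewrite <- Hx, <- Hy, <- Hr2. unfold c, d; field. rewrite Hr2; nra.
Qed.

Lemma angle_bound (x1 y1 x2 y2 : R) : - PI < angle x1 y1 x2 y2 < PI.
Proof. unfold angle; destruct (atan_bound ((x1 * y2 - y1 * x2) / (norm2 x1 y1 * norm2 x2 y2 + (x1 * x2 + y1 * y2)))); lra. Qed.

Lemma angle_nonneg (x1 y1 x2 y2 : R) : 0 <= x1 * y2 - y1 * x2 ->
  (x1 * y2 - y1 * x2 <> 0 \/ 0 < x1 * x2 + y1 * y2) -> 0 <= angle x1 y1 x2 y2.
Proof.
  intros Hc Hnd; apply angle_den_pos in Hnd; unfold angle.
  assert (0 <= (x1 * y2 - y1 * x2) / (norm2 x1 y1 * norm2 x2 y2 + (x1 * x2 + y1 * y2)))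
    by (apply Rdiv_le_0_compat; auto).
  assert (0 <= atan ((x1 * y2 - y1 * x2) / (norm2 x1 y1 * norm2 x2 y2 + (x1 * x2 + y1 * y2)))); [|lra].
  rewrite <- atan_0; destruct H as [H|H]; [left; apply atan_increasing; auto|rewrite <- H; lra].
Qed.

Lemma angle_self (x y : R) : angle x y x y = 0.
Proof. unfold angle. replace (x * y - y * x) with 0 by ring. unfold Rdiv; rewrite Rmult_0_l, atan_0; ring. Qed.

Lemma angle_continuous {T : UniformSpace} (x1 y1 x2 y2 : T -> R) (p : T) :
  continuous x1 p -> continuous y1 p -> continuous x2 p -> continuous y2 p ->
  (x1 p * y2 p - y1 p * x2 p <> 0 \/ 0 < x1 p * x2 p + y1 p * y2 p) ->
  continuous (fun t => angle (x1 t) (y1 t) (x2 t) (y2 t)) p.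
Proof.
  intros C1 C2 C3 C4 Hnd; apply angle_den_pos in Hnd.
  assert (Hm : forall f g : T -> R, continuous f p -> continuous g p -> continuous (fun t => f t * g t) p).
  { intros f g Hf Hg; apply (continuous_mult (K := R_AbsRing) f g); auto. }
  assert (Hp : forall f g : T -> R, continuous f p -> continuous g p -> continuous (fun t => f t + g t) p).
  { intros f g Hf Hg; apply (continuous_plus (V := R_NormedModule) f g); auto. }
  assert (Hmi : forall f g : T -> R, continuous f p -> continuous g p -> continuous (fun t => f t - g t) p).
  { intros f g Hf Hg; apply (continuous_minus (V := R_NormedModule) f g); auto. }
  assert (Hn : forall f g : T -> R, continuous f p -> continuous g p -> continuous (fun t => norm2 (f t) (g t)) p).
  { intros f g Hf Hg; apply (continuous_comp (fun t => f t * f t + g t * g t) sqrt); auto.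
    apply continuous_sqrt. }
  unfold angle.
  apply (Hm (fun _ => 2)); [apply continuous_const|].
  apply (continuous_comp (fun t => (x1 t * y2 t - y1 t * x2 t) /
     (norm2 (x1 t) (y1 t) * norm2 (x2 t) (y2 t) + (x1 t * x2 t + y1 t * y2 t))) atan).
  - apply (Hm (fun t => x1 t * y2 t - y1 t * x2 t)); [auto|].
    apply (continuous_comp (fun t => norm2 (x1 t) (y1 t) * norm2 (x2 t) (y2 t) + (x1 t * x2 t + y1 t * y2 t)) Rinv);
      [auto|]. apply continuous_Rinv; lra.
  - apply (ex_derive_continuous atan). eexists; apply is_derive_atan.
Qed.

(** Near k a continuous choice of angle stays within PI/2 of t(k), where it equals t(k) plus the
    arctangent of cross over dot product; that expression is differentiable although t is only
    assumed continuous. *)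
Lemma polar_derive (x y t : R -> R) (k xk yk : R) :
  continuous t k -> locally k (fun k => polar (x k) (y k) (t k)) ->
  is_derive x k xk -> is_derive y k yk ->
  is_derive t k ((x k * yk - y k * xk) / (x k ^ 2 + y k ^ 2)).
Proof.
  intros Ht Hpol Dx Dy.
  destruct (locally_singleton _ _ Hpol) as (r0 & Hr0 & Ex0 & Ey0).
  assert (Hn : x k ^ 2 + y k ^ 2 = r0 ^ 2).
  { rewrite Ex0, Ey0. transitivity (r0 ^ 2 * (Rsqr (sin (t k)) + Rsqr (cos (t k)))); [unfold Rsqr; ring|].
    rewrite sin2_cos2; ring. }
  assert (Hn0 : 0 < r0 ^ 2) by (apply pow_lt; auto).
  apply (is_derive_ext_loc (fun s => t k + atan ((x k * y s - y k * x s) / (x k * x s + y k * y s)))).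
  - assert (Hloc : locally k (fun s => Rabs (t s - t k) < PI / 2)).
    { assert (HPI := PI_RGT_0). assert (H2 : 0 < PI / 2) by lra.
      apply (Ht (fun z => Rabs (z - t k) < PI / 2)).
      exists (mkposreal _ H2); intros z Hz; exact Hz. }
    generalize (filter_and _ _ Hpol Hloc). apply filter_imp. intros s [(rs & Hrs & Exs & Eys) Hs].
    apply Rabs_def2 in Hs.
    replace ((x k * y s - y k * x s) / (x k * x s + y k * y s)) with (tan (t s - t k)).
    + rewrite atan_tan by lra. apply Rplus_minus.
    + assert (Hc : 0 < cos (t s - t k)) by (apply cos_gt_0; lra).
      replace (x k * y s - y k * x s) with (r0 * rs * sin (t s - t k))
        by (rewrite Ex0, Ey0, Exs, Eys, sin_minus; ring).
      replace (x k * x s + y k * y s) with (r0 * rs * cos (t s - t k))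
        by (rewrite Ex0, Ey0, Exs, Eys, cos_minus; ring).
      unfold tan; field; lra.
  - assert (E1 : Derive (fun s : R => x s) k = xk) by (apply is_derive_unique; exact Dx).
    assert (E2 : Derive (fun s : R => y s) k = yk) by (apply is_derive_unique; exact Dy).
    assert (X1 : ex_derive (fun s : R => x s) k) by (eexists; exact Dx).
    assert (X2 : ex_derive (fun s : R => y s) k) by (eexists; exact Dy).
    auto_derive.
    + repeat split; auto. simpl in Hn, Hn0. lra.
    + rewrite E1, E2. 
      replace (x k * y k + - (y k * x k)) with 0 by ring.
      simpl in *. field. simpl; lra.
Qed.

Lemma ivt_any (f : R -> R) (a b y : R) : a <= b ->
  (forall x, a <= x <= b -> continuous f x) -> (f a <= y <= f b \/ f b <= y <= f a) ->
  exists x, a <= x <= b /\ f x = y.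
Proof.
  intros Hab Hc Hy.
  destruct (Req_dec (f a) y) as [E|E]; [exists a; split; auto; lra|].
  destruct (Req_dec (f b) y) as [E'|E']; [exists b; split; auto; lra|].
  assert (Hlt : a < b).
  { destruct Hab as [|<-]; auto. exfalso; lra. }
  destruct Hy as [Hy|Hy].
  - destruct (Ranalysis5.IVT_interv (fun x => f x - y) a b) as [z [Hz1 Hz2]]; auto; try lra.
    + intros x Hx; apply continuity_pt_minus; [apply continuity_pt_filterlim, Hc; auto|].
      apply continuity_pt_const; intros u v; reflexivity.
    + exists z; split; auto; lra.
  - destruct (Ranalysis5.IVT_interv (fun x => y - f x) a b) as [z [Hz1 Hz2]]; auto; try lra.
    + intros x Hx; apply continuity_pt_minus; [|apply continuity_pt_filterlim, Hc; auto].
      apply continuity_pt_const; intros u v; reflexivity.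
    + exists z; split; auto; lra.
Qed.

Lemma nonzero_keeps_sign (f : R -> R) (a : R) : 0 < a -> 0 < f a ->
  (forall x, 0 < x -> continuous f x) -> (forall x, 0 < x -> f x <> 0) ->
  forall x, 0 < x -> 0 < f x.
Proof.
  intros Ha Hfa Hc Hne x Hx; destruct (Rlt_le_dec 0 (f x)) as [|Hle]; auto; exfalso.
  destruct (Rle_dec a x).
  - destruct (ivt_any f a x 0) as (z & Hz & Ez); auto; [intros; apply Hc; lra|lra|].
    apply (Hne z); auto; lra.
  - destruct (ivt_any f x a 0) as (z & Hz & Ez); auto; [lra|intros; apply Hc; lra|lra|].
    apply (Hne z); auto; lra.
Qed.

(** * A continuous phase for the data at R2 *)

Section Phase.
Variables (U V Uk Vk : R -> R -> R) (w : R).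
Hypothesis Hw : 0 < w.
Hypothesis HUaff : forall a k, U a k = U 0 k + a * (U 1 k - U 0 k).
Hypothesis HVaff : forall a k, V a k = V 0 k + a * (V 1 k - V 0 k).
Hypothesis Hwr : forall a b k, 0 < k -> U a k * V b k - V a k * U b k = (b - a) * w.
Hypothesis HUd : forall a k, 0 < k -> is_derive (U a) k (Uk a k).
Hypothesis HVd : forall a k, 0 < k -> is_derive (V a) k (Vk a k).
Hypothesis Hneg : forall a k, 0 < k -> U a k * Vk a k - V a k * Uk a k < 0.
Hypothesis HUkc : forall k, 0 < k -> continuous (Uk 0) k.
Hypothesis HVkc : forall k, 0 < k -> continuous (Vk 0) k.
Hypothesis Hsmall : forall a, 0 < a -> exists kap, 0 < kap /\
  forall k, 0 < k < kap -> 0 < U a k /\ 0 < V a k.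
Hypothesis Hsmall0 : exists kap, 0 < kap /\ forall k, 0 < k < kap -> 0 < U 0 k.
Hypothesis Hosc : forall (m : nat) K, exists k, K < k /\ 0 < k /\ (-1) ^ m * U 0 k < 0.

Lemma UV_nonzero (a k : R) : 0 < k -> 0 < U a k ^ 2 + V a k ^ 2.
Proof using Hw Hwr.
  intros Hk; assert (H := Hwr a (a + 1) k Hk).
  assert (H1 := pow2_ge_0 (U a k)). assert (H2 := pow2_ge_0 (V a k)).
  destruct (Req_dec (U a k) 0) as [E|E]; [|apply pow2_gt_0 in E; lra].
  destruct (Req_dec (V a k) 0) as [E'|E']; [|apply pow2_gt_0 in E'; lra].
  rewrite E, E' in H. exfalso; lra.
Qed.

Lemma U_continuous (a k : R) : 0 < k -> continuous (U a) k /\ continuous (V a) k.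
Proof using HUd HVd.
  intros Hk; split; [apply (ex_derive_continuous (U a))|apply (ex_derive_continuous (V a))];
    eexists; [apply HUd|apply HVd]; auto.
Qed.

(** The curve (U 0, V 0) is lifted to a polar angle by integrating its angular speed [phi] from a
    point [ks] where U 0 > 0 and the angle is an arctangent. *)
Lemma base_phase : exists theta : R -> R,
  (forall k, 0 < k -> continuous theta k) /\
  (forall k, 0 < k -> polar (U 0 k) (V 0 k) (theta k)) /\
  (exists kap, 0 < kap /\ forall k, 0 < k < kap -> - (PI / 2) < theta k < PI / 2).
Proof using Hw Hwr HUd HVd HUkc HVkc Hsmall0.
  destruct Hsmall0 as (kap & Hkap & HU0).
  set (ks := kap / 2). assert (Hks : 0 < ks < kap) by (unfold ks; lra).
  set (phi := fun k => (U 0 k * Vk 0 k - V 0 k * Uk 0 k) / (U 0 k ^ 2 + V 0 k ^ 2)).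
  set (u := U 0) in *. set (v := V 0) in *.
  assert (Hn : forall k, 0 < k -> 0 < u k ^ 2 + v k ^ 2) by (intros; apply UV_nonzero; auto).
  assert (Hcont : forall k, 0 < k -> continuous u k /\ continuous v k)
    by (intros; apply U_continuous; auto).
  assert (Hphi : forall k, 0 < k -> continuous phi k).
  { intros k Hk; destruct (Hcont k Hk) as [Cu Cv].
    assert (Hm : forall f g : R -> R, continuous f k -> continuous g k -> continuous (fun t => f t * g t) k).
    { intros f g Hf Hg; apply (continuous_mult (K := R_AbsRing) f g); auto. }
    unfold phi. apply (Hm (fun k => u k * Vk 0 k - v k * Uk 0 k)).
    - apply (continuous_minus (V := R_NormedModule) (fun k => u k * Vk 0 k) (fun k => v k * Uk 0 k)); apply Hm; auto.
    - apply (continuous_comp (fun k => u k ^ 2 + v k ^ 2) Rinv).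
      + apply (continuous_plus (V := R_NormedModule) (fun k => u k ^ 2) (fun k => v k ^ 2)).
        * apply (continuous_ext (fun k => u k * u k)); [intros; simpl; ring|apply Hm; auto].
        * apply (continuous_ext (fun k => v k * v k)); [intros; simpl; ring|apply Hm; auto].
      + apply continuous_Rinv. specialize (Hn k Hk); lra. }
  set (theta := fun k => atan (v ks / u ks) + RInt phi ks k).
  assert (Dth : forall k, 0 < k -> is_derive theta k (phi k)).
  { intros k Hk. replace (phi k) with (plus 0 (phi k)) by (unfold plus; simpl; ring).
    apply (is_derive_plus (fun _ => atan (v ks / u ks)) (fun k => RInt phi ks k)).
    - auto_derive; auto.
    - apply (is_derive_RInt phi (fun k => RInt phi ks k) ks k); [|apply Hphi; auto].
      generalize (open_gt 0 k Hk). apply filter_imp; intros y Hy.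
      apply (RInt_correct phi), ex_RInt_continuous. intros z Hz. apply Hphi.
      assert (0 < Rmin ks y) by (apply Rmin_pos; lra). lra. }
  assert (Cth : forall k, 0 < k -> continuous theta k).
  { intros k Hk; apply (ex_derive_continuous theta); eexists; apply Dth; auto. }
  set (F1 := fun k => u k * sin (theta k) - v k * cos (theta k)).
  set (F2 := fun k => u k * cos (theta k) + v k * sin (theta k)).
  (* The squared sine of the angle between (u, v) and the direction [theta]: its derivative is 0 by
     the choice of [phi], and it is 0 at [ks]. *)
  set (h := fun k => F1 k * F1 k / (u k ^ 2 + v k ^ 2)).
  assert (Dh : forall k, 0 < k -> is_derive h k 0).
  { intros k Hk. assert (A1 := HUd 0 k Hk). assert (A2 := HVd 0 k Hk). assert (A3 := Dth k Hk).
    assert (E1 : Derive (fun x : R => u x) k = Uk 0 k) by (apply is_derive_unique; exact A1).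
    assert (E2 : Derive (fun x : R => v x) k = Vk 0 k) by (apply is_derive_unique; exact A2).
    assert (E3 : Derive (fun x : R => theta x) k = phi k) by (apply is_derive_unique; exact A3).
    assert (X1 : ex_derive (fun x : R => u x) k) by (eexists; exact A1).
    assert (X2 : ex_derive (fun x : R => v x) k) by (eexists; exact A2).
    assert (X3 : ex_derive (fun x : R => theta x) k) by (eexists; exact A3).
    specialize (Hn k Hk).
    unfold h, F1; auto_derive.
    - repeat split; auto. simpl in Hn; lra.
    - rewrite E1, E2, E3; unfold phi. simpl in *. field. simpl; lra. }
  assert (Hh : forall k, 0 < k -> h k = h ks).
  { intros k Hk; destruct (Rle_dec k ks).
    - apply (closed_interval_constant h k ks); auto.
      + apply continuous_on_of_derive; intros x Hx; exists 0; apply Dh; lra.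
      + intros; apply Dh; lra.
    - symmetry; apply (closed_interval_constant h ks k); try lra.
      + apply continuous_on_of_derive; intros x Hx; exists 0; apply Dh; lra.
      + intros; apply Dh; lra. }
  assert (Hus : 0 < u ks) by (apply HU0; lra).
  assert (Eth : theta ks = atan (v ks / u ks)).
  { unfold theta; rewrite RInt_point; unfold zero; simpl; ring. }
  assert (Hcs : 0 < cos (theta ks)).
  { rewrite Eth; destruct (atan_bound (v ks / u ks)); apply cos_gt_0; lra. }
  assert (Hsn : u ks * sin (theta ks) = v ks * cos (theta ks)).
  { assert (E := tan_atan (v ks / u ks)); rewrite <- Eth in E; unfold tan in E.
    apply (Rmult_eq_reg_r (/ (u ks * cos (theta ks)))); [|apply Rinv_neq_0_compat; nra].
    transitivity (sin (theta ks) / cos (theta ks)); [field; lra|]. rewrite E; field; lra. }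
  assert (Hz1 : forall k, 0 < k -> F1 k = 0).
  { intros k Hk. assert (E : h k = 0).
    { rewrite Hh by auto. unfold h, F1; rewrite Hsn. unfold Rdiv; ring. }
    unfold h in E. specialize (Hn k Hk).
    assert (F1 k * F1 k = 0).
    { apply (Rmult_eq_reg_r (/ (u k ^ 2 + v k ^ 2))); [|apply Rinv_neq_0_compat; lra].
      unfold Rdiv in E; rewrite E; ring. }
    nra. }
  (* [F2] is the component along [theta]. As F1 = 0 it cannot vanish, so it keeps the positive sign
     it has at [ks] and serves as the radius. *)
  assert (HF2 : forall k, 0 < k -> 0 < F2 k).
  { apply (nonzero_keeps_sign F2 ks); [lra| | |].
    - unfold F2. assert (Hsc := sin2_cos2 (theta ks)); unfold Rsqr in Hsc.
      apply (Rmult_lt_reg_r (cos (theta ks))); auto. rewrite Rmult_0_l.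
      replace ((u ks * cos (theta ks) + v ks * sin (theta ks)) * cos (theta ks))
        with (u ks * (cos (theta ks) * cos (theta ks)) + sin (theta ks) * (v ks * cos (theta ks))) by ring.
      rewrite <- Hsn. replace (sin (theta ks) * (u ks * sin (theta ks))) with (u ks * (sin (theta ks) * sin (theta ks))) by ring.
      rewrite <- Rmult_plus_distr_l, Rplus_comm, Hsc. lra.
    - intros x Hx. apply (ex_derive_continuous F2).
      assert (X1 : ex_derive (fun x : R => u x) x) by (eexists; apply HUd; auto).
      assert (X2 : ex_derive (fun x : R => v x) x) by (eexists; apply HVd; auto).
      assert (X3 : ex_derive (fun x : R => theta x) x) by (eexists; apply Dth; auto).
      unfold F2; auto_derive; repeat split; auto.
    - intros x Hx E. assert (E1 := Hz1 x Hx). specialize (Hn x Hx).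
      assert (E3 : F1 x * F1 x + F2 x * F2 x = (u x ^ 2 + v x ^ 2) * (Rsqr (sin (theta x)) + Rsqr (cos (theta x))))
        by (unfold F1, F2, Rsqr; ring).
      rewrite sin2_cos2, E, E1 in E3. lra. }
  assert (Hpol : forall k, 0 < k -> polar (u k) (v k) (theta k)).
  { intros k Hk; exists (F2 k); split; auto.
    assert (Hsc := sin2_cos2 (theta k)); unfold Rsqr in Hsc.
    assert (Z := Hz1 k Hk). unfold F1 in Z. split.
    - transitivity (u k * (sin (theta k) * sin (theta k) + cos (theta k) * cos (theta k)) -
        sin (theta k) * (u k * sin (theta k) - v k * cos (theta k))); [rewrite Hsc, Z; ring|unfold F2; ring].
    - transitivity (v k * (sin (theta k) * sin (theta k) + cos (theta k) * cos (theta k)) +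
        cos (theta k) * (u k * sin (theta k) - v k * cos (theta k))); [rewrite Hsc, Z; ring|unfold F2; ring]. }
  exists theta; split; [auto|split; [auto|]].
  exists kap; split; auto. intros k Hk.
  (* Where U 0 > 0 the angle cannot cross an odd multiple of PI/2, so it stays in the interval that
     contains theta(ks). *)
  assert (Hne : forall x, 0 < x < kap -> cos (theta x) <> 0).
  { intros x Hx E; destruct (Hpol x ltac:(lra)) as (rho & _ & Eu & _).
    rewrite E, Rmult_0_r in Eu. assert (0 < u x) by (apply HU0; auto). lra. }
  assert (Hts : - (PI / 2) < theta ks < PI / 2).
  { rewrite Eth; destruct (atan_bound (v ks / u ks)); lra. }
  assert (HPI := PI_RGT_0).
  assert (Hcross : forall y, cos y = 0 -> (theta k <= y <= theta ks \/ theta ks <= y <= theta k) -> False).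
  { intros y Hy Hbt. destruct (Rle_dec k ks).
    - destruct (ivt_any theta k ks y) as (z & Hz & Ez); auto; [intros; apply Cth; lra|].
      apply (Hne z); [lra|rewrite Ez; auto].
    - destruct (ivt_any theta ks k y) as (z & Hz & Ez); try lra; [intros; apply Cth; lra|].
      apply (Hne z); [lra|rewrite Ez; auto]. }
  split; apply Rnot_le_lt; intros Hle.
  - apply (Hcross (- (PI / 2))); [rewrite cos_neg; apply cos_PI2|lra].
  - apply (Hcross (PI / 2)); [apply cos_PI2|lra].
Qed.

Lemma cos_shift_nonneg (m : nat) (x : R) : - (PI / 2) <= x + INR m * PI <= PI / 2 ->
  0 <= (-1) ^ m * cos x.
Proof.
  intros H. replace ((-1) ^ m * cos x) with (cos (x + INR m * PI)).
  - apply cos_ge_0; lra.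
  - destruct (sin_cos_nat_PI m) as [E1 E2]. rewrite cos_plus, E1, E2; ring.
Qed.

(** Theta is the base phase, plus the angle from (U 0, V 0) to (U a, V a), plus the angle from there
    to (U a, V a + b U a). The cross products are a w and b U^2; when one of them is 0 the dot
    product is positive. So neither pair is antiparallel, and both angles are continuous in k and in
    (a, b), at the corner too. *)
Lemma phase_exists : exists Theta : R -> R -> R -> R,
  (forall k a b, 0 < k -> polar (U a k) (V a k + b * U a k) (Theta k a b)) /\
  (forall k a b, 0 < k -> continuous (fun k => Theta k a b) k) /\
  (forall a b k k', 0 < k -> k < k' -> Theta k' a b < Theta k a b) /\
  (forall k (p : R * R), 0 < k -> continuous (fun p : R * R => Theta k (fst p) (snd p)) p) /\
  (forall a b M, exists k, 0 < k /\ Theta k a b < M) /\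
  (forall a b, 0 < a -> 0 < b -> exists kap, 0 < kap /\ forall k, 0 < k < kap -> 0 < Theta k a b < PI) /\
  (exists kap, 0 < kap /\ forall k, 0 < k < kap -> - (PI / 2) < Theta k 0 0 < PI / 2).
Proof using Hw HUaff HVaff Hwr HUd HVd Hneg HUkc HVkc Hsmall Hsmall0 Hosc.
  destruct base_phase as (theta & Cth & Pth & kap0 & Hkap0 & Sth).
  assert (HPI := PI_RGT_0).
  assert (N1 : forall k a, 0 < k -> U 0 k * V a k - V 0 k * U a k <> 0 \/ 0 < U 0 k * U a k + V 0 k * V a k).
  { intros k a Hk; rewrite Hwr by auto. destruct (Req_dec a 0) as [->|Ha].
    - right. assert (H := UV_nonzero 0 k Hk). simpl in H; lra.
    - left. rewrite Rminus_0_r. apply Rmult_integral_contrapositive; split; auto; lra. }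
  assert (N2 : forall k a b, 0 < k -> U a k * (V a k + b * U a k) - V a k * U a k <> 0 \/
     0 < U a k * U a k + V a k * (V a k + b * U a k)).
  { intros k a b Hk. assert (H := UV_nonzero a k Hk).
    destruct (Req_dec (b * (U a k * U a k)) 0) as [E|E]; [right|left; lra].
    apply Rmult_integral in E; destruct E as [-> |E]; [simpl in H; lra|].
    assert (U a k = 0) by nra. rewrite H0 in *. simpl in H; lra. }
  set (d1 := fun k a => angle (U 0 k) (V 0 k) (U a k) (V a k)).
  set (d2 := fun k a b => angle (U a k) (V a k) (U a k) (V a k + b * U a k)).
  set (Theta := fun k a b => theta k + d1 k a + d2 k a b).
  assert (P1 : forall k a, 0 < k -> polar (U a k) (V a k) (theta k + d1 k a)).
  { intros k a Hk; apply polar_angle; auto. }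
  assert (P2 : forall k a b, 0 < k -> polar (U a k) (V a k + b * U a k) (Theta k a b)).
  { intros k a b Hk; apply polar_angle; auto. }
  assert (Cm : forall (T : UniformSpace) (f g : T -> R) (p : T), continuous f p -> continuous g p -> continuous (fun t => f t * g t) p).
  { intros T f g p Hf Hg; apply (continuous_mult (K := R_AbsRing) f g); auto. }
  assert (Cp : forall (T : UniformSpace) (f g : T -> R) (p : T), continuous f p -> continuous g p -> continuous (fun t => f t + g t) p).
  { intros T f g p Hf Hg; apply (continuous_plus (V := R_NormedModule) f g); auto. }
  assert (Ck : forall k a b, 0 < k -> continuous (fun k => Theta k a b) k).
  { intros k a b Hk. destruct (U_continuous 0 k Hk) as [c1 c2]. destruct (U_continuous a k Hk) as [c3 c4].
    unfold Theta, d1, d2. apply (Cp _ (fun k => theta k + angle (U 0 k) (V 0 k) (U a k) (V a k))).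
    - apply (Cp _ theta); auto. apply (angle_continuous (U 0) (V 0) (U a) (V a)); auto.
    - apply (angle_continuous (U a) (V a) (U a) (fun k => V a k + b * U a k)); auto.
      apply Cp; auto. apply (Cm _ (fun _ => b)); auto. apply continuous_const. }
  assert (Dk : forall a b k k', 0 < k -> k < k' -> Theta k' a b < Theta k a b).
  { intros a b k k' Hk Hkk.
    set (D := fun k => (U a k * (Vk a k + b * Uk a k) - (V a k + b * U a k) * Uk a k)
                        / (U a k ^ 2 + (V a k + b * U a k) ^ 2)).
    apply (strictly_decreasing_of_derive (fun k => Theta k a b) D); auto.
    - intros x Hx. apply (polar_derive (U a) (fun k => V a k + b * U a k)).
      + apply Ck; lra.
      + generalize (open_gt 0 x ltac:(lra)). apply filter_imp; intros y Hy; apply P2; auto.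
      + apply HUd; lra.
      + apply (is_derive_plus (V a) (fun k => b * U a k)); [apply HVd; lra|].
        apply is_derive_scal, HUd; lra.
    - intros x Hx; unfold D. destruct (P2 x a b ltac:(lra)) as (rho & Hrho & E1 & E2).
      assert (Hn : 0 < U a x ^ 2 + (V a x + b * U a x) ^ 2).
      { assert (H := UV_nonzero a x ltac:(lra)). assert (H1 := pow2_ge_0 (V a x + b * U a x)).
        destruct (Req_dec (U a x) 0) as [E|E]; [rewrite E in *; simpl in *; lra|].
        apply pow2_gt_0 in E; lra. }
      assert (H := Hneg a x ltac:(lra)).
      apply (Rmult_lt_reg_r (U a x ^ 2 + (V a x + b * U a x) ^ 2)); auto.
      unfold Rdiv; rewrite Rmult_assoc, Rinv_l by lra. lra. }
  assert (Bd : forall k a b, Theta k a b < theta k + 2 * PI).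
  { intros k a b; unfold Theta, d1, d2.
    assert (H1 := angle_bound (U 0 k) (V 0 k) (U a k) (V a k)).
    assert (H2 := angle_bound (U a k) (V a k) (U a k) (V a k + b * U a k)). lra. }
  assert (T00 : forall k, Theta k 0 0 = theta k).
  { intros k; unfold Theta, d1, d2. replace (V 0 k + 0 * U 0 k) with (V 0 k) by ring.
    rewrite !angle_self; ring. }
  exists Theta; split; [exact P2|split; [exact Ck|split; [exact Dk|split; [|split; [|split]]]]].
  - intros k [a b] Hk; unfold Theta, d1, d2; simpl fst; simpl snd.
    assert (CU : continuous (fun p : R * R => U (fst p) k) (a, b)).
    { apply (continuous_ext (fun p : R * R => U 0 k + fst p * (U 1 k - U 0 k))); [intros; symmetry; apply HUaff|].
      apply (Cp _ (fun _ => U 0 k)); [apply continuous_const|].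
      apply (Cm _ (fun p : R * R => fst p)); [apply continuous_fst|apply continuous_const]. }
    assert (CV : continuous (fun p : R * R => V (fst p) k) (a, b)).
    { apply (continuous_ext (fun p : R * R => V 0 k + fst p * (V 1 k - V 0 k))); [intros; symmetry; apply HVaff|].
      apply (Cp _ (fun _ => V 0 k)); [apply continuous_const|].
      apply (Cm _ (fun p : R * R => fst p)); [apply continuous_fst|apply continuous_const]. }
    apply (Cp _ (fun p : R * R => theta k + angle (U 0 k) (V 0 k) (U (fst p) k) (V (fst p) k))).
    + apply (Cp _ (fun _ => theta k)); [apply continuous_const|].
      apply (angle_continuous (fun _ => U 0 k) (fun _ => V 0 k)
        (fun p : R * R => U (fst p) k) (fun p : R * R => V (fst p) k)); simpl; auto; apply continuous_const.
    + apply (angle_continuous (fun p : R * R => U (fst p) k) (fun p : R * R => V (fst p) k)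
        (fun p : R * R => U (fst p) k) (fun p : R * R => V (fst p) k + snd p * U (fst p) k)); simpl; auto.
      apply Cp; auto. apply (Cm _ (fun p : R * R => snd p)); [apply continuous_snd|auto].
  - intros a b M.
    assert (Hth : forall m : nat, exists k, 0 < k /\ theta k < PI / 2 - INR m * PI).
    { induction m as [|m (k0 & Hk0 & IH)].
      - exists (kap0 / 2); split; [lra|]. specialize (Sth (kap0 / 2) ltac:(lra)). simpl; lra.
      (* The phase decreases, and the sign of U 0 at k rules out the strip of width PI where (-1)^m
         cos is nonnegative; so the phase has passed below it. *)
      - destruct (Hosc m k0) as (k & Hk & Hk' & Hs). exists k; split; auto.
        apply Rnot_le_lt; intros Hle. rewrite S_INR in Hle.
        assert (Hd := Dk 0 0 k0 k Hk0 Hk). rewrite !T00 in Hd.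
        assert (Hc : 0 <= (-1) ^ m * cos (theta k)) by (apply cos_shift_nonneg; lra).
        destruct (Pth k Hk') as (rho & Hrho & E & _). rewrite E in Hs.
        replace ((-1) ^ m * (rho * cos (theta k))) with (rho * ((-1) ^ m * cos (theta k))) in Hs by ring.
        assert (0 <= rho * ((-1) ^ m * cos (theta k))) by (apply Rmult_le_pos; lra). lra. }
    destruct (nfloor_ex (Rabs (3 * PI - M)) (Rabs_pos _)) as [N [_ HN]].
    destruct (Hth (S N)) as (k & Hk & Hlt). exists k; split; auto.
    assert (Hb := Bd k a b). rewrite S_INR in Hlt.
    assert (HN1 : 3 * PI - M < INR N + 1) by (eapply Rle_lt_trans; [apply Rle_abs|exact HN]).
    assert (HP3 : 1 <= PI) by (assert (H := PI2_1); lra).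
    assert (0 <= INR N) by apply pos_INR. nra.
  - intros a b Ha Hb; destruct (Hsmall a Ha) as (kap & Hkap & HUV).
    exists (Rmin kap0 kap); split; [apply Rmin_pos; auto|]. intros k [Hk Hkk].
    assert (k < kap0) by (eapply Rlt_le_trans; [exact Hkk|apply Rmin_l]).
    assert (k < kap) by (eapply Rlt_le_trans; [exact Hkk|apply Rmin_r]).
    destruct (HUV k ltac:(lra)) as [HU HV].
    specialize (Sth k ltac:(lra)).
    assert (B1 := angle_bound (U 0 k) (V 0 k) (U a k) (V a k)). fold (d1 k a) in B1.
    assert (B2 := angle_bound (U a k) (V a k) (U a k) (V a k + b * U a k)). fold (d2 k a b) in B2.
    assert (B3 : 0 <= d1 k a).
    { apply angle_nonneg; auto. rewrite Hwr by auto. apply Rmult_le_pos; lra. }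
    assert (B4 : 0 <= d2 k a b).
    { apply angle_nonneg; auto.
      replace (U a k * (V a k + b * U a k) - V a k * U a k) with (b * (U a k * U a k)) by ring.
      apply Rmult_le_pos; [lra|apply Rle_0_sqr]. }
    (* Adding a nonnegative angle below PI cannot take the phase past PI/2, for U stays positive;
       with V + b U > 0 the phase then lies in (0, PI/2). *)
    assert (Hcos : forall t x y, polar x y t -> 0 < x -> - (PI / 2) < t < 3 * (PI / 2) -> t < PI / 2).
    { intros t x y (rho & Hrho & E & _) Hx Ht. apply Rnot_le_lt; intros Hle.
      assert (cos t <= 0) by (apply cos_le_0; lra). nra. }
    assert (Q1 : theta k + d1 k a < PI / 2) by (apply (Hcos _ _ _ (P1 k a Hk) HU); lra).
    assert (Q2 : Theta k a b < PI / 2) by (apply (Hcos _ _ _ (P2 k a b Hk) HU); unfold Theta; lra).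
    split; [|lra].
    apply Rnot_le_lt; intros Hle.
    destruct (P2 k a b Hk) as (rho & Hrho & _ & E).
    assert (0 < V a k + b * U a k) by nra.
    assert (sin (Theta k a b) <= 0).
    { destruct (Req_dec (Theta k a b) 0) as [Z|Z]; [rewrite Z, sin_0; lra|].
      left; apply sin_lt_0_var; unfold Theta in *; lra. }
    nra.
  - exists kap0; split; auto. intros k Hk; rewrite T00; auto.
Qed.

End Phase.

(** * Roots and branches *)

Lemma derive_of_slope (k psi : R -> R) (a0 : R) : continuous psi a0 ->
  locally a0 (fun a => k a - k a0 = (a - a0) * psi a) -> is_derive k a0 (psi a0).
Proof.
  intros Hc [d1 Hd1]; apply is_derive_Reals; intros eps Heps.
  destruct (Hc (fun y => Rabs (y - psi a0) < eps)) as [d2 Hd2].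
  { exists (mkposreal _ Heps); intros y Hy; exact Hy. }
  exists (mkposreal _ (Rmin_stable_in_posreal d1 d2)); intros h Hh Hlt; simpl in Hlt.
  assert (B : forall d : posreal, Rabs h < d -> ball a0 d (a0 + h)).
  { intros d Hd; unfold ball; simpl; unfold AbsRing_ball, abs, minus, plus, opp; simpl.
    replace (a0 + h + - a0) with h by ring; exact Hd. }
  assert (E := Hd1 (a0 + h) (B d1 (Rlt_le_trans _ _ _ Hlt (Rmin_l _ _)))). cbv beta in E.
  assert (L := Hd2 (a0 + h) (B d2 (Rlt_le_trans _ _ _ Hlt (Rmin_r _ _)))). cbv beta in L.
  rewrite E. replace ((a0 + h - a0) * psi (a0 + h) / h) with (psi (a0 + h)) by (field; auto). exact L.
Qed.

(** Carathéodory's form of the derivative: a slope function, continuous at the point, that factors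
    the increment. It can be composed with a function known only to be continuous. *)
Lemma slope_of_derive (G : R -> R) (x0 m : R) : is_derive G x0 m ->
  exists phi, continuous phi x0 /\ phi x0 = m /\ forall x, G x - G x0 = phi x * (x - x0).
Proof.
  intros HG; exists (fun x => if Req_EM_T x x0 then m else (G x - G x0) / (x - x0)).
  split; [|split].
  - apply is_derive_Reals in HG.
    intros P [eps HP]. destruct (Req_EM_T x0 x0) as [_|]; [|tauto].
    destruct (HG eps (cond_pos eps)) as [d Hd].
    exists d; intros y Hy; apply HP. destruct (Req_EM_T y x0) as [E|E]; [apply ball_center|].
    unfold ball in *; simpl in *; unfold AbsRing_ball, abs, minus, plus, opp in *; simpl in *.
    specialize (Hd (y - x0) ltac:(lra) Hy).
    replace (x0 + (y - x0)) with y in Hd by ring. exact Hd.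
  - destruct (Req_EM_T x0 x0); tauto.
  - intros x; destruct (Req_EM_T x x0) as [-> |E]; [ring|field; lra].
Qed.

(** If phi is the slope of G = P + a0 Q, the equation at a reads phi(k a) (k a - k a0) = - (a - a0)
    Q(k a); dividing by phi gives a slope for k, so differentiability of the root follows from its
    continuity. *)
Lemma implicit_derive (P Q k : R -> R) (a0 P' Q' : R) : continuous k a0 ->
  is_derive P (k a0) P' -> is_derive Q (k a0) Q' -> P' + a0 * Q' <> 0 ->
  locally a0 (fun a => P (k a) + a * Q (k a) = 0) ->
  is_derive k a0 (- Q (k a0) / (P' + a0 * Q')).
Proof.
  intros Hk HP HQ Hm Hloc.
  set (k0 := k a0) in *. set (m := P' + a0 * Q') in *.
  set (G := fun x => P x + a0 * Q x).
  assert (HG : is_derive G k0 m).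
  { apply (is_derive_plus P (fun x => a0 * Q x)); auto. apply is_derive_scal; auto. }
  destruct (slope_of_derive G k0 m HG) as (phi & Hphi & Ephi & Hsl).
  assert (HG0 : G k0 = 0) by (apply (locally_singleton _ _ Hloc)).
  assert (Cphi : continuous (fun a => phi (k a)) a0) by (apply (continuous_comp k phi); auto).
  set (psi := fun a => - Q (k a) * / phi (k a)).
  replace (- Q k0 / m) with (psi a0) by (unfold psi, Rdiv; fold k0; rewrite Ephi; auto).
  apply derive_of_slope.
  - apply (continuous_mult (K := R_AbsRing) (fun a => - Q (k a)) (fun a => / phi (k a))).
    + apply (continuous_opp (V := R_NormedModule) (fun a => Q (k a))).
      apply (continuous_comp k Q); auto. apply (ex_derive_continuous Q). eexists; exact HQ.
    + apply (continuous_comp (fun a => phi (k a)) Rinv); auto. apply continuous_Rinv.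
      fold k0; rewrite Ephi; auto.
  - assert (Hnz : locally a0 (fun a => phi (k a) <> 0)).
    { apply (Cphi (fun y => y <> 0)). apply open_neq. fold k0; rewrite Ephi; auto. }
    generalize (filter_and _ _ Hnz Hloc); apply filter_imp. intros a [Hn Ha].
    specialize (Hsl (k a)). rewrite HG0 in Hsl. unfold G in Hsl.
    change (k a - k0 = (a - a0) * psi a). unfold psi.
    apply (Rmult_eq_reg_l (phi (k a))); auto.
    transitivity (- (a - a0) * Q (k a)); [|field; auto].
    transitivity (P (k a) + a0 * Q (k a) - 0); [rewrite Hsl; ring|].
    rewrite <- Ha at 1. ring.
Qed.

Section Roots.
Variables (F : R -> R -> R -> R) (Theta : R -> R -> R -> R).
Hypothesis HF : forall k a b, 0 < k -> (F k a b = 0 <-> sin (Theta k a b) = 0).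
Hypothesis Hc : forall k a b, 0 < k -> continuous (fun k => Theta k a b) k.
Hypothesis Hd : forall a b k k', 0 < k -> k < k' -> Theta k' a b < Theta k a b.
Hypothesis Hab : forall k (p : R * R), 0 < k -> continuous (fun p : R * R => Theta k (fst p) (snd p)) p.
Hypothesis Hinf : forall a b M, exists k, 0 < k /\ Theta k a b < M.

Lemma phase_value (a b y : R) : (exists k, 0 < k /\ y < Theta k a b) ->
  exists k, 0 < k /\ Theta k a b = y.
Proof using Hc Hd Hinf.
  intros (k1 & Hk1 & H1). destruct (Hinf a b y) as (k2 & Hk2 & H2).
  assert (Hlt : k1 < k2).
  { apply Rnot_le_lt; intros [Hle|Hle]; [|subst; lra].
    assert (H := Hd a b k2 k1 Hk2 Hle). lra. }
  destruct (ivt_any (fun k => Theta k a b) k1 k2 y) as (z & Hz & E); try lra.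
  - intros x Hx; apply Hc; lra.
  - exists z; split; auto; lra.
Qed.

Lemma phase_order (a b k k' : R) : 0 < k -> 0 < k' -> Theta k' a b < Theta k a b -> k < k'.
Proof using Hd.
  intros Hk Hk' H; apply Rnot_le_lt; intros [Hle|Hle]; [|subst; lra].
  assert (H1 := Hd a b k' k Hk' Hle). lra.
Qed.

Lemma phase_inj (a b k k' : R) : 0 < k -> 0 < k' -> Theta k a b = Theta k' a b -> k = k'.
Proof using Hd.
  intros Hk Hk' H. destruct (Rtotal_order k k') as [Hlt|[Heq|Hlt]]; auto; exfalso.
  - assert (H1 := Hd a b k k' Hk Hlt). lra.
  - assert (H1 := Hd a b k' k Hk' Hlt). lra.
Qed.

(** The zeros of the sine are the multiples of PI; the positive ones are excluded by Theta < PI, and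
    injectivity in k leaves one root for each p. *)
Lemma root_iff (a b : R) (K : nat -> R) : (forall k, 0 < k -> Theta k a b < PI) ->
  (forall p, 0 < K p /\ Theta (K p) a b = - INR p * PI) ->
  forall x, 0 < x -> (F x a b = 0 <-> exists p, x = K p).
Proof using HF Hd.
  intros Hpi HK x Hx; rewrite HF by auto; split.
  - intros Hs; destruct (sin_eq_0_0 _ Hs) as [z Hz].
    assert (HPI := PI_RGT_0). assert (H := Hpi x Hx). rewrite Hz in H.
    assert (Hz0 : (z <= 0)%Z).
    { assert (IZR z < 1) by nra. apply lt_IZR in H0. lia. }
    exists (Z.to_nat (- z)). apply (phase_inj a b); auto; [apply HK|].
    rewrite Hz. destruct (HK (Z.to_nat (- z))) as [_ ->].
    rewrite INR_IZR_INZ, Z2Nat.id, opp_IZR by lia. ring.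
  - intros [p ->]. destruct (HK p) as [_ ->].
    replace (- INR p * PI) with (- (INR p * PI)) by ring. rewrite sin_neg.
    destruct (sin_cos_nat_PI p) as [-> _]. ring.
Qed.

(** At c - eps and c + eps the phase lies strictly on either side of the level, and this persists
    for nearby (a, b); monotonicity in k then traps the root. The point c is described by its
    position rather than by Theta c = y, so that c = 0 is allowed: there positivity of the root
    replaces the lower barrier. *)
Lemma phase_trap (a0 b0 c y : R) (K : R -> R -> R) :
  (forall a b, 0 < a -> 0 < b -> 0 < K a b /\ Theta (K a b) a b = y) ->
  (forall x, 0 < x -> (x < c -> y < Theta x a0 b0) /\ (c < x -> Theta x a0 b0 < y)) ->
  0 <= c -> forall eps, 0 < eps -> exists del, 0 < del /\
  forall a b, 0 < a -> 0 < b -> Rabs (a - a0) < del -> Rabs (b - b0) < del -> Rabs (K a b - c) < eps.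
Proof using Hd Hab.
  intros HK Hx Hc0 eps Heps.
  assert (Hcont : forall x, 0 < x -> Theta x a0 b0 <> y -> exists del, 0 < del /\
    forall a b, Rabs (a - a0) < del -> Rabs (b - b0) < del ->
      (Theta x a0 b0 < y -> Theta x a b < y) /\ (y < Theta x a0 b0 -> y < Theta x a b)).
  { intros x Hx0 Hne.
    assert (Hp : 0 < Rabs (Theta x a0 b0 - y)) by (apply Rabs_pos_lt; lra).
    destruct (Hab x (a0, b0) Hx0 (fun z => Rabs (z - Theta x a0 b0) < Rabs (Theta x a0 b0 - y))) as [d H].
    { exists (mkposreal _ Hp); intros z Hz; exact Hz. }
    exists d; split; [apply cond_pos|]. intros a b Ha Hb.
    specialize (H (a, b) (conj Ha Hb)). simpl in H. apply Rabs_def2 in H.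
    split; intros Hs.
    - rewrite (Rabs_left (Theta x a0 b0 - y)) in H by lra. lra.
    - rewrite (Rabs_right (Theta x a0 b0 - y)) in H by lra. lra. }
  assert (Hup : 0 < c + eps) by lra.
  destruct (Hx (c + eps) Hup) as [_ Hu]. specialize (Hu ltac:(lra)).
  destruct (Hcont (c + eps) Hup ltac:(lra)) as (d1 & Hd1 & Hd1').
  assert (Hlow : exists d2, 0 < d2 /\ forall a b, 0 < a -> 0 < b ->
     Rabs (a - a0) < d2 -> Rabs (b - b0) < d2 -> c - eps < K a b).
  { destruct (Rlt_le_dec 0 (c - eps)) as [Hce|Hce].
    - destruct (Hx (c - eps) Hce) as [Hl _]. specialize (Hl ltac:(lra)).
      destruct (Hcont (c - eps) Hce ltac:(lra)) as (d2 & Hd2 & Hd2').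
      exists d2; split; auto. intros a b Ha Hb Da Db.
      destruct (HK a b Ha Hb) as [HK1 HK2].
      apply (phase_order a b); auto. rewrite HK2. apply (Hd2' a b); auto.
    - exists 1; split; [lra|]. intros a b Ha Hb _ _. destruct (HK a b Ha Hb); lra. }
  destruct Hlow as (d2 & Hd2 & Hd2').
  exists (Rmin d1 d2); split; [apply Rmin_pos; auto|].
  intros a b Ha Hb Da Db.
  assert (M1 := Rmin_l d1 d2). assert (M2 := Rmin_r d1 d2).
  specialize (Hd2' a b Ha Hb ltac:(lra) ltac:(lra)).
  destruct (HK a b Ha Hb) as [HK1 HK2].
  assert (K a b < c + eps).
  { apply (phase_order a b); auto. rewrite HK2. apply (Hd1' a b); lra. }
  apply Rabs_def1; lra.
Qed.

Hypothesis Hpos : forall a b, 0 < a -> 0 < b ->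
  exists kap, 0 < kap /\ forall k, 0 < k < kap -> 0 < Theta k a b < PI.

Lemma phase_lt_PI (a b M : R) : (exists kap, 0 < kap /\ forall k, 0 < k < kap -> Theta k a b < M) ->
  forall k, 0 < k -> Theta k a b < M.
Proof using Hd.
  intros (kap & Hkap & H) k Hk. set (x := Rmin (kap / 2) (k / 2)).
  assert (0 < x) by (unfold x; apply Rmin_pos; lra).
  assert (M1 := Rmin_l (kap / 2) (k / 2)). assert (M2 := Rmin_r (kap / 2) (k / 2)). fold x in M1, M2.
  assert (H1 := Hd a b x k ltac:(lra) ltac:(lra)). specialize (H x ltac:(lra)). lra.
Qed.

Lemma roots_exist : exists K : nat -> R -> R -> R, forall a b, 0 < a -> 0 < b ->
  forall p, 0 < K p a b /\ Theta (K p a b) a b = - INR p * PI.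
Proof using Hc Hd Hinf Hpos.
  assert (H : forall z : nat * (R * R), exists k, 0 < fst (snd z) -> 0 < snd (snd z) ->
    0 < k /\ Theta k (fst (snd z)) (snd (snd z)) = - INR (fst z) * PI).
  { intros (p & a & b); simpl. destruct (Rlt_dec 0 a) as [Ha|Ha]; [|exists 0; tauto].
    destruct (Rlt_dec 0 b) as [Hb|Hb]; [|exists 0; tauto].
    destruct (phase_value a b (- INR p * PI)) as (k & Hk).
    - destruct (Hpos a b Ha Hb) as (kap & Hkap & Hk). exists (kap / 2); split; [lra|].
      specialize (Hk (kap / 2) ltac:(lra)). assert (HPI := PI_RGT_0). assert (Hp := pos_INR p). nra.
    - exists k; auto. }
  apply functional_choice in H. destruct H as [f Hf].
  exists (fun p a b => f (p, (a, b))). intros a b Ha Hb p. apply (Hf (p, (a, b))); auto.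
Qed.

Lemma roots_increasing (a b : R) (K : nat -> R) :
  (forall p, 0 < K p /\ Theta (K p) a b = - INR p * PI) -> forall p, K p < K (S p).
Proof using Hd.
  intros HK p. destruct (HK p) as [H1 H2]. destruct (HK (S p)) as [H3 H4].
  apply (phase_order a b); auto. rewrite H2, H4, S_INR. assert (HPI := PI_RGT_0). lra.
Qed.

Lemma roots_unbounded (a b : R) (K : nat -> R) :
  (forall p, 0 < K p /\ Theta (K p) a b = - INR p * PI) -> is_lim_seq K p_infty.
Proof using Hd.
  intros HK; apply is_lim_seq_spec; intros M.
  set (x := Rmax M 1). assert (Hx : 0 < x) by (unfold x; assert (H := Rmax_r M 1); lra).
  destruct (nfloor_ex (Rabs (Theta x a b)) (Rabs_pos _)) as [N [_ HN]].
  exists (S N); intros p Hp. apply Rle_lt_trans with x; [apply Rmax_l|].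
  destruct (HK p) as [H1 H2]. apply (phase_order a b); auto. rewrite H2.
  assert (HPI : 1 <= PI) by (assert (H := PI2_1); lra).
  apply le_INR in Hp; rewrite S_INR in Hp. assert (H3 := Rabs_maj2 (Theta x a b)).
  assert (H4 := pos_INR p). assert (INR p * 1 <= INR p * PI) by (apply Rmult_le_compat_l; lra). lra.
Qed.

Hypothesis Hcorner : exists kap, 0 < kap /\ forall k, 0 < k < kap -> - (PI / 2) < Theta k 0 0 < PI / 2.

(** If the phase starts above 0, [kN p] solves Theta = - p PI. Otherwise it is below 0 for every k >
    0, and the missing root at level 0 is replaced by the value 0; the others are shifted by one
    index, so that [kN p] still belongs to the level - p PI of the branch with the same index. *)
Lemma neumann_roots (positive : Prop) :
  (positive -> exists kap, 0 < kap /\ forall k, 0 < k < kap -> 0 < Theta k 0 0) ->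
  (~ positive -> exists kap, 0 < kap /\ forall k, 0 < k < kap -> Theta k 0 0 < 0) ->
  exists kN : nat -> R, 0 <= kN 0%nat /\ (forall p, kN p < kN (S p)) /\
    (forall p x, 0 < x -> (x < kN p -> - INR p * PI < Theta x 0 0) /\ (kN p < x -> Theta x 0 0 < - INR p * PI)) /\
    (forall x, 0 < x -> (F x 0 0 = 0 <-> exists p, x = kN p)) /\
    (positive -> 0 < kN 0%nat) /\ (~ positive -> kN 0%nat = 0).
Proof using HF Hc Hd Hinf Hcorner.
  intros H1 H2. assert (HPI := PI_RGT_0).
  destruct (classic positive) as [HP|HP].
  - specialize (H1 HP).
    assert (Hv : forall p, exists k, 0 < k /\ Theta k 0 0 = - INR p * PI).
    { intros p; apply phase_value. destruct H1 as (kap & Hkap & H1). exists (kap / 2); split; [lra|].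
      specialize (H1 (kap / 2) ltac:(lra)). assert (Hp := pos_INR p). nra. }
    apply functional_choice in Hv; destruct Hv as [K HK].
    exists K; split; [left; apply HK|split; [apply (roots_increasing 0 0 K HK)|split; [|split; [|split; [|tauto]]]]].
    + intros p x Hx; destruct (HK p) as [A <-]; split; intros Hlt; apply Hd; auto.
    + apply root_iff; auto. apply phase_lt_PI.
      destruct Hcorner as (kap & Hkap & H). exists kap; split; auto. intros k Hk; specialize (H k Hk); lra.
    + intros _; apply HK.
  - specialize (H2 HP).
    assert (Hv : forall p, exists k, 0 < k /\ Theta k 0 0 = - INR (S p) * PI).
    { intros p; apply phase_value. destruct Hcorner as (kap & Hkap & H). exists (kap / 2); split; [lra|].
      specialize (H (kap / 2) ltac:(lra)). assert (Hp := pos_INR p). rewrite S_INR. nra. }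
    apply functional_choice in Hv; destruct Hv as [K HK].
    assert (Hn0 := phase_lt_PI 0 0 0 H2).
    exists (fun p => match p with O => 0 | S p => K p end).
    split; [lra|split; [|split; [|split; [|split; [tauto|auto]]]]].
    + intros [|p]; [apply HK|]. destruct (HK p) as [A1 A2]. destruct (HK (S p)) as [B1 B2].
      apply (phase_order 0 0); auto. rewrite A2, B2, (S_INR (S p)). lra.
    + intros [|p] x Hx.
      * split; intros Hlt; [lra|]. simpl. specialize (Hn0 x Hx). lra.
      * destruct (HK p) as [A <-]; split; intros Hlt; apply Hd; auto.
    + intros x Hx; rewrite HF by auto; split.
      * intros Hs; destruct (sin_eq_0_0 _ Hs) as [z Hz].
        assert (H := Hn0 x Hx). rewrite Hz in H.
        assert (Hz0 : (z <= -1)%Z).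
        { assert (IZR z < 0) by nra. apply lt_IZR in H0. lia. }
        exists (S (Z.to_nat (- z - 1))). apply (phase_inj 0 0); auto; [apply HK|].
        rewrite Hz. destruct (HK (Z.to_nat (- z - 1))) as [_ ->].
        rewrite S_INR, INR_IZR_INZ, Z2Nat.id, minus_IZR, opp_IZR by lia. ring.
      * intros [[|p] ->]; [lra|]. destruct (HK p) as [_ ->].
        replace (- INR (S p) * PI) with (- (INR (S p) * PI)) by ring. rewrite sin_neg.
        destruct (sin_cos_nat_PI (S p)) as [-> _]. ring.
Qed.

End Roots.

(** * Limits at the Neumann corner and continuous branches *)

Lemma corner_limit_intro (g : R -> R -> R) (c : R) :
  (forall eps, 0 < eps -> exists del, 0 < del /\
    forall a b, 0 < a -> 0 < b -> Rabs (a - 0) < del -> Rabs (b - 0) < del -> Rabs (g a b - c) < eps) ->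
  tends_at_corner g c.
Proof.
  intros H P [eps HP]. destruct (H eps (cond_pos eps)) as (del & Hdel & Hg).
  exists (mkposreal _ Hdel). intros [a b] [Ha Hb] [Qa Qb]; simpl in *. apply HP, Hg; auto.
Qed.

Lemma corner_limit_unique (g : R -> R -> R) (x y : R) :
  tends_at_corner g x -> tends_at_corner g y -> x = y.
Proof.
  intros Hx Hy. destruct (Req_dec x y) as [|Hne]; auto; exfalso.
  assert (Hp : 0 < Rabs (x - y) / 2) by (assert (H := Rabs_pos_lt (x - y) ltac:(lra)); lra).
  destruct (Hx (fun z => Rabs (z - x) < Rabs (x - y) / 2)) as [d1 H1].
  { exists (mkposreal _ Hp); intros z Hz; exact Hz. }
  destruct (Hy (fun z => Rabs (z - y) < Rabs (x - y) / 2)) as [d2 H2].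
  { exists (mkposreal _ Hp); intros z Hz; exact Hz. }
  set (t := Rmin d1 d2 / 2).
  assert (D1 := cond_pos d1). assert (D2 := cond_pos d2).
  assert (M1 := Rmin_l d1 d2). assert (M2 := Rmin_r d1 d2).
  assert (Ht : 0 < t) by (unfold t; assert (H := Rmin_pos d1 d2 D1 D2); lra).
  assert (B : forall d : posreal, Rmin d1 d2 <= d -> ball ((0, 0) : R * R) d (t, t)).
  { intros d Hd. assert (X : Rabs (t + - 0) < d).
    { rewrite Ropp_0, Rplus_0_r, Rabs_pos_eq by lra. apply Rlt_le_trans with (Rmin d1 d2); auto.
      unfold t in *; lra. }
    split; exact X. }
  specialize (H1 (t, t) (B d1 M1) (conj Ht Ht)). specialize (H2 (t, t) (B d2 M2) (conj Ht Ht)).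
  simpl in H1, H2.
  assert (H3 := Rabs_triang (x - g t t) (g t t - y)).
  replace (x - g t t + (g t t - y)) with (x - y) in H3 by ring.
  rewrite (Rabs_minus_sym x (g t t)) in H3. lra.
Qed.

Lemma corner_limit_ext (f g : R -> R -> R) (x : R) :
  (forall a b, 0 < a -> 0 < b -> f a b = g a b) -> tends_at_corner f x -> tends_at_corner g x.
Proof.
  intros E; apply filterlim_within_ext. intros [a b] [Ha Hb]; apply E; auto.
Qed.

(** At each point g takes one of the strictly ordered values K p, so along the segment from (1, 1)
    it never meets a midpoint between consecutive roots; its index is therefore the same
    everywhere. *)
Lemma branch_is_root (K : nat -> R -> R -> R) (g : R -> R -> R) :
  (forall a b, 0 < a -> 0 < b -> forall p, K p a b < K (S p) a b) ->
  (forall p, continuous_on quadrant (fun z : R * R => K p (fst z) (snd z))) ->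
  continuous_on quadrant (fun z : R * R => g (fst z) (snd z)) ->
  (forall a b, 0 < a -> 0 < b -> exists p, g a b = K p a b) ->
  exists p, forall a b, 0 < a -> 0 < b -> g a b = K p a b.
Proof.
  intros Hinc HK Hg Hroot.
  destruct (Hroot 1 1 Rlt_0_1 Rlt_0_1) as [p Hp]. exists p. intros a b Ha Hb.
  destruct (Hroot a b Ha Hb) as [q Hq].
  enough (p = q) by (subst; auto).
  assert (Hquad : forall z, quadrant z -> locally z quadrant).
  { intros [x y] [Hx Hy]; simpl in Hx, Hy.
    exists (mkposreal _ (Rmin_pos _ _ Hx Hy)). intros [x' y'] [Bx By].
    unfold ball in *; simpl in *; unfold AbsRing_ball, abs, minus, plus, opp in *; simpl in *.
    assert (M1 := Rmin_l x y). assert (M2 := Rmin_r x y).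
    apply Rabs_def2 in Bx; apply Rabs_def2 in By. split; simpl; lra. }
  set (path := fun s : R => (1 + s * (a - 1), 1 + s * (b - 1))).
  assert (Hpath : forall s, 0 <= s <= 1 -> quadrant (path s)).
  { intros s Hs; split; simpl; nra. }
  assert (Cpath : forall s, continuous path s).
  { intros s. assert (C : forall c : R, continuous (fun s : R => 1 + s * c) s).
    { intros c; apply (ex_derive_continuous (fun s : R => 1 + s * c)); auto_derive; auto. }
    intros P [eps HP]. destruct (C (a - 1) (ball (1 + s * (a - 1)) eps)) as [d1 H1].
    { exists eps; auto. }
    destruct (C (b - 1) (ball (1 + s * (b - 1)) eps)) as [d2 H2].
    { exists eps; auto. }
    exists (mkposreal _ (Rmin_stable_in_posreal d1 d2)). intros y Hy. apply HP; split; simpl.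
    - apply H1. eapply ball_le; [|exact Hy]. simpl; apply Rmin_l.
    - apply H2. eapply ball_le; [|exact Hy]. simpl; apply Rmin_r. }
  assert (Ccomp : forall h : R -> R -> R, continuous_on quadrant (fun z : R * R => h (fst z) (snd z)) ->
    forall s, 0 <= s <= 1 -> continuous (fun s => h (fst (path s)) (snd (path s))) s).
  { intros h Hh s Hs. apply (continuous_comp path (fun z : R * R => h (fst z) (snd z))); auto.
    apply (continuous_continuous_on quadrant); auto. }
  assert (Hmono : forall x y, 0 < x -> 0 < y -> forall i j, (i <= j)%nat -> K i x y <= K j x y).
  { intros x y Hx Hy i j Hij; induction Hij as [|j Hij IH]; [lra|].
    specialize (Hinc x y Hx Hy j). lra. }
  (* Signed distance from g to the midpoint of the roots m and m + 1: never 0, and negative exactly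
     when the index of g is at most m. *)
  set (D := fun m s => g (fst (path s)) (snd (path s)) -
     / 2 * (K m (fst (path s)) (snd (path s)) + K (S m) (fst (path s)) (snd (path s)))).
  assert (CD : forall m s, 0 <= s <= 1 -> continuous (D m) s).
  { intros m s Hs; unfold D.
    apply (continuous_minus (V := R_NormedModule) (fun s => g (fst (path s)) (snd (path s)))
      (fun s => / 2 * (K m (fst (path s)) (snd (path s)) + K (S m) (fst (path s)) (snd (path s))))).
    - apply (Ccomp g); auto.
    - apply (continuous_scal_r (V := R_NormedModule) (/ 2)).
      apply (continuous_plus (V := R_NormedModule) (fun s => K m (fst (path s)) (snd (path s)))
        (fun s => K (S m) (fst (path s)) (snd (path s)))); [apply (Ccomp (K m))|apply (Ccomp (K (S m)))]; auto. }
  assert (Dsign : forall m s i, 0 <= s <= 1 -> g (fst (path s)) (snd (path s)) = K i (fst (path s)) (snd (path s)) ->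
    ((i <= m)%nat -> D m s < 0) /\ ((m < i)%nat -> 0 < D m s)).
  { intros m s i Hs Hi. destruct (Hpath s Hs) as [Q1 Q2].
    assert (I := Hinc _ _ Q1 Q2 m). unfold D; rewrite Hi. split; intros Hm.
    - assert (M := Hmono _ _ Q1 Q2 i m Hm). lra.
    - assert (M := Hmono _ _ Q1 Q2 (S m) i Hm). lra. }
  assert (Dnz : forall m s, 0 <= s <= 1 -> D m s <> 0).
  { intros m s Hs. destruct (Hpath s Hs) as [Q1 Q2]. destruct (Hroot _ _ Q1 Q2) as [i Hi].
    destruct (Dsign m s i Hs Hi) as [S1 S2]. destruct (Nat.le_gt_cases i m) as [Hm|Hm].
    - specialize (S1 Hm); lra.
    - specialize (S2 Hm); lra. }
  assert (P0 : path 0 = (1, 1)) by (unfold path; f_equal; ring).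
  assert (P1 : path 1 = (a, b)) by (unfold path; f_equal; ring).
  assert (S0 : forall m, ((p <= m)%nat -> D m 0 < 0) /\ ((m < p)%nat -> 0 < D m 0)).
  { intros m; apply Dsign; [lra|]. rewrite P0; auto. }
  assert (S1 : forall m, ((q <= m)%nat -> D m 1 < 0) /\ ((m < q)%nat -> 0 < D m 1)).
  { intros m; apply Dsign; [lra|]. rewrite P1; auto. }
  destruct (Nat.lt_trichotomy p q) as [Hpq|[Hpq|Hpq]]; auto; exfalso.
  - destruct (S0 p) as [A _]; destruct (S1 p) as [_ B]. specialize (A (le_n _)); specialize (B Hpq).
    destruct (ivt_any (D p) 0 1 0) as (z & Hz & E); try lra; [intros; apply CD; auto|].
    apply (Dnz p z); auto.
  - destruct (S0 q) as [_ A]; destruct (S1 q) as [B _]. specialize (B (le_n _)); specialize (A Hpq).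
    destruct (ivt_any (D q) 0 1 0) as (z & Hz & E); try lra; [intros; apply CD; auto|].
    apply (Dnz q z); auto.
Qed.

(** * The characteristic equation *)

Lemma mu_cases (d l : nat) : (2 <= d)%nat ->
  exists n, mu d l = INR n \/ mu d l = INR n + 1 / 2.
Proof.
  intros Hd; unfold mu, nu.
  destruct (Nat.Even_or_Odd d) as [[e He]|[e He]].
  - exists (l + (e - 1))%nat; left.
    rewrite He, plus_INR, minus_INR, mult_INR by lia; simpl; field.
  - exists (l + (e - 1))%nat; right.
    rewrite He, !plus_INR, minus_INR, mult_INR by lia; simpl; field.
Qed.

(** u = r^(-nu) Z(k r); by the first equation of the Bessel system [bessel_g] is its r-derivative.
    In these terms [bc1] and [bc2] are the boundary operators - u' + a u and u' + b u. *)
Definition bessel_f (d l : nat) (Z : R -> R -> R) (r k : R) : R :=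
  Rpower r (- nu d) * Z (mu d l) (k * r).
Definition bessel_g (d l : nat) (Z : R -> R -> R) (r k : R) : R :=
  Rpower r (- nu d) * (INR l / r * Z (mu d l) (k * r) - k * Z (mu d l + 1) (k * r)).

Lemma bc1_eq (d l : nat) (R1 a k : R) (Z : R -> R -> R) :
  bc1 d l R1 Z a k = a * bessel_f d l Z R1 k - bessel_g d l Z R1 k.
Proof. unfold bc1, bessel_f, bessel_g; ring. Qed.

Lemma bc2_eq (d l : nat) (R2 b k : R) (Z : R -> R -> R) :
  bc2 d l R2 Z b k = bessel_g d l Z R2 k + b * bessel_f d l Z R2 k.
Proof. unfold bc2, bessel_f, bessel_g; ring. Qed.

Lemma bessel_fg_analytic (d l : nat) (Z : R -> R -> R) (r k : R) : 0 < r -> 0 < k ->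
  bessel_system (mu d l) (Z (mu d l)) (Z (mu d l + 1)) ->
  analytic_at (bessel_f d l Z r) k /\ analytic_at (bessel_g d l Z r) k.
Proof.
  intros Hr Hk HZ.
  assert (Hrk : 0 < r * k) by (apply Rmult_lt_0_compat; auto).
  destruct (bessel_system_analytic _ _ _ _ HZ Hrk) as [A0 A1].
  apply analytic_at_scale in A0; [|lra]. apply analytic_at_scale in A1; [|lra].
  assert (B0 : analytic_at (fun k => Z (mu d l) (k * r)) k).
  { apply (analytic_at_ext (fun k => Z (mu d l) (r * k))); auto.
    apply filter_forall; intros x; f_equal; apply Rmult_comm. }
  assert (B1 : analytic_at (fun k => Z (mu d l + 1) (k * r)) k).
  { apply (analytic_at_ext (fun k => Z (mu d l + 1) (r * k))); auto.
    apply filter_forall; intros x; f_equal; apply Rmult_comm. }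
  split.
  - apply (analytic_at_mult (fun _ => Rpower r (- nu d)) (fun k => Z (mu d l) (k * r)));
      auto using analytic_at_const.
  - apply (analytic_at_mult (fun _ => Rpower r (- nu d))
      (fun k => INR l / r * Z (mu d l) (k * r) - k * Z (mu d l + 1) (k * r))); auto using analytic_at_const.
    apply (analytic_at_minus (fun k => INR l / r * Z (mu d l) (k * r)) (fun k => k * Z (mu d l + 1) (k * r))).
    + apply (analytic_at_mult (fun _ => INR l / r) (fun k => Z (mu d l) (k * r))); auto using analytic_at_const.
    + apply (analytic_at_mult (fun k => k) (fun k => Z (mu d l + 1) (k * r))); auto using analytic_at_id.
Qed.

Lemma Delta_coefficients (d l : nat) (R1 R2 : R) :
  exists F0 F1 F2 F3 : R -> R,
    (forall k a b, Delta_l d l R1 R2 k a b = F0 k + a * F1 k + b * F2 k + a * b * F3 k) /\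
    (forall k, 0 < R1 -> 0 < R2 -> 0 < k ->
       bessel_system (mu d l) (bessel_J (mu d l)) (bessel_J (mu d l + 1)) ->
       bessel_system (mu d l) (bessel_Y (mu d l)) (bessel_Y (mu d l + 1)) ->
       analytic_at F0 k /\ analytic_at F1 k /\ analytic_at F2 k /\ analytic_at F3 k).
Proof.
  set (fJ := bessel_f d l bessel_J). set (gJ := bessel_g d l bessel_J).
  set (fY := bessel_f d l bessel_Y). set (gY := bessel_g d l bessel_Y).
  exists (fun k => gY R1 k * gJ R2 k - gJ R1 k * gY R2 k),
         (fun k => fJ R1 k * gY R2 k - fY R1 k * gJ R2 k),
         (fun k => gY R1 k * fJ R2 k - gJ R1 k * fY R2 k),
         (fun k => fJ R1 k * fY R2 k - fY R1 k * fJ R2 k).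
  split.
  - intros k a b; unfold Delta_l; rewrite !bc1_eq, !bc2_eq; fold fJ gJ fY gY; ring.
  - intros k H1 H2 Hk HJ HY.
    destruct (bessel_fg_analytic d l bessel_J R1 k H1 Hk HJ) as [A1 A2].
    destruct (bessel_fg_analytic d l bessel_J R2 k H2 Hk HJ) as [A3 A4].
    destruct (bessel_fg_analytic d l bessel_Y R1 k H1 Hk HY) as [A5 A6].
    destruct (bessel_fg_analytic d l bessel_Y R2 k H2 Hk HY) as [A7 A8].
    fold fJ in A1, A3; fold gJ in A2, A4; fold fY in A5, A7; fold gY in A6, A8.
    repeat split; apply analytic_at_minus; apply analytic_at_mult; auto.
Qed.

(* [U a k, V a k] are the value and slope at R2 of the solution starting from
   (1, a) at R1. *)
Lemma dirichlet_data (d l : nat) (R1 R2 : R) : (2 <= d)%nat -> 0 < R1 -> R1 < R2 ->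
  exists (c w : R) (U V Uk Vk : R -> R -> R),
    c <> 0 /\ 0 < w /\
    (forall k a b, Delta_l d l R1 R2 k a b = c * (V a k + b * U a k)) /\
    (forall a k, U a k = U 0 k + a * (U 1 k - U 0 k)) /\
    (forall a k, V a k = V 0 k + a * (V 1 k - V 0 k)) /\
    (forall a b k, 0 < k -> U a k * V b k - V a k * U b k = (b - a) * w) /\
    (forall a k, 0 < k -> is_derive (U a) k (Uk a k)) /\
    (forall a k, 0 < k -> is_derive (V a) k (Vk a k)) /\
    (forall a k, 0 < k -> U a k * Vk a k - V a k * Uk a k < 0) /\
    (forall k, 0 < k -> continuous (Uk 0) k) /\
    (forall k, 0 < k -> continuous (Vk 0) k) /\
    (forall a, 0 < a -> exists kap, 0 < kap /\ forall k, 0 < k < kap -> 0 < U a k /\ 0 < V a k) /\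
    (exists kap, 0 < kap /\ forall k, 0 < k < kap ->
       0 < U 0 k /\ ((0 < l)%nat -> 0 < V 0 k) /\ (~ (0 < l)%nat -> V 0 k < 0)) /\
    (forall (m : nat) K, exists k, K < k /\ 0 < k /\ (-1) ^ m * U 0 k < 0) /\
    (forall k, 0 < k -> (SL_eigenvalue d l R1 R2 0 0 (k ^ 2) <-> V 0 k = 0)).
Proof.
  intros Hd HR1 HR12.
  destruct (mu_cases d l Hd) as [n0 Hmu].
  destruct (bessel_pair (mu d l) n0 Hmu) as (HJ & HY & C & HC & HCx).
  set (f1 := bessel_f d l bessel_J). set (g1 := bessel_g d l bessel_J).
  set (f2 := bessel_f d l bessel_Y). set (g2 := bessel_g d l bessel_Y).
  set (n := (d - 1)%nat). set (Lam := INR l * (INR l + INR d - 2)).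
  assert (Hn : INR n = 2 * nu d + 1) by (unfold n, nu; rewrite minus_INR by lia; simpl; field).
  assert (Hd2 : 2 <= INR d) by (apply (le_INR 2); auto).
  assert (S1 : radial_solution n (nu d) Lam f1 g1) by (apply (radial_of_bessel d l (mu d l)); auto).
  assert (S2 : radial_solution n (nu d) Lam f2 g2) by (apply (radial_of_bessel d l (mu d l)); auto).
  assert (HW : forall r k, 0 < r -> 0 < k -> r ^ n * (f1 r k * g2 r k - g1 r k * f2 r k) = C).
  { intros r k Hr Hk.
    apply (radial_bessel_wronskian d l (nu d) C (bessel_J (mu d l)) (bessel_J (mu d l + 1))); auto. }
  assert (HR1n : 0 < R1 ^ n) by (apply pow_lt; auto).
  assert (HR2n : 0 < R2 ^ n) by (apply pow_lt; lra).
  set (U := fun a k => rU n C R1 f1 g1 f2 g2 a R2 k).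
  set (V := fun a k => rV n C R1 f1 g1 f2 g2 a R2 k).
  set (Uk := fun a k => rUk n (nu d) Lam C R1 f1 g1 f2 g2 a R2 k).
  set (Vk := fun a k => rVk n (nu d) Lam C R1 f1 g1 f2 g2 a R2 k).
  assert (HR2 : 0 < R2) by lra.
  assert (HLam : 0 < Lam <-> (0 < l)%nat).
  { unfold Lam; split.
    - intros H; destruct l; [simpl in H; lra|lia].
    - intros H. assert (1 <= INR l) by (apply (le_INR 1); auto). nra. }
  assert (HLam0 : ~ (0 < l)%nat -> Lam = 0).
  { intros H; unfold Lam; replace l with 0%nat by lia; simpl; ring. }
  assert (HsmallL : 0 < Lam -> forall a, 0 <= a ->
    forall k, 0 < k < Rmin 1 (Lam / R2 ^ 2) -> 0 < U a k /\ 0 < V a k).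
  { intros HL a Ha k [Hk Hkk].
    apply (small_k_positive n (nu d) Lam C R1 R2 f1 g1 f2 g2); auto.
    assert (M1 := Rmin_l 1 (Lam / R2 ^ 2)). assert (M2 := Rmin_r 1 (Lam / R2 ^ 2)).
    apply Rle_lt_trans with k; [simpl; nra|lra]. }
  assert (HminL : 0 < Lam -> 0 < Rmin 1 (Lam / R2 ^ 2)).
  { intros HL; apply Rmin_pos; [lra|]. apply Rdiv_lt_0_compat; auto. apply pow_lt; auto. }
  (* C / R1^n relates the combination of J and Y in [Delta_l] to the solution normalised at R1; w is
     the Wronskian at R1 carried to R2 by the weight r^n. *)
  exists (C / R1 ^ n), (R1 ^ n / R2 ^ n), U, V, Uk, Vk.
  assert (HC' : C / R1 ^ n <> 0).
  { unfold Rdiv; apply Rmult_integral_contrapositive; split; auto. apply Rinv_neq_0_compat; lra. }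
  split; [exact HC'|].
  split; [apply Rdiv_lt_0_compat; auto|].
  split.
  { intros k a b; unfold Delta_l; rewrite !bc1_eq, !bc2_eq; fold f1 g1 f2 g2.
    unfold U, V, rU, rV, rP, rQ; field; lra. }
  split; [intros a k; unfold U, rU, rP, rQ; ring|].
  split; [intros a k; unfold V, rV, rP, rQ; ring|].
  split.
  { intros a b k Hk.
    assert (E := radial_wronskian n C R1 f1 g1 f2 g2 HC HR1 HW a b R2 k HR2 Hk).
    fold (U a k) (U b k) (V a k) (V b k) in E.
    apply (Rmult_eq_reg_l (R2 ^ n)); [|lra]. rewrite E; field; lra. }
  split; [intros a k Hk; apply (rU_derive_k n (nu d) Lam C R1 f1 g1 f2 g2 HR1 S1 S2 a R2 k HR2 Hk)|].
  split; [intros a k Hk; apply (rU_derive_k n (nu d) Lam C R1 f1 g1 f2 g2 HR1 S1 S2 a R2 k HR2 Hk)|].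
  split; [intros a k Hk; apply (lagrange_neg n (nu d) Lam C R1 R2 f1 g1 f2 g2); auto|].
  split; [intros k Hk; apply (rUk_continuous n (nu d) Lam C R1 f1 g1 f2 g2 HR1 S1 S2 0 R2 k HR2 Hk)|].
  split; [intros k Hk; apply (rUk_continuous n (nu d) Lam C R1 f1 g1 f2 g2 HR1 S1 S2 0 R2 k HR2 Hk)|].
  split.
  { intros a Ha. destruct (classic (0 < l)%nat) as [Hl|Hl].
    - apply HLam in Hl. exists (Rmin 1 (Lam / R2 ^ 2)); split; auto.
      intros k Hk; apply HsmallL; auto; lra.
    - destruct (small_k_zero_Lam n (nu d) Lam C R1 R2 f1 g1 f2 g2) with (a := a) as (kap & Hkap & H); auto; [lra|].
      exists kap; split; auto. intros k Hk; destruct (H k Hk) as (X & Y & _); split; auto; apply Y; auto. }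
  split.
  { destruct (classic (0 < l)%nat) as [Hl|Hl].
    - assert (HL := proj2 HLam Hl). exists (Rmin 1 (Lam / R2 ^ 2)); split; auto.
      intros k Hk; destruct (HsmallL HL 0 (Rle_refl 0) k Hk) as [X Y]; tauto.
    - destruct (small_k_zero_Lam n (nu d) Lam C R1 R2 f1 g1 f2 g2) with (a := 0) as (kap & Hkap & H); auto; [lra|].
      exists kap; split; auto. intros k Hk; destruct (H k Hk) as (X & _ & Y).
      split; [exact X|split; [tauto|intros _; apply Y; auto]]. }
  split.
  { intros m K. destruct (oscillation_bound n Lam R1 R2 HR1 HR12) as [M HM].
    set (w1 := Rpower R1 (INR n / 2)) in *. set (w2 := Rpower R2 (INR n / 2)) in *.
    assert (Hw1 : 0 < w1) by apply Rpower_pos. assert (Hw2 : 0 < w2) by apply Rpower_pos.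
    (* k > B ensures k > K, k >= 1 and k w1 > |M|, so the main term of [oscillation_bound]
       dominates. *)
    set (B := Rabs K + 1 + Rabs M / w1). 
    assert (HB : Rabs M / w1 >= 0).
    { apply Rle_ge, Rdiv_le_0_compat; auto using Rabs_pos. }
    assert (HB0 : 0 <= (R2 - R1) * B).
    { apply Rmult_le_pos; [lra|]. unfold B; assert (H := Rabs_pos K); lra. }
    destruct (nfloor_ex ((R2 - R1) * B) HB0) as [N [_ HN]].
    (* At least N + 1, and of parity opposite to m, so that (-1)^m' = - (-1)^m. *)
    set (m' := S (m + 2 * N)).
    set (k := INR m' * PI / (R2 - R1)).
    assert (HPI : 1 <= PI) by (assert (H := PI2_1); lra).
    assert (Hm' : INR N + 1 <= INR m').
    { rewrite <- S_INR; apply le_INR; unfold m'; lia. }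
    assert (HkB : B < k).
    { unfold k. apply (Rmult_lt_reg_r (R2 - R1)); [lra|].
      replace (INR m' * PI / (R2 - R1) * (R2 - R1)) with (INR m' * PI) by (field; lra).
      assert (INR m' * 1 <= INR m' * PI) by (apply Rmult_le_compat_l; [apply pos_INR|auto]). lra. }
    assert (HKk : Rabs K + 1 < k) by (unfold B in HkB; lra).
    assert (HK0 := Rabs_pos K). assert (HK1 := Rle_abs K).
    exists k; split; [lra|split; [lra|]].
    assert (Hk : 0 < k) by lra.
    assert (E := HM k (fun r => rU n C R1 f1 g1 f2 g2 0 r k) (fun r => rV n C R1 f1 g1 f2 g2 0 r k) ltac:(lra)).
    specialize (E ltac:(intros r Hr; split; [apply (rU_derive n (nu d) Lam C R1 f1 g1 f2 g2 S1 S2)|apply (rV_derive n (nu d) Lam C R1 f1 g1 f2 g2 S1 S2)]; lra)).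
    specialize (E (rU_R1 n C R1 f1 g1 f2 g2 HC HR1 HW 0 k Hk) (rV_R1 n C R1 f1 g1 f2 g2 HC HR1 HW 0 k Hk) m').
    specialize (E ltac:(unfold k; field; lra)). cbv beta in E. fold (U 0 k) in E.
    assert (HkM : Rabs M < k * w1).
    { apply Rle_lt_trans with (Rabs M / w1 * w1); [right; field; lra|].
      apply Rmult_lt_compat_r; auto. unfold B in HkB; lra. }
    assert (HMa := Rle_abs M).
    assert (Es : (-1) ^ m' = - (-1) ^ m).
    { unfold m'; rewrite <- tech_pow_Rmult, pow_add, pow_1_even; ring. }
    rewrite Es in E.
    assert (X : 0 < k * w2 * (- ((-1) ^ m * U 0 k))) by lra.
    assert (0 < k * w2) by (apply Rmult_lt_0_compat; auto).
    assert (0 < - ((-1) ^ m * U 0 k)); [|lra].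
    apply (Rmult_lt_reg_l (k * w2)); auto. rewrite Rmult_0_r; exact X. }
  intros k Hk.
  apply (neumann_positive d l C R1 R2 f1 g1 f2 g2 k); auto.
Qed.

(* k p is the root k_(l,p+1) : indices start at 0. *)
Theorem theorem3p1 :
  forall (d l : nat) (R1 R2 : R),
    (2 <= d)%nat -> 0 < R1 -> R1 < R2 ->
    exists k : nat -> R -> R -> R,
      (forall a1 a2, 0 < a1 -> 0 < a2 ->
         (forall p, 0 < k p a1 a2) /\
         (forall p, k p a1 a2 < k (S p) a1 a2) /\
         (forall x, 0 < x ->
            (Delta_l d l R1 R2 x a1 a2 = 0 <-> exists p, x = k p a1 a2)) /\
         (forall p,
            ex_derive (fun x => Delta_l d l R1 R2 x a1 a2) (k p a1 a2) /\
            Derive (fun x => Delta_l d l R1 R2 x a1 a2) (k p a1 a2) <> 0) /\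
         is_lim_seq (fun p => k p a1 a2) p_infty) /\
      (forall p a1 a2, 0 < a1 -> 0 < a2 ->
         analytic2_at (k p) a1 a2 /\
         ex_derive (fun a => k p a a2) a1 /\ 0 < Derive (fun a => k p a a2) a1 /\
         ex_derive (fun a => k p a1 a) a2 /\ 0 < Derive (fun a => k p a1 a) a2) /\
      (exists kN : nat -> R,
         0 <= kN 0%nat /\
         (forall p, kN p < kN (S p)) /\
         (forall lam, SL_eigenvalue d l R1 R2 0 0 lam <->
                      exists p, lam = kN p ^ 2) /\
         (forall p, tends_at_corner (k p) (kN p)) /\
         (forall g, is_branch d l R1 R2 g ->
            exists! p, tends_at_corner g (kN p)) /\
         (forall g p, is_branch d l R1 R2 g -> tends_at_corner g (kN p) ->
            forall a1 a2, 0 < a1 -> 0 < a2 -> g a1 a2 = k p a1 a2)).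
Proof.
  intros d l R1 R2 Hd HR1 HR12.
  destruct (dirichlet_data d l R1 R2 Hd HR1 HR12) as
    (c & w & U & V & Uk & Vk & Hc & Hw & HDelta & HUaff & HVaff & Hwr & HUd & HVd & Hneg
     & HUkc & HVkc & Hsmall & Hsmall0 & Hosc & Hneu).
  destruct (phase_exists U V Uk Vk w Hw HUaff HVaff Hwr HUd HVd Hneg HUkc HVkc Hsmall) as
    (Theta & Tpol & Tc & Td & Tab & Tinf & Tpos & Tcor); auto.
  { destruct Hsmall0 as (kap & Hkap & H0); exists kap; split; auto. intros k Hk; apply (H0 k Hk). }
  set (F := fun k a b => V a k + b * U a k).
  assert (HF : forall k a b, 0 < k -> (F k a b = 0 <-> sin (Theta k a b) = 0)).
  { intros k a b Hk; destruct (Tpol k a b Hk) as (rho & Hrho & _ & E). fold (F k a b) in E. rewrite E.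
    split; intros Hz; [|rewrite Hz; ring].
    apply Rmult_integral in Hz; destruct Hz; auto; lra. }
  assert (HDF : forall k a b, Delta_l d l R1 R2 k a b = 0 <-> F k a b = 0).
  { intros k a b; rewrite HDelta; fold (F k a b). split; intros Hz; [|rewrite Hz; ring].
    apply Rmult_integral in Hz; tauto. }
  destruct (roots_exist Theta Tc Td Tinf Tpos) as [K HK].
  assert (HKpos : forall p a b, 0 < a -> 0 < b -> 0 < K p a b) by (intros; apply HK; auto).
  assert (HKroot : forall p a b, 0 < a -> 0 < b -> F (K p a b) a b = 0).
  { intros p a b Ha Hb. destruct (HK a b Ha Hb p) as [H1 H2]. rewrite HF, H2 by auto.
    replace (- INR p * PI) with (- (INR p * PI)) by ring. rewrite sin_neg.
    destruct (sin_cos_nat_PI p) as [-> _]; ring. }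
  assert (Hiff : forall a b, 0 < a -> 0 < b -> forall x, 0 < x ->
    (Delta_l d l R1 R2 x a b = 0 <-> exists p, x = K p a b)).
  { intros a b Ha Hb x Hx; rewrite HDF.
    apply (root_iff F Theta HF Td a b (fun p => K p a b)); auto.
    apply phase_lt_PI; auto. destruct (Tpos a b Ha Hb) as (kap & Hkap & H).
    exists kap; split; auto. intros k Hk; apply (H k Hk). }
  assert (Hinc : forall a b, 0 < a -> 0 < b -> forall p, K p a b < K (S p) a b).
  { intros a b Ha Hb. apply (roots_increasing Theta Td a b (fun p => K p a b)); auto. }
  assert (HFd : forall k a b, 0 < k -> is_derive (fun k => F k a b) k (Vk a k + b * Uk a k)).
  { intros k a b Hk. apply (is_derive_plus (V a) (fun k => b * U a k)); auto. apply is_derive_scal; auto. }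
  (* At a root V = - b U, so the sign in Lagrange's identity becomes U F_k < 0. This gives
     simplicity and, later, the sign of the derivatives of the roots. *)
  assert (Hslope : forall k a b, 0 < k -> F k a b = 0 -> U a k * (Vk a k + b * Uk a k) < 0).
  { intros k a b Hk HFz. unfold F in HFz. assert (H := Hneg a k Hk).
    replace (V a k) with (- b * U a k) in H by lra. lra. }
  assert (HDd : forall k a b, 0 < k ->
    is_derive (fun x => Delta_l d l R1 R2 x a b) k (c * (Vk a k + b * Uk a k))).
  { intros k a b Hk. apply (is_derive_ext (fun x => c * F x a b)); [intros; symmetry; apply HDelta|].
    apply is_derive_scal; auto. }
  assert (Hsl0 : forall p a b, 0 < a -> 0 < b -> Vk a (K p a b) + b * Uk a (K p a b) <> 0).
  { intros p a b Ha Hb E. assert (H := Hslope _ a b (HKpos p a b Ha Hb) (HKroot p a b Ha Hb)).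
    rewrite E in H; lra. }
  assert (HKc : forall p a0 b0, 0 < a0 -> 0 < b0 -> forall eps, 0 < eps -> exists del, 0 < del /\
    forall a b, 0 < a -> 0 < b -> Rabs (a - a0) < del -> Rabs (b - b0) < del ->
      Rabs (K p a b - K p a0 b0) < eps).
  { intros p a0 b0 Ha0 Hb0. apply (phase_trap Theta Td Tab a0 b0 (K p a0 b0) (- INR p * PI)).
    - intros a b Ha Hb; apply HK; auto.
    - intros x Hx; destruct (HK a0 b0 Ha0 Hb0 p) as [A <-]. split; intros Hlt; apply Td; auto.
    - left; auto. }
  assert (HKnear : forall p a0 b0, 0 < a0 -> 0 < b0 -> forall eps, 0 < eps -> exists del, 0 < del /\
    forall s t, Rabs s < del -> Rabs t < del -> 0 < a0 + s /\ 0 < b0 + t /\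
      Rabs (K p (a0 + s) (b0 + t) - K p a0 b0) < eps).
  { intros p a0 b0 Ha0 Hb0 eps Heps. destruct (HKc p a0 b0 Ha0 Hb0 eps Heps) as (del & Hdel & H).
    exists (Rmin del (Rmin a0 b0)); split; [repeat apply Rmin_pos; auto|]. intros s t Hs Ht.
    assert (M1 := Rmin_l del (Rmin a0 b0)). assert (M2 := Rmin_r del (Rmin a0 b0)).
    assert (M3 := Rmin_l a0 b0). assert (M4 := Rmin_r a0 b0).
    assert (Hs' := Rabs_def2 _ _ Hs). assert (Ht' := Rabs_def2 _ _ Ht).
    split; [lra|split; [lra|]]. apply H; try lra.
    - replace (a0 + s - a0) with s by ring; lra.
    - replace (b0 + t - b0) with t by ring; lra. }
  exists K; split; [|split].
  - intros a b Ha Hb. split; [auto|split; [auto|split; [auto|split]]].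
    + intros p. assert (D := HDd (K p a b) a b (HKpos p a b Ha Hb)). split; [eexists; exact D|].
      assert (E : Derive (fun x : R => Delta_l d l R1 R2 x a b) (K p a b) = _) by (apply is_derive_unique; exact D).
      rewrite E. apply Rmult_integral_contrapositive; split; auto.
    + apply (roots_unbounded Theta Td a b (fun p => K p a b)); auto.
  - intros p a b Ha Hb.
    set (k0 := K p a b). assert (Hk0 : 0 < k0) by (apply HKpos; auto).
    assert (HF0 : F k0 a b = 0) by (apply HKroot; auto).
    assert (HUS := Hslope k0 a b Hk0 HF0).
    assert (HS0 : Vk a k0 + b * Uk a k0 <> 0) by (apply Hsl0; auto).
    assert (Hloc : forall x0 : R, 0 < x0 -> locally x0 (fun x => 0 < x)) by (intros; apply open_gt; auto).
    assert (Ca : continuous (fun a => K p a b) a).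
    { intros P [eps HP]. destruct (HKnear p a b Ha Hb eps (cond_pos eps)) as (del & Hdel & H).
      exists (mkposreal _ Hdel). intros y Hy. apply HP.
      destruct (H (y - a) 0) as (_ & _ & H1); [exact Hy|rewrite Rabs_R0; auto|].
      rewrite (Rplus_minus a y), Rplus_0_r in H1. exact H1. }
    assert (Cb : continuous (fun b => K p a b) b).
    { intros P [eps HP]. destruct (HKnear p a b Ha Hb eps (cond_pos eps)) as (del & Hdel & H).
      exists (mkposreal _ Hdel). intros y Hy. apply HP.
      destruct (H 0 (y - b)) as (_ & _ & H1); [rewrite Rabs_R0; auto|exact Hy|].
      rewrite (Rplus_minus b y), Rplus_0_r in H1. exact H1. }
    assert (Da : is_derive (fun a => K p a b) a
       (- (V 1 k0 - V 0 k0 + b * (U 1 k0 - U 0 k0)) / (Vk a k0 + b * Uk a k0))).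
    (* [Vk] and [Uk] are known only as derivatives; that their combination is affine in a follows
       from uniqueness of the derivative. *)
    { assert (Es : Vk a k0 + b * Uk a k0
        = Vk 0 k0 + b * Uk 0 k0 + a * (Vk 1 k0 - Vk 0 k0 + b * (Uk 1 k0 - Uk 0 k0))).
      { assert (D1 : is_derive (fun k => F k 0 b + a * (F k 1 b - F k 0 b)) k0 (Vk a k0 + b * Uk a k0)).
        { apply (is_derive_ext (fun k => F k a b)); [|apply HFd; auto].
          intros t; unfold F; change (V a t + b * U a t = V 0 t + b * U 0 t + a * (V 1 t + b * U 1 t - (V 0 t + b * U 0 t))).
          rewrite (HVaff a), (HUaff a); ring. }
        assert (D2 : is_derive (fun k => F k 0 b + a * (F k 1 b - F k 0 b)) k0
          (Vk 0 k0 + b * Uk 0 k0 + a * (Vk 1 k0 + b * Uk 1 k0 - (Vk 0 k0 + b * Uk 0 k0)))).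
        { apply (is_derive_plus (fun k => F k 0 b) (fun k => a * (F k 1 b - F k 0 b))); [apply HFd; auto|].
          apply is_derive_scal, (is_derive_minus (fun k => F k 1 b) (fun k => F k 0 b)); apply HFd; auto. }
        apply is_derive_unique in D1; apply is_derive_unique in D2. rewrite D1 in D2. rewrite D2; ring. }
      assert (HI := implicit_derive (fun k => F k 0 b) (fun k => V 1 k - V 0 k + b * (U 1 k - U 0 k))
        (fun a => K p a b) a (Vk 0 k0 + b * Uk 0 k0) (Vk 1 k0 - Vk 0 k0 + b * (Uk 1 k0 - Uk 0 k0)) Ca).
      cbv beta in HI. fold k0 in HI. rewrite <- Es in HI. apply HI; auto.
      - apply (is_derive_plus (fun k => V 1 k - V 0 k) (fun k => b * (U 1 k - U 0 k))).
        + apply (is_derive_minus (V 1) (V 0)); auto.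
        + apply is_derive_scal, (is_derive_minus (U 1) (U 0)); auto.
      - generalize (Hloc a Ha). apply filter_imp; intros y Hy.
        assert (Z := HKroot p y b Hy Hb). unfold F in *. rewrite (HVaff y), (HUaff y) in Z. lra. }
    assert (Db : is_derive (fun b => K p a b) b (- U a k0 / (Vk a k0 + b * Uk a k0))).
    { apply (implicit_derive (V a) (U a) (fun b => K p a b) b (Vk a k0) (Uk a k0) Cb); auto.
      generalize (Hloc b Hb). apply filter_imp; intros y Hy. apply (HKroot p a y Ha Hy). }
    (* By U F_k < 0, the derivative - F_a / F_k has the sign of U F_a, and likewise for b; these two
       products are w and U^2. *)
    assert (Hsign : forall q, 0 < U a k0 * q -> 0 < - q / (Vk a k0 + b * Uk a k0)).
    { intros q Hq. set (s := Vk a k0 + b * Uk a k0) in *.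
      assert (HU0 : U a k0 <> 0) by (intros E; rewrite E in HUS; lra).
      assert (HU2 : 0 < U a k0 * U a k0) by nra.
      replace (- q / s) with ((U a k0 * q) * (- (U a k0 * s)) / ((U a k0 * U a k0) * (s * s))) by (field; auto).
      apply Rdiv_lt_0_compat; apply Rmult_lt_0_compat; try lra. nra. }
    split; [|split; [eexists; exact Da|split; [|split; [eexists; exact Db|]]]].
    + destruct (Delta_coefficients d l R1 R2) as (F0 & F1 & F2 & F3 & EF & HA).
      destruct (mu_cases d l Hd) as [n0 Hmu].
      destruct (bessel_pair (mu d l) n0 Hmu) as (HJ & HY & _).
      destruct (HA k0 HR1 ltac:(lra) Hk0 HJ HY) as (A0 & A1 & A2 & A3).
      apply (implicit_analytic F0 F1 F2 F3 (K p) a b (c * (Vk a k0 + b * Uk a k0))); auto.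
      * apply (is_derive_ext (fun x => Delta_l d l R1 R2 x a b)); [intros; apply EF|].
        apply HDd; auto.
      * intros eps Heps; destruct (HKnear p a b Ha Hb eps Heps) as (del & Hdel & H).
        exists del; split; auto. intros s t Hs Ht; apply H; auto.
      * destruct (HKnear p a b Ha Hb 1 Rlt_0_1) as (del & Hdel & H).
        exists del; split; auto. intros s t Hs Ht; cbv zeta. destruct (H s t Hs Ht) as (P1 & P2 & _).
        rewrite <- EF. apply HDF, HKroot; auto.
    + assert (ED : Derive (fun x : R => K p x b) a = _) by (apply is_derive_unique; exact Da).
      rewrite ED. apply Hsign.
      (* The Wronskian of the solutions of slopes a and a + 1 is w; since they are affine in the
         slope, it reduces to a bracket with the increments in a. *)
      assert (E := Hwr a (a + 1) k0 Hk0). rewrite (HUaff (a + 1)), (HVaff (a + 1)) in E.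
      assert (E0 := HVaff a k0). assert (E1 := HUaff a k0). unfold F in HF0.
      assert (X : U a k0 * (V 1 k0 - V 0 k0) - V a k0 * (U 1 k0 - U 0 k0) = w).
      { transitivity (U a k0 * (V 0 k0 + (a + 1) * (V 1 k0 - V 0 k0)) - V a k0 * (U 0 k0 + (a + 1) * (U 1 k0 - U 0 k0))
          - (U a k0 * (V 0 k0 + a * (V 1 k0 - V 0 k0)) - V a k0 * (U 0 k0 + a * (U 1 k0 - U 0 k0)))); [ring|].
        rewrite E, <- E0, <- E1; ring. }
      replace (V a k0) with (- b * U a k0) in X by lra. lra.
    + assert (ED : Derive (fun x : R => K p a x) b = _) by (apply is_derive_unique; exact Db).
      rewrite ED. apply Hsign.
      assert (U a k0 <> 0) by (intros E; rewrite E in HUS; lra). nra.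
  (* The parameter [positive] is l > 0: the sign of V 0 for small k decides whether the corner phase
     starts above or below 0. *)
  - destruct (neumann_roots F Theta HF Tc Td Tinf Tcor (0 < l)%nat) as
      (kN & HN0 & HNinc & HNtrap & HNroot & HNp & HNz).
    { intros Hl; destruct Hsmall0 as (kap & Hkap & H0). destruct Tcor as (kap' & Hkap' & H1).
      exists (Rmin kap kap'); split; [apply Rmin_pos; auto|]. intros k [Hk Hkk].
      assert (M1 := Rmin_l kap kap'). assert (M2 := Rmin_r kap kap').
      destruct (H0 k ltac:(lra)) as (_ & HV & _). specialize (HV Hl). specialize (H1 k ltac:(lra)).
      destruct (Tpol k 0 0 Hk) as (rho & Hrho & _ & E). rewrite Rmult_0_l, Rplus_0_r in E.
      apply Rnot_le_lt; intros Hle. assert (HPI := PI_RGT_0).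
      assert (0 <= sin (- Theta k 0 0)) by (apply sin_ge_0; lra). rewrite sin_neg in H. nra. }
    { intros Hl; destruct Hsmall0 as (kap & Hkap & H0). destruct Tcor as (kap' & Hkap' & H1).
      exists (Rmin kap kap'); split; [apply Rmin_pos; auto|]. intros k [Hk Hkk].
      assert (M1 := Rmin_l kap kap'). assert (M2 := Rmin_r kap kap').
      destruct (H0 k ltac:(lra)) as (_ & _ & HV). specialize (HV Hl). specialize (H1 k ltac:(lra)).
      destruct (Tpol k 0 0 Hk) as (rho & Hrho & _ & E). rewrite Rmult_0_l, Rplus_0_r in E.
      apply Rnot_le_lt; intros Hle. assert (HPI := PI_RGT_0).
      assert (0 <= sin (Theta k 0 0)) by (apply sin_ge_0; lra). nra. }
    assert (Hcorner : forall p, tends_at_corner (K p) (kN p)).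
    { intros p; apply corner_limit_intro.
      apply (phase_trap Theta Td Tab 0 0 (kN p) (- INR p * PI)).
      - intros a b Ha Hb; apply HK; auto.
      - intros x Hx; apply HNtrap; auto.
      - clear - HN0 HNinc. induction p as [|p IH]; auto. specialize (HNinc p); lra. }
    assert (HKcont : forall p, continuous_on quadrant (fun z : R * R => K p (fst z) (snd z))).
    { intros p; apply continuous_on_forall. intros [a b] [Ha Hb] P [eps HP]; simpl in *.
      destruct (HKnear p a b Ha Hb eps (cond_pos eps)) as (del & Hdel & H).
      exists (mkposreal _ Hdel). intros [x y] [Bx By]; simpl in *. apply HP.
      destruct (H (x - a) (y - b) Bx By) as (_ & _ & H1).
      rewrite (Rplus_minus a x), (Rplus_minus b y) in H1. exact H1. }
    assert (Hbr : forall g, is_branch d l R1 R2 g -> exists p, forall a b, 0 < a -> 0 < b -> g a b = K p a b).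
    { intros g [Hg1 Hg2]. apply branch_is_root; auto.
      intros a b Ha Hb. destruct (Hg2 a b Ha Hb) as [P1 P2]. apply (Hiff a b Ha Hb _ P1); auto. }
    assert (HNmono : forall p q, (p < q)%nat -> kN p < kN q).
    { intros p q Hpq; induction Hpq as [|q Hpq IH]; auto. specialize (HNinc q); lra. }
    assert (HNinj : forall p q, kN p = kN q -> p = q).
    { intros p q E. destruct (Nat.lt_trichotomy p q) as [H|[H|H]]; auto; apply HNmono in H; lra. }
    assert (Hcan : forall g p, is_branch d l R1 R2 g -> tends_at_corner g (kN p) ->
            forall a1 a2, 0 < a1 -> 0 < a2 -> g a1 a2 = K p a1 a2).
    { intros g p Hg Ht. destruct (Hbr g Hg) as [q Hq].
      replace p with q; auto. apply HNinj, (corner_limit_unique g); auto.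
      apply (corner_limit_ext (K q)); auto. intros; symmetry; auto. }
    exists kN; split; [auto|split; [auto|split; [|split; [auto|split; [|auto]]]]].
    + assert (HNpos : forall p, 0 <= kN p).
      { intros p; induction p as [|p IH]; auto. specialize (HNinc p); lra. }
      assert (Hpositive : forall x, 0 < x -> (SL_eigenvalue d l R1 R2 0 0 (x ^ 2) <-> exists p, x = kN p)).
      { intros x Hx. rewrite Hneu, <- HNroot by auto. unfold F. rewrite Rmult_0_l, Rplus_0_r. tauto. }
      assert (Hd2 : 2 <= INR d) by (apply (le_INR 2); auto).
      intros lam; split.
      (* A positive lam is k^2 with k a root; a negative one, and 0 when l > 0, is excluded by the
         energy argument; for l = 0 the eigenvalue 0 is the square of kN 0. *)
      * intros HSL. destruct (Rtotal_order lam 0) as [Hlam|[->|Hlam]].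
        -- exfalso; revert HSL; apply neumann_not_below; auto. intros r Hr.
           assert (0 <= INR l * (INR l + INR d - 2) / r ^ 2); [|lra].
           apply Rdiv_le_0_compat; [|apply pow_lt; lra].
           assert (Hl := pos_INR l). apply Rmult_le_pos; lra.
        -- destruct (classic (0 < l)%nat) as [Hl|Hl].
           ++ exfalso; revert HSL; apply neumann_not_below; auto. intros r Hr. rewrite Rminus_0_r.
              apply Rdiv_lt_0_compat; [|apply pow_lt; lra].
              assert (1 <= INR l) by (apply (le_INR 1); auto). nra.
           ++ exists 0%nat. rewrite (HNz Hl); ring.
        -- assert (Hs : 0 < sqrt lam) by (apply sqrt_lt_R0; auto).
           assert (Es : sqrt lam ^ 2 = lam) by (apply pow2_sqrt; lra).
           rewrite <- Es in HSL. apply Hpositive in HSL; auto. destruct HSL as [p Hp].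
           exists p. rewrite <- Hp; auto.
      * intros [p ->]. destruct (HNpos p) as [Hp|Hp].
        -- apply Hpositive; eauto.
        -- assert (p = 0%nat).
           { destruct p as [|p]; auto. specialize (HNinc p); specialize (HNpos p); lra. }
           subst p. destruct (classic (0 < l)%nat) as [Hl|Hl]; [specialize (HNp Hl); lra|].
           rewrite <- Hp. replace l with 0%nat by lia. replace (0 ^ 2) with 0 by ring.
           apply neumann_zero; auto.
    + intros g Hg. destruct (Hbr g Hg) as [p Hp]. 
      assert (Ht : tends_at_corner g (kN p)).
      { apply (corner_limit_ext (K p)); auto. intros; symmetry; auto. }
      exists p; split; auto. intros q Hq. apply HNinj, (corner_limit_unique g); auto.
Qed.
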